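(* Let $E$ be a field of characteristic different from $2$ and assume that $E$ is weakly square-reflexive. Then the following hold: (i) every $5$-dimensional quadratic form over $E(X)$ is isotropic; (ii) every finite number of $3$-dimensional quadratic forms over $E(X)$ of trivial determinant represent a common element of $E(X)^\times$.
   Context: $E(X)$ is the rational function field in one variable over $E$. Quadratic forms are always regular (nondegenerate); a form is isotropic if it has a nontrivial zero. The determinant of a form $\langle a_1,\dots,a_n\rangle=a_1X_1^2+\dots+a_nX_n^2$ over a field $F$ is the class of $a_1\cdots a_n$ in $F^\times/F^{\times 2}$; it is trivial if $a_1\cdots a_n\in F^{\times 2}$. Square-reflexivity. For a commutative ring $R$ let $R^\times$ be its group of units and $R^{\times 2}=\{x^2\mid x\in R^\times\}$; an element of $R$ is square-free if it is not equal to $x^2y$ for any $x\in R\setminus R^\times$ and $y\in R$. For a nonzero $f\in E[X]$ put $E_f=E[X]/(f)$, let $\mathrm{N}_{E_f/E}:E_f\to E$ be the norm of this finite-dimensional $E$-algebra and let $\mathrm{lc}(f)$ be the leading coefficient of $f$. A square-free polynomial $f\in E[X]\setminus\{0\}$ is called square-reflexive if for every $\alpha\in E_f^\times$ with $\mathrm{N}_{E_f/E}(\alpha)\in E^{\times 2}\cup \mathrm{lc}(f)E^{\times 2}$ there exists a polynomial $g\in E[X]$ coprime to $f$ such that $g+(f)\in\alpha E_f^{\times 2}$ and $f+(g)\in E_g^{\times 2}$. The field $E$ is called weakly square-reflexive if every square-free polynomial in $E[X]$ divides a square-reflexive polynomial in $E[X]$. *)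

(* Defs.v *)
From HB Require Import structures.
From mathcomp Require Import all_boot all_order all_algebra.

Set Implicit Arguments.
Unset Strict Implicit.
Unset Printing Implicit Defensive.

Import GRing.Theory.
Local Open Scope ring_scope.

(* [GRing.unit] is only available for nontrivial rings, whereas E[X]/(f) is the
   zero ring when f is a nonzero constant; hence these definitions for possibly
   trivial commutative rings. *)
Definition is_unit (R : comPzRingType) (x : R) : Prop :=
  exists y : R, x * y = 1.

Definition is_unit_square (R : comPzRingType) (x : R) : Prop :=
  exists2 y : R, is_unit y & x = y ^+ 2.

Definition squarefree (R : comPzRingType) (a : R) : Prop :=
  forall x y : R, ~ is_unit x -> a <> x ^+ 2 * y.

(* E[X]/(f) for f != 0, of any leading coefficient and possibly constant:
   classes are represented by their unique representative of degree less than
   that of f. (The library's {poly %/ f} is E[X]/(X) unless f is monic and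
   nonconstant.) The value at f = 0 is the zero ring, a junk value. *)
Section PolyQuotient.
Variable E : fieldType.

Definition polyquot (f : {poly E}) : Type := {poly_(size f).-1 E}.

HB.instance Definition _ (f : {poly E}) := Vector.on (polyquot f).

Variable f : {poly E}.

Definition polyclass (a : {poly E}) : polyquot f :=
  npolyp (size f).-1 (a %% f).

Lemma val_polyclass (a : {poly E}) :
  f != 0 -> polyclass a = a %% f :> {poly E}.
Proof.
by move=> f0; rewrite npolypK // -ltnS prednK ?size_poly_gt0 // ltn_modp.
Qed.

Lemma polyquot0_eq (a b : polyquot f) : f = 0 -> a = b.
Proof.
move=> f0; apply/val_inj/polyP=> i.
by rewrite !big_coef_npoly // f0 size_poly0.
Qed.

Lemma modp_polyquot (a : polyquot f) :
  f != 0 -> (a : {poly E}) %% f = a.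
Proof.
move=> f0; rewrite modp_small // -[ltnRHS]prednK ?size_poly_gt0 // ltnS.
exact: size_npoly.
Qed.

Definition polyquot_mul (a b : polyquot f) : polyquot f :=
  polyclass ((a : {poly E}) * (b : {poly E})).

Fact polyquot_mulA : associative polyquot_mul.
Proof.
move=> a b c; have [f0|f0] := eqVneq f 0; first exact: polyquot0_eq.
apply/val_inj; rewrite /polyquot_mul /= !val_polyclass // modp_mul.
by rewrite [in RHS]mulrC modp_mul mulrA [in RHS]mulrC.
Qed.

Fact polyquot_mulC : commutative polyquot_mul.
Proof. by move=> a b; rewrite /polyquot_mul mulrC. Qed.

Fact polyquot_mul1 : left_id (polyclass 1) polyquot_mul.
Proof.
move=> a; have [f0|f0] := eqVneq f 0; first exact: polyquot0_eq.
apply/val_inj; rewrite /polyquot_mul /= !val_polyclass //.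
by rewrite mulrC modp_mul mulr1 modp_polyquot.
Qed.

Fact polyquot_mulDl : left_distributive polyquot_mul +%R.
Proof.
move=> a b c; have [f0|f0] := eqVneq f 0; first exact: polyquot0_eq.
by apply/val_inj; rewrite /= !val_polyclass //= mulrDl modpD.
Qed.

HB.instance Definition _ := GRing.Zmodule_isComPzRing.Build (polyquot f)
  polyquot_mulA polyquot_mulC polyquot_mul1 polyquot_mulDl.

Fact polyclass_is_zmod_morphism : zmod_morphism polyclass.
Proof.
move=> a b; have [f0|f0] := eqVneq f 0; first exact: polyquot0_eq.
by apply/val_inj; rewrite /= !val_polyclass //= modpD modpN.
Qed.

HB.instance Definition _ :=
  GRing.isZmodMorphism.Build {poly E} (polyquot f) polyclass
    polyclass_is_zmod_morphism.

Fact polyclass_is_monoid_morphism : monoid_morphism polyclass.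
Proof.
split=> // a b; have [f0|f0] := eqVneq f 0; first exact: polyquot0_eq.
rewrite -[RHS]/(polyquot_mul _ _); apply/val_inj.
by rewrite /polyquot_mul /= !val_polyclass // modp_mul [in RHS]mulrC modp_mul mulrC.
Qed.

HB.instance Definition _ :=
  GRing.isMonoidMorphism.Build {poly E} (polyquot f) polyclass
    polyclass_is_monoid_morphism.

Lemma polyclass_surj (a : polyquot f) : polyclass (a : {poly E}) = a.
Proof.
have [f0|f0] := eqVneq f 0; first exact: polyquot0_eq.
by apply/val_inj; rewrite /= val_polyclass // modp_polyquot.
Qed.

Lemma polyclass_eq0 (a : {poly E}) : f != 0 -> (polyclass a == 0) = (f %| a).
Proof. by move=> f0; rewrite -val_eqE /= val_polyclass. Qed.

(* Determinant of multiplication by a, in the basis 1, X, ..., X^(deg f - 1). *)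
Definition polyquot_norm (a : polyquot f) : E :=
  \det (\matrix_(i < (size f).-1, j < (size f).-1)
          (a * polyclass 'X^i : {poly E})`_j).

End PolyQuotient.

Definition square_reflexive (E : fieldType) (f : {poly E}) : Prop :=
  [/\ f != 0, squarefree f
    & forall a : polyquot f, is_unit a ->
        is_unit_square (polyquot_norm a) \/
        (exists2 c : E, is_unit_square c & polyquot_norm a = lead_coef f * c) ->
      exists g : {poly E},
        [/\ g != 0, coprimep g f,
            exists2 b : polyquot f, is_unit_square b & polyclass f g = a * b
          & is_unit_square (polyclass g f)]].

Definition weakly_square_reflexive (E : fieldType) : Prop :=
  forall f : {poly E}, squarefree f ->
    exists2 h : {poly E}, square_reflexive h & f %| h.

(* A regular n-dimensional quadratic form over a field of characteristic
   different from 2, given by its Gram matrix: <a_1, ..., a_n> is the diagonal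
   matrix with entries a_1, ..., a_n. *)
Record qform (F : fieldType) (n : nat) : Type := QForm {
  gram : 'M[F]_n;
  gram_sym : gram^T = gram;
  gram_regular : gram \in unitmx
}.

Definition qvalue (F : fieldType) (n : nat) (q : qform F n) (v : 'rV[F]_n) : F :=
  (v *m gram q *m v^T) 0 0.

Definition isotropic (F : fieldType) (n : nat) (q : qform F n) : Prop :=
  exists2 v : 'rV[F]_n, v != 0 & qvalue q v = 0.

Definition represents (F : fieldType) (n : nat) (q : qform F n) (c : F) : Prop :=
  exists v : 'rV[F]_n, qvalue q v = c.

(* det(P A P^T) = det(P)^2 det(A), so the class of the determinant of the Gram
   matrix is that of a_1 ... a_n for any diagonalization <a_1, ..., a_n>. *)
Definition trivial_det (F : fieldType) (n : nat) (q : qform F n) : Prop :=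
  is_unit_square (\det (gram q)).

(* Main.v *)
From HB Require Import structures.
Require Import Defs.
From mathcomp Require Import all_boot all_order all_algebra.
From mathcomp Require Import generic_quotient fingroup perm cyclic pgroup abelian finfield qfpoly.
From mathcomp Require Import ring zify.
From Stdlib Require Import Classical.

(** Write F = E(X). Up to squares, a ternary form of trivial determinant over F
is <yz, xz, xy> with x, y, z polynomials and xyz squarefree.

Part (ii). Let h be a squarefree common multiple of the products xyz attached to
the given forms, and for each of them write h = - xyzk. All the forms represent
-h as soon as each <x, y, z, -k> is isotropic over F. Let s be a residue modulo h
equal to -yz, -xz, -xy, 1 modulo x, y, z, k. If s is the class, up to squares, of
some g prime to h such that h is a square modulo g, then the congruences linking
x, y, z, k, g are what is needed to complete <x, y, z, -k> to a symmetric 6 x 6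
matrix over E[X] of determinant -1 ([gram6_exists]). The Witt index of a
unimodular form over E[X] is that of its value at any point of E
([totally_isotropic_lift]), because an anisotropic unimodular form is constant,
by Hermite's bound on minima ([hermite_bound]). A form of dimension 6 over E with
trivial discriminant is hyperbolic, since ternary forms over E are isotropic; so
the 6-dimensional form contains a totally isotropic 3-space over F, which meets
the 4-dimensional subspace <x, y, z, -k> ([common_slot]).

Square-reflexivity of h provides g provided that the norm of s is a square. By
reciprocity ([polynorm_reciprocity]) this holds when x, y, z have degrees of the
same parity ([polynorm_residues_square]), a condition at infinity. If E is
infinite, a change of variable X = r + 1/Y moves infinity to a point where the
forms are unramified, and all degrees become even ([common_value_nonroot]). If E
is finite, h is taken of odd degree and g is found by counting: over the class of
s, suitably scaled, the sum of the divisor sums of the Jacobi symbol of h is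
twice such a sum over lower degrees, which is positive, and a polynomial with
nonzero divisor sum has a square-free part modulo which h is a square
([class_square_part]).

The same lattice, evaluated at a root of k where it is visibly hyperbolic and
then reduced modulo a prime p dividing k, shows that norms a^2 - u b^2 with u prime to p
represent every unit of E[X]/(p) ([residue_norm_universal]). For p = X this says that
ternary forms over E are isotropic. It also makes every 3-fold Pfister form over
F isotropic ([pfister_isotropic_frac]): when e divides a^2 - u b^2 - v, the norm
form of the quaternion algebra (u, v), restricted to a suitable lattice and
divided by e, has determinant (uv)^2, so that Hermite's bound replaces the slot e
by one of degree at most the mean of deg u and deg v; when the three slots have
the same degree, leading coefficients can be cancelled.

Part (i). For <a, b, c, e, f> with d = abcef, part (ii) gives a common value of
abc<a, b, c> and -abc<e, f, -d>. Hence <a, b, c> = <t, m, n> and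
<t, e, f> = <d, p, q>, and the given form is <m, n, p, q, d>. As <m, n, p, q> has
trivial determinant it is similar to the norm form of a quaternion algebra, and
it represents -d because 3-fold Pfister forms are isotropic
([quinary_isotropic]). *)

Set Implicit Arguments.
Unset Strict Implicit.
Unset Printing Implicit Defensive.
Import GRing.Theory.
Local Open Scope ring_scope.

Local Notation dg p := (size (p : {poly _})).-1.
Local Notation tofrac := (@FracField.tofrac _).

(** * Symmetric forms and unimodular row reduction *)

Lemma degM (R : idomainType) (p q : {poly R}) : p != 0 -> q != 0 -> dg (p * q)%R = (dg p + dg q)%N.
Proof.
move=> p0 q0; rewrite size_mul //; move: p0 q0; rewrite -!size_poly_gt0.
by case: (size p) => // n; case: (size q) => // l; rewrite addnS.
Qed.

Section TotallyIsotropic.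
Variable R : comUnitRingType.

Definition qf n (M : 'M[R]_n) (v : 'rV[R]_n) : R := (v *m M *m v^T) 0 0.

(** The rows of W span a direct summand of rank k, split by V, on which the form vanishes. *)
Definition totally_isotropic n (M : 'M[R]_n) k : Prop :=
  exists (W : 'M[R]_(k, n)) (V : 'M[R]_(n, k)),
    W *m V = 1%:M /\ W *m M *m W^T = 0.

Lemma totally_isotropic0 n (M : 'M[R]_n) : totally_isotropic M 0.
Proof. by exists 0, 0; split; rewrite flatmx0 // [RHS]flatmx0. Qed.

Lemma totally_isotropic_congr n (M U : 'M[R]_n) k : U \in unitmx ->
  totally_isotropic (U *m M *m U^T) k <-> totally_isotropic M k.
Proof.
move=> Uu; split=> -[W [V [WV WM]]].
  exists (W *m U), (invmx U *m V); split.
    by rewrite mulmxA mulmxK.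
  by rewrite trmx_mul !mulmxA in WM *.
exists (W *m invmx U), (U *m V); split; first by rewrite mulmxA mulmxKV.
rewrite trmx_mul !mulmxA mulmxKV // -!mulmxA [X in _ *m (_ *m X)]mulmxA.
by rewrite -trmx_mul mulVmx // trmx1 mul1mx mulmxA.
Qed.

(** An orthogonal sum of M with a plane that has an isotropic basis vector. The other
basis vector keeps an arbitrary value c, so that splitting off such a plane works over
any ring with row reduction. *)
Definition plane_sum (d c : R) n (M : 'M[R]_n) : 'M[R]_(1 + (1 + n)) :=
  block_mx 0 (row_mx d%:M 0) (col_mx d%:M 0) (block_mx c%:M 0 0 M).

Lemma plane_sum_totally_isotropic d c n (M : 'M[R]_n) k :
  totally_isotropic M k -> totally_isotropic (plane_sum d c M) (1 + k).
Proof.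
case=> W [V [WV WM]].
pose W1 : 'M_(1 + k, 1 + (1 + n)) := block_mx 1%:M 0 0 (row_mx 0 W).
pose V1 : 'M_(1 + (1 + n), 1 + k) := block_mx 1%:M 0 0 (col_mx 0 V).
exists W1, V1; split.
  by rewrite mulmx_block !mulmx0 !mul0mx mulmx1 mul_row_col mul0mx WV !addr0 !add0r
             -scalar_mx_block.
rewrite /W1 /plane_sum mulmx_block !mulmx0 !mul0mx !mul1mx !addr0 !add0r.
rewrite tr_block_mx tr_row_mx !trmx0 trmx1 mulmx_block !mulmx0 !mul0mx.
rewrite mul_row_col !mul0mx mul_row_block !mulmx0 !mul0mx !addr0 !add0r.
rewrite !mulmx1 !mul_row_col !mulmx0 !mul0mx WM !addr0.
by rewrite block_mx0.
Qed.

Lemma plane_sum_det d c n (M : 'M[R]_n) :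
  \det (plane_sum d c M) = - d ^+ 2 * \det M.
Proof.
have lift0r (j : 'I_(1 + n)) : lift 0 j = rshift 1 j by apply/val_inj.
pose j0 : 'I_(1 + (1 + n)) := rshift 1 (lshift n 0).
have row0 j : plane_sum d c M (lshift _ 0) j = d *+ (j == j0).
  rewrite /plane_sum /j0; case: (split_ordP j) => j1 ->.
    by rewrite block_mxEul mxE -val_eqE /= [j1]ord1.
  rewrite block_mxEur; case: (split_ordP j1) => j2 ->.
    by rewrite row_mxEl mxE -val_eqE /= [j2]ord1.
  by rewrite row_mxEr mxE -val_eqE.
rewrite (expand_det_row _ (lshift _ 0)) (bigD1 j0) //= big1 => [|j /negPf jN]; last first.
  by rewrite row0 jN mul0r.
rewrite row0 eqxx addr0 mulr1n /cofactor.
have -> : row' (lshift _ 0) (col' j0 (plane_sum d c M)) = block_mx d%:M 0 0 M.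
  apply/matrixP => i j.
  transitivity (plane_sum d c M (lift (lshift _ 0) i) (lift j0 j)); first by rewrite 2!mxE.
  rewrite (_ : lift (lshift (1 + n) 0) i = rshift 1 i); last exact/val_inj.
  rewrite /plane_sum; case: (split_ordP j) => [j1|j1] ->; rewrite ?[j1]ord1.
    have -> : lift j0 (lshift n 0) = lshift (1 + n) 0 by apply/val_inj.
    by rewrite block_mxEdl; case: (split_ordP i) => i' ->;
       rewrite ?block_mxEul ?block_mxEdl ?col_mxEu ?col_mxEd.
  have -> : lift j0 (rshift 1 j1) = rshift 1 (rshift 1 j1) by apply/val_inj.
  by rewrite block_mxEdr; case: (split_ordP i) => i' ->;
     rewrite ?block_mxEdr ?block_mxEur ?mxE.
rewrite det_ublock det_scalar1 /= addn0 expr1.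
ring.
Qed.

End TotallyIsotropic.

Section RowReduction.

Definition row_reducible (R : comUnitRingType) : Prop :=
  forall n (v : 'rV[R]_n.+1), exists2 U : 'M[R]_n.+1, U \in unitmx &
    exists d, v *m U = d *: delta_mx 0 0.

(** Euclid's algorithm on the entries, measured by the sum of their sizes. *)
Lemma poly_row_reducible (E : fieldType) : row_reducible {poly E}.
Proof.
move=> n v; have [N] := ubnP (\sum_j size (v 0%R j)).
elim: N v => // N IH v; rewrite ltnS => leN.
have [[i [j [neq_ij vi0 vj0 le_ij]]] | noij] := classic (exists i j,
    [/\ i != j, v 0 i != 0, v 0 j != 0 & (size (v 0%R i) <= size (v 0%R j))%N]).
  pose U : 'M[{poly E}]_n.+1 := 1%:M - (v 0 j %/ v 0 i) *: delta_mx i j.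
  have Uu : U \in unitmx.
    pose V : 'M[{poly E}]_n.+1 := 1%:M + (v 0 j %/ v 0 i) *: delta_mx i j.
    have UV : U *m V = 1%:M.
      rewrite /U /V mulmxBl mul1mx mulmxDr mulmx1 -scalemxAl -scalemxAr mul_delta_mx_0 1?eq_sym //.
      by rewrite !scaler0 addr0 addrK.
    by case/mulmx1_unit: UV.
  have vU l : (v *m U) 0 l = if l == j then v 0 j %% v 0 i else v 0 l.
    rewrite mulmxBr mulmx1 -scalemxAr !mxE (bigD1 i) //= big1 ?addr0 => [|l' /negPf ne].
      rewrite !mxE eqxx /=; case: eqVneq => [->|_] /=.
        by rewrite mulr1 {1}(divp_eq (v 0 j) (v 0 i)) addrAC subrr add0r.
      by rewrite !mulr0 subr0.
    by rewrite !mxE ne mulr0.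
  case: (IH (v *m U)) => [|U' U'u [d E']].
    apply: leq_trans leN; rewrite [X in (_ < X)%N](bigD1 j) //= (bigD1 j) //=.
    rewrite vU eqxx -addSn leq_add //; first by rewrite (leq_trans _ le_ij) ?ltn_modp.
    by apply: leq_sum => l /negPf nl; rewrite vU nl.
  exists (U *m U'); first by rewrite unitmx_mul Uu.
  by exists d; rewrite mulmxA.
have [v0|/eqP/rowP nv0] := eqVneq v 0.
  by exists 1%:M; [exact: unitmx1 | exists 0; rewrite v0 mul0mx scale0r].
have [i vi0] : exists i, v 0 i != 0.
  apply: NNPP => nex; apply: nv0 => i; rewrite mxE; apply/eqP.
  by apply/negPn/negP => vi; apply: nex; exists i.
exists (tperm_mx 0 i); first exact: unitmx_perm.
exists (v 0 i); rewrite -xcolE; apply/rowP => j; rewrite !mxE eqxx /=.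
have v_neq l : l != i -> v 0 l = 0.
  move=> li; apply/eqP/negPn/negP => vl0; case: noij.
  by have [?|/ltnW ?] := leqP (size (v 0%R i)) (size (v 0%R l));
    [exists i, l | exists l, i]; rewrite // eq_sym.
case: tpermP => [->|->|/eqP j0 /eqP ji]; first by rewrite mulr1.
  case: eqVneq => [->|i0]; rewrite ?mulr1 //= mulr0.
  by rewrite v_neq // eq_sym.
by rewrite (negPf j0) mulr0 v_neq.
Qed.

Lemma unitmx_map (R S : comUnitRingType) (f : {rmorphism R -> S}) n (A : 'M[R]_n) :
  A \in unitmx -> map_mx f A \in unitmx.
Proof. by rewrite !unitmxE det_map_mx; apply: rmorph_unit. Qed.

(** The polynomial case, evaluated at 0. *)
Lemma field_row_reducible (K : fieldType) : row_reducible K.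
Proof.
move=> n v; have [U Uu [d E]] := poly_row_reducible (map_mx polyC v).
exists (map_mx (horner_eval 0) U); first exact: unitmx_map.
exists d.[0]; have := congr1 (map_mx (horner_eval 0)) E.
rewrite map_mxM map_mxZ map_delta_mx -map_mx_comp.
by rewrite [X in X *m _]map_mx_id // => a; rewrite /= /horner_eval hornerC.
Qed.
End RowReduction.

Section Splitting.
Variable R : idomainType.
Hypothesis Rred : row_reducible R.

Definition anisotropic n (M : 'M[R]_n) := forall v, qf M v = 0 -> v = 0.

Lemma qf_congr n (M U : 'M[R]_n) v : qf (U *m M *m U^T) v = qf M (v *m U).
Proof. by rewrite /qf trmx_mul !mulmxA. Qed.

Lemma qfZ n (M : 'M[R]_n) a v : qf M (a *: v) = a ^+ 2 * qf M v.
Proof.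
rewrite /qf -!scalemxAl [(_ *: v)^T]linearZ /= -scalemxAr scalerA mxE.
by rewrite expr2.
Qed.

Lemma sym_congr n (M U : 'M[R]_n) : M^T = M -> (U *m M *m U^T)^T = U *m M *m U^T.
Proof. by move=> Ms; rewrite !trmx_mul trmxK Ms mulmxA. Qed.

(** Over a ring with unimodular row reduction every vector is a multiple of a
primitive one, and primitive vectors extend to bases. *)
Lemma primitive_row n (v : 'rV[R]_n.+1) : v != 0 ->
  exists (B : 'M[R]_n.+1) d, [/\ B \in unitmx, d != 0 & v = d *: row 0 B].
Proof.
move=> v0; have [U Uu [d E]] := Rred v.
exists (invmx U), d; split; first by rewrite unitmx_inv.
  apply: contraNneq v0 => d0; rewrite d0 scale0r in E.
  by rewrite -(mulmxK Uu v) E mul0mx.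
by rewrite -(mulmxK Uu v) E -scalemxAl rowE.
Qed.

Lemma qf_delta0 n (M : 'M[R]_n.+1) : qf M (delta_mx 0 0) = M 0 0.
Proof.
by rewrite /qf -rowE trmx_delta -colE !mxE.
Qed.

Lemma block_mx00 n a (b : 'rV[R]_n) (c : 'cV_n) (C : 'M_n) : block_mx a%:M b c C 0 0 = a :> R.
Proof.
transitivity (block_mx a%:M b c C (lshift n 0) (lshift n 0)).
  by congr (fun_of_matrix _ _ _); apply/val_inj.
by rewrite block_mxEul mxE eqxx mulr1n.
Qed.

Lemma sym_block n (M : 'M[R]_(1 + n)) : M^T = M ->
  exists a b C, M = block_mx a%:M b b^T C /\ C^T = C.
Proof.
move=> Ms; exists (M 0 0), (ursubmx M), (drsubmx M).
rewrite trmx_ursub Ms; split; last by rewrite -[in LHS]Ms -trmx_drsub trmxK.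
rewrite -[LHS]submxK; congr block_mx.
rewrite [LHS]mx11_scalar; congr _%:M; rewrite !mxE; congr (M _ _); exact/val_inj.
Qed.

Lemma split_unit n (M : 'M[R]_(1 + n)) : M^T = M -> M 0 0 \in GRing.unit ->
  exists2 T : 'M[R]_(1 + n), T \in unitmx & exists2 C, C^T = C &
    T *m M *m T^T = block_mx (M 0 0)%:M 0 0 C.
Proof.
move=> Ms; have [a [b [C [ME Cs]]]] := sym_block Ms.
have -> : M 0 0 = a by rewrite ME block_mx00.
move=> au; exists (block_mx 1%:M 0 (- a^-1 *: b^T) 1%:M).
  by rewrite unitmxE det_lblock !det1 mulr1 unitr1.
exists (C - a^-1 *: (b^T *m b)).
  by rewrite linearB linearZ /= trmx_mul trmxK Cs.
have aK m1 m2 (D : 'M[R]_(m1, m2)) : a *: (- a^-1 *: D) = - D.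
  by rewrite scalerA mulrN mulrV // scaleN1r.
rewrite ME mulmx_block tr_block_mx mulmx_block !trmx0 !trmx1.
rewrite !mul0mx !mul1mx !mulmx0 !mulmx1 !addr0 [(_ *: _)^T]linearZ /= trmxK.
rewrite mul_mx_scalar mul_scalar_mx !aK !addNr mul0mx add0r.
by rewrite -scalemxAl scaleNr addrC.
Qed.

(** A primitive isotropic vector pairs with the whole lattice onto the unit ideal
because M is unimodular; a vector paired to a unit completes it to a plane, which
then splits off. *)
Lemma split_isotropic n (M : 'M[R]_(2 + n)) (v : 'rV[R]_(2 + n)) :
  M^T = M -> M \in unitmx -> v != 0 -> qf M v = 0 ->
  exists T d c C, [/\ T \in unitmx, d \in GRing.unit, C^T = C &
    T *m M *m T^T = plane_sum d c C].
Proof.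
move=> Ms Mu v0 qv; have [B [d [Bu d0 vE]]] := primitive_row v0.
pose M1 : 'M_(1 + (1 + n)) := B *m M *m B^T.
have M1u : M1 \in unitmx by rewrite !unitmx_mul unitmx_tr Bu Mu.
have M1s : M1^T = M1 by apply: sym_congr.
have M100 : M1 0 0 = 0.
  rewrite -qf_delta0 qf_congr -rowE; apply/eqP.
  have := qv; rewrite vE qfZ => /eqP; rewrite mulf_eq0 expf_eq0 /= (negPf d0).
  by [].
have [a [b [C [M1E Cs]]]] := sym_block M1s.
have a0 : a = 0 by rewrite -M100 M1E block_mx00.
have [U Uu [e bU]] := Rred b.
pose T1 : 'M[R]_(1 + (1 + n)) := block_mx 1%:M 0 0 U^T.
have T1u : T1 \in unitmx by rewrite unitmxE det_lblock det1 mul1r -unitmxE unitmx_tr.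
have [c [f [C' [C1E C's]]]] := sym_block (sym_congr U^T Cs).
have bUE : b *m U = row_mx e%:M 0.
  rewrite bU; apply/rowP => j; case: (@split_ordP 1 n j) => j' ->.
    by rewrite [RHS](@row_mxEl _ 1 1 n) !mxE [j']ord1 eqxx /= mulr1 mulr1n.
  by rewrite [RHS](@row_mxEr _ 1 1 n) !mxE /= mulr0.
have M2E : T1 *m M1 *m T1^T =
    block_mx 0 (row_mx e%:M 0) (col_mx e%:M 0) (block_mx c%:M f f^T C').
  rewrite M1E a0 /T1 mulmx_block tr_block_mx mulmx_block !trmx0 !trmx1 !trmxK.
  rewrite !mul0mx !mul1mx !mulmx0 !mulmx1 !addr0 !add0r raddf0 bUE -C1E trmxK.
  by rewrite -trmx_mul bUE tr_row_mx tr_scalar_mx trmx0.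
have eu : e \in GRing.unit.
  pose M2 := T1 *m M1 *m T1^T.
  have M2u : M2 \in unitmx by rewrite /M2 /M1 !unitmx_mul !unitmx_tr T1u Bu Mu.
  have := congr1 (fun X : 'M[R]_(1 + (1 + n)) => X (lshift _ 0) (lshift _ 0)) (mulmxV M2u).
  rewrite {1}/M2 M2E mxE big_split_ord big_ord1 /= block_mxEul mxE mul0r add0r.
  rewrite big_split_ord big_ord1 /= block_mxEur row_mxEl mxE eqxx mulr1n big1 => [|j _].
    rewrite addr0 mxE eqxx => E.
    by apply/unitrP; exists (invmx M2 (rshift 1 (lshift n 0)) (lshift (1 + n) 0)); rewrite mulrC.
  by rewrite block_mxEur row_mxEr mxE mul0r.
pose T2 : 'M[R]_(1 + (1 + n)) :=
  block_mx 1%:M 0 (col_mx 0 (- e^-1 *: f^T)) 1%:M.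
have T2u : T2 \in unitmx by rewrite unitmxE det_lblock !det1 mulr1 unitr1.
exists (T2 *m (T1 *m B)), e, c, C'; split => //.
  by rewrite !unitmx_mul T2u T1u Bu.
have -> : T2 *m (T1 *m B) *m M *m (T2 *m (T1 *m B))^T = T2 *m (T1 *m M1 *m T1^T) *m T2^T.
  by rewrite /M1 !trmx_mul !mulmxA.
have eK m1 m2 (D : 'M[R]_(m1, m2)) : e *: (- e^-1 *: D) = - D.
  by rewrite scalerA mulrN mulrV // scaleN1r.
rewrite M2E /T2 mulmx_block tr_block_mx mulmx_block !trmx0 !trmx1.
rewrite !mul0mx !mul1mx !mulmx0 !mulmx1 !addr0 !add0r.
rewrite tr_col_mx trmx0 [(_ *: _)^T]linearZ /= trmxK.
rewrite !mul_col_row !mul0mx ?mulmx0 mul_mx_scalar mul_scalar_mx !eK ?mul0mx.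
by rewrite !add_block_mx !add0r !addNr.
Qed.

Lemma anisotropic_congr n (M U : 'M[R]_n) : U \in unitmx ->
  anisotropic M -> anisotropic (U *m M *m U^T).
Proof.
move=> Uu aM v; rewrite qf_congr => /aM vU.
by rewrite -(mulmxK Uu v) vU mul0mx.
Qed.

Lemma qf_block n a (b : 'rV[R]_n) C l u :
  qf (block_mx a%:M b b^T C) (row_mx l%:M u) =
  a * l ^+ 2 + (l * (b *m u^T) 0 0) *+ 2 + qf C u.
Proof.
rewrite /qf mul_row_block tr_row_mx mul_row_col tr_scalar_mx.
rewrite !mulmxDl !mul_mx_scalar !mul_scalar_mx -!scalemxAl.
have -> : u *m b^T = (b *m u^T)^T by rewrite trmx_mul trmxK.
move: (b *m u^T) (u *m C *m u^T) => p q.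
by rewrite !mxE eqxx mulr1n; ring.
Qed.
End Splitting.

(** * Hermite's bound over E[X] *)

Lemma ex_min_measure (T : Type) (P : T -> Prop) (m : T -> nat) :
  (exists x, P x) -> exists2 x, P x & forall y, P y -> (m x <= m y)%N.
Proof.
case=> x; have [n] := ubnP (m x); elim: n x => // n IH x; rewrite ltnS => le Px.
have [[y Py lt]|no] := classic (exists2 y, P y & (m y < m x)%N).
  by apply: (IH y) => //; apply: leq_trans le.
exists x => // y Py; rewrite leqNgt; apply/negP => lt; apply: no; by exists y.
Qed.

Section Hermite.
Variable E : fieldType.
Implicit Type n : nat.

(** Take v of minimal degree, completed to a basis, with value a. Projection to
the orthogonal of v gives a form G2 whose determinant is det G times a power of
a; by induction it has a vector u of small value. Lifting u with coefficient chosen by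
Euclidean division by a gives a vector whose value, at least of degree deg a, is
at most (G2(u) + smaller terms) / a, so that deg G2(u) >= 2 deg a. *)
Lemma hermite_bound n (G : 'M[{poly E}]_n.+1) : G^T = G -> anisotropic G ->
  exists2 v, v != 0 & ((size (qf G v)).-1 * n.+1 <= (size (\det G)).-1)%N.
Proof.
elim: n G => [|n IH] G Gs Ga.
  exists (delta_mx 0 0).
    apply/eqP => /matrixP/(_ 0 0); rewrite !mxE eqxx => /eqP; by rewrite oner_eq0.
  by rewrite qf_delta0 muln1 [G]mx11_scalar det_scalar1 -mx11_scalar.
have [v v0 vmin] : exists2 v, v != 0 & forall u, u != 0 ->
    (size (qf G v) <= size (qf G u))%N.
  apply: (@ex_min_measure 'rV[{poly E}]_n.+2 (fun v => v != 0)); exists (delta_mx 0 0).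
  apply/eqP => /matrixP/(_ 0 0); rewrite !mxE eqxx => /eqP; by rewrite oner_eq0.
have [B [d [Bu d0 vE]]] := primitive_row (@poly_row_reducible E) v0.
have [a [b [C [G1E Cs]]]] : exists (a : {poly E}) (b : 'rV[{poly E}]_n.+1) C,
    B *m G *m B^T = block_mx a%:M b b^T C :> 'M_(1 + n.+1) /\ C^T = C.
  exact: (sym_block (sym_congr B Gs : _ = _ :> 'M_(1 + n.+1))).
have G1a : anisotropic (block_mx a%:M b b^T C).
  by rewrite -G1E; apply: anisotropic_congr.
have aE : qf G (row 0 B) = a.
  by rewrite rowE -qf_congr qf_delta0 G1E block_mx00.
have row0 : row 0 B != 0 by apply: contraNneq v0 => r0; rewrite vE r0 scaler0.
have a0 : a != 0.
  by apply: contraNneq row0 => a0; apply/eqP/Ga; rewrite aE.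
have amin u : u != 0 -> (size a <= size (qf (block_mx a%:M b b^T C) u))%N.
  move=> u0; rewrite -G1E qf_congr.
  have uB : u *m B != 0.
    by apply: contraNneq u0 => uB0; rewrite -(mulmxK Bu u) uB0 mul0mx.
  apply: leq_trans (vmin _ uB).
  rewrite vE qfZ aE; apply: dvdp_leq; last exact: dvdp_mull.
  by rewrite mulf_neq0 ?expf_neq0.
(* Completing the square: a q(l, u) = (a l + b.u)^2 + G2(u). *)
pose G2 : 'M[{poly E}]_n.+1 := a *: C - b^T *m b.
have G2s : G2^T = G2 by rewrite /G2 linearB linearZ /= Cs trmx_mul trmxK.
have G2q l u : a * qf (block_mx a%:M b b^T C) (row_mx l%:M u) =
    (a * (l : {poly E}) + (b *m u^T) 0 0) ^+ 2 + qf G2 u.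
  rewrite qf_block.
  have -> : qf G2 u = a * qf C u - (b *m u^T) 0 0 ^+ 2.
    rewrite /qf /G2 mulmxBr mulmxBl -scalemxAr -scalemxAl.
    rewrite mulmxA -[_ *m b *m _]mulmxA.
    have -> : u *m b^T = (b *m u^T)^T by rewrite trmx_mul trmxK.
    move: (b *m u^T) (u *m C *m u^T) => p q.
    by rewrite !mxE big_ord1 !mxE -expr2.
  by ring.
have G2a : anisotropic G2.
  move=> u u0; have := G2q (- (b *m u^T) 0 0) (a *: u).
  have -> : (b *m (a *: u)^T) 0 0 = a * (b *m u^T) 0 0.
    by rewrite [(_ *: u)^T]linearZ /= -scalemxAr [LHS]mxE.
  rewrite qfZ u0 mulr0 addr0 mulrN addNr expr0n /= => /eqP.
  rewrite mulf_eq0 (negPf a0) /= => /eqP/G1a/matrixP ru0.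
  apply/rowP => j; have := ru0 0 (rshift 1 j); rewrite row_mxEr !mxE => /eqP.
  by rewrite mulf_eq0 (negPf a0) => /eqP.
have det2 : \det G2 = a ^+ n * \det (block_mx a%:M b b^T C).
  apply: (mulfI a0); rewrite mulrA -exprS.
  have <- : \det (block_mx 1%:M 0 (- b^T) a%:M) = a ^+ n.+1.
    by rewrite det_lblock det1 mul1r det_scalar.
  rewrite -det_mulmx mulmx_block !mul1mx !mul0mx !addr0 mulNmx mul_mx_scalar mul_scalar_mx addNr.
  by rewrite det_ublock det_scalar1 mulNmx mul_scalar_mx addrC.
have detG : size (\det (block_mx a%:M b b^T C)) = size (\det G).
  rewrite -G1E !det_mulmx det_tr mulrAC mulrC.
  have : \det B * \det B \is a GRing.unit by rewrite unitrM -unitmxE Bu.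
  rewrite poly_unitE => /andP[/size_poly1P[c c0 ->] _].
  by rewrite mulrC size_Cmul.
have [u u0 uH] := IH _ G2s G2a.
pose r : {poly E} := (b *m u^T) 0 0.
pose l : {poly E} := - (r %/ a).
have lE : a * l + r = r %% a by rewrite /l {2}(divp_eq r a); ring.
have w0 : row_mx l%:M u != 0.
  apply: contraNneq u0 => /matrixP w0; apply/eqP/rowP => j.
  by have := w0 0 (rshift 1 j); rewrite row_mxEr !mxE.
exists (row 0 B).
  exact: row0.
pose Q : {poly E} := qf (block_mx a%:M b b^T C) (row_mx l%:M u).
pose Q2 : {poly E} := qf G2 u.
have leaq : (size a <= size Q)%N := amin _ w0.
have qE : a * Q = (r %% a) ^+ 2 + Q2 by rewrite -lE; apply: G2q.
have q0 : Q != 0.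
  by apply: contra_neq w0 => /G1a.
have szaq : (size a + size a <= (size Q2).+1)%N.
  have : (size a + size a <= (size (a * Q)%R).+1)%N.
    by rewrite size_mul // prednK ?leq_add2l // addn_gt0 size_poly_gt0 a0.
  rewrite qE => le1.
  have lt2 : ((size ((r %% a) ^+ 2)%R).+1 < size a + size a)%N.
    have [->|rm0] := eqVneq (r %% a) 0.
      by rewrite expr0n size_poly0 -[1%N]/(0 + 1)%N; have := size_poly_gt0 a; rewrite a0; lia.
    have := ltn_modp r a; rewrite a0 => lt1.
    rewrite expr2 size_mul //; move: lt1.
    by move: (size (r %% a)) (size a) => m1 m2; lia.
  have := size_polyD ((r %% a) ^+ 2) Q2.
  rewrite leq_max => /orP[h|h]; last by rewrite (leq_trans le1) // ltnS.
  by have := leq_ltn_trans (leq_trans le1 (h : (_.+1 <= _.+1)%N)) lt2; rewrite ltnn.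
rewrite aE; move: uH; rewrite -/Q2 det2.
have [D0|D0] := eqVneq (\det (block_mx a%:M b b^T C)) 0.
  rewrite D0 mulr0 size_poly0 /= leqn0 muln_eq0 orbF => /eqP q2.
  suff -> : (size a).-1 = 0%N by [].
  by move: szaq q2; move: (size a) (size Q2) => m1 m2; lia.
have -> : (size (a ^+ n * \det (block_mx a%:M b b^T C))%R).-1 =
    ((size a).-1 * n + (size (\det G)).-1)%N.
  rewrite size_mul ?expf_neq0 // detG -size_exp.
  have : (0 < size (a ^+ n)%R)%N by rewrite size_poly_gt0 expf_neq0.
  have : (0 < size (\det G))%N by rewrite -detG size_poly_gt0.
  by move: (size (a ^+ n)) (size _) => m1 m2; lia.
have : (0 < size a)%N by rewrite size_poly_gt0.
move: szaq; move: (size a) (size Q2) (size (\det G)) => m1 m2 m3; nia.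
Qed.
End Hermite.

(** * Totally isotropic subspaces over a field *)

Lemma totally_isotropic_map (R S : comUnitRingType) (f : {rmorphism R -> S}) n
    (M : 'M[R]_n) k : totally_isotropic M k -> totally_isotropic (map_mx f M) k.
Proof.
case=> W [V [WV WM]]; exists (map_mx f W), (map_mx f V); split.
  by rewrite -map_mxM WV map_mx1.
by rewrite map_trmx -!map_mxM WM map_mx0.
Qed.

Lemma qf_map (R S : comUnitRingType) (f : {rmorphism R -> S}) n (M : 'M[R]_n) v :
  qf (map_mx f M) (map_mx f v) = f (qf M v).
Proof. by rewrite /qf map_trmx -!map_mxM mxE. Qed.

Section FieldForms.
Variable K : fieldType.

Lemma rank_totally_isotropic n (M : 'M[K]_n) m (P : 'M_(m, n)) k :
  (k <= \rank P)%N -> P *m M *m P^T = 0 -> totally_isotropic M k.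
Proof.
move=> lek PM; have /submxP[D DE] : (row_base P <= P)%MS by rewrite eq_row_base.
have /row_freeP[B BE] := row_base_free P.
exists (pid_mx k *m row_base P), (B *m pid_mx k); split.
  rewrite mulmxA -[_ *m B]mulmxA BE mulmx1 mul_pid_mx minnn (minn_idPr lek).
  by rewrite pid_mx_1.
rewrite DE !trmx_mul !mulmxA -[_ *m P *m M]mulmxA -[_ *m (P *m M) *m _]mulmxA.
by rewrite PM mulmx0 !mul0mx.
Qed.

Lemma tall_row_kernel m n (A : 'M[K]_(m, n)) : (n < m)%N ->
  exists2 r : 'rV_m, r != 0 & r *m A = 0.
Proof.
move=> nm; have : kermx A != 0.
  by rewrite kermx_eq0 /row_free neq_ltn (leq_ltn_trans (rank_leq_col A)).
by case/rowV0Pn => r rk r0; exists r => //; apply/sub_kermxP.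
Qed.

Lemma isotropic_totally_isotropic n (M : 'M[K]_n) v :
  v != 0 -> qf M v = 0 -> totally_isotropic M 1.
Proof.
move=> v0 qv; apply: (rank_totally_isotropic (P := v)); first by rewrite rank_rV v0.
by rewrite [LHS]mx11_scalar -/(qf M v) qv raddf0.
Qed.

Lemma totally_isotropic_isotropic n (M : 'M[K]_n) k :
  totally_isotropic M k.+1 -> exists2 v, v != 0 & qf M v = 0.
Proof.
case=> W [V [WV WM]]; exists (row 0 W).
  apply: contra_neq (oner_neq0 K) => W0.
  have := congr1 (row 0) WV; rewrite row_mul W0 mul0mx => /matrixP/(_ 0 0).
  by rewrite !mxE eqxx.
by rewrite /qf -row_mul tr_row -[_ *m col _ _]/(_ *m _) colE mulmxA -row_mul WM rowE mulmx0 mul0mx mxE.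
Qed.

(** Witt cancellation of a plane containing an isotropic vector, for totally
isotropic subspaces. Write the rows of W as (al, be, P) along the plane and M.
On rows with be = 0 the component P is totally isotropic for M; either there are k
independent such rows, or be vanishes and P loses at most one dimension. *)
Lemma plane_sum_cancel d c n (M : 'M[K]_n) k : d != 0 ->
  totally_isotropic (plane_sum d c M) k.+1 -> totally_isotropic M k.
Proof.
move=> d0 [W [V [WV WM]]].
pose al : 'cV[K]_k.+1 := lsubmx (W : 'M_(k.+1, 1 + (1 + n))).
pose be : 'cV[K]_k.+1 := lsubmx (rsubmx (W : 'M_(k.+1, 1 + (1 + n)))).
pose P : 'M[K]_(k.+1, n) := rsubmx (rsubmx (W : 'M_(k.+1, 1 + (1 + n)))).
have WE : W = row_mx al (row_mx be P) :> 'M_(k.+1, 1 + (1 + n)) by rewrite !hsubmxK.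
have rkW : \rank (row_mx al (row_mx be P)) = k.+1.
  by rewrite -WE; apply/eqP/row_freeP; exists V.
have prodE m (x y : 'cV[K]_m) (Q : 'M_(m, n)) :
   row_mx x (row_mx y Q) *m plane_sum d c M = row_mx (d *: y) (row_mx (d *: x + c *: y) (Q *m M)).
  rewrite /plane_sum mul_row_block mulmx0 add0r mul_row_col mulmx0 addr0 mul_mx_scalar.
  rewrite mul_mx_row mulmx0 mul_row_block !mulmx0 add0r addr0 !mul_mx_scalar add_row_mx.
  by rewrite add0r.
have bilE m (x y : 'cV[K]_m) (Q : 'M_(m, n)) :
    row_mx x (row_mx y Q) *m plane_sum d c M *m (row_mx al (row_mx be P))^T =
    d *: (y *m al^T + x *m be^T) + c *: (y *m be^T) + Q *m M *m P^T.
  rewrite prodE tr_row_mx tr_row_mx !mul_row_col.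
  by rewrite mulmxDl -!scalemxAl scalerDr !addrA.
have PE : P *m M *m P^T = - (d *: (be *m al^T + al *m be^T) + c *: (be *m be^T)).
  by apply/eqP; rewrite -addr_eq0 addrC -bilE -WE; apply/eqP.
have [be0|be0] := eqVneq be 0.
  apply: (rank_totally_isotropic (P := P)); last first.
    by rewrite PE be0 trmx0 !mulmx0 !mul0mx addr0 !scaler0 addr0 oppr0.
  have : (\rank (row_mx al (row_mx be P)) <= 1 + \rank P)%N.
    have -> : row_mx al (row_mx be P) = al *m row_mx 1%:M 0 + P *m row_mx 0 (row_mx 0 1%:M).
      rewrite !mul_mx_row !mulmx0 !mulmx1 add_row_mx addr0 be0.
      by congr (row_mx _ _); apply: esym; apply: add0r.
    apply: leq_trans (mxrank_add _ _) _; rewrite leq_add //.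
      by rewrite (leq_trans (mxrankM_maxl _ _)) // rank_leq_col.
    exact: mxrankM_maxl.
  by rewrite rkW.
apply: (rank_totally_isotropic (P := kermx be *m P)); last first.
  have kb : kermx be *m be = 0 := mulmx_ker _.
  rewrite trmx_mul !mulmxA -[_ *m P *m M]mulmxA -[_ *m (P *m M) *m _]mulmxA PE.
  rewrite mulmxN mulNmx mulmxDr mulmxDl -!scalemxAr -!scalemxAl mulmxDr mulmxDl.
  rewrite !mulmxA kb !mul0mx add0r scaler0 addr0 -!mulmxA -trmx_mul kb.
  by rewrite trmx0 !mulmx0 scaler0 oppr0.
have rkb : \rank be = 1%N.
  by apply/eqP; rewrite eqn_leq rank_leq_col lt0n mxrank_eq0.
have -> : \rank (kermx be *m P) = \rank (kermx be).
  apply/(mxrank_injP _); rewrite -submx0; apply/rV_subP => x; rewrite sub_capmx.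
  case/andP => /sub_kermxP xb /sub_kermxP xP; rewrite submx0.
  have xW : x *m row_mx al (row_mx be P) = row_mx (x *m al) 0.
    by rewrite !mul_mx_row xb xP row_mx0.
  have : row_mx (x *m al) (row_mx 0 0) *m plane_sum d c M *m (row_mx al (row_mx be P))^T = 0.
    by rewrite row_mx0 -xW -!mulmxA [X in _ *m X]mulmxA -WE WM mulmx0.
  rewrite bilE !mul0mx scaler0 !addr0 add0r => /eqP.
  rewrite scaler_eq0 (negPf d0) /= [x *m al]mx11_scalar mul_scalar_mx scaler_eq0.
  rewrite trmx_eq0 (negPf be0) orbF => /eqP xal.
  have : x *m row_mx al (row_mx be P) = 0.
    by rewrite xW [x *m al]mx11_scalar xal raddf0 row_mx0.
  have /row_freeP[B BE] : row_free (row_mx al (row_mx be P)) by rewrite /row_free rkW.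
  by move=> /(congr1 (mulmx^~ B)); rewrite -mulmxA BE mulmx1 mul0mx => ->.
by rewrite mxrank_ker rkb subn1.
Qed.
End FieldForms.

(** * Unimodular forms over E[X] *)

Section UnimodularPoly.
Variable E : fieldType.

(** Hermite's bound gives a vector of constant nonzero value, which splits off; the
complement is again unimodular and anisotropic. *)
Lemma unimodular_anisotropic_const n (G : 'M[{poly E}]_n) :
  G^T = G -> G \in unitmx -> anisotropic G ->
  exists2 U, U \in unitmx & exists C : 'M[E]_n, U *m G *m U^T = map_mx polyC C.
Proof.
elim: n G => [|n IH] G Gs Gu Ga.
  by exists 1%:M; rewrite ?unitmx1 //; exists 0; rewrite !flatmx0.
have [v v0 vH] := hermite_bound Gs Ga.
have [B [d [Bu d0 vE]]] := primitive_row (@poly_row_reducible E) v0.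
have qv0 : qf G v != 0 by apply: contra_neq v0 => /Ga.
have G1s := sym_congr B Gs.
have au : (B *m G *m B^T) 0 0 \is a GRing.unit.
  have : qf G v \is a GRing.unit.
    have := Gu; rewrite unitmxE poly_unitE => /andP[/eqP sd _].
    move: vH; rewrite sd leqn0 muln_eq0 orbF => /eqP sq.
    have sz1 : size (qf G v : {poly E}) = 1%N.
      by move: sq; have := size_poly_gt0 (qf G v : {poly E}); rewrite qv0; case: size => // -[].
    rewrite poly_unitE sz1 eqxx /= unitfE; move: qv0; apply: contraNneq => c0.
    by have /size1_polyC -> := eq_leq sz1; rewrite c0.
  by rewrite vE qfZ unitrM => /andP[_]; rewrite rowE -qf_congr qf_delta0.
have [T Tu [C Cs TE]] := split_unit (G1s : _ = _ :> 'M_(1 + n)) au.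
have TEu : T *m (B *m G *m B^T) *m T^T \in unitmx.
  by rewrite !unitmx_mul !unitmx_tr Tu Bu Gu.
rewrite TE in TEu.
have Cu : C \in unitmx.
  by move: TEu; rewrite unitmxE det_ublock unitrM -!unitmxE => /andP[].
have Ca : anisotropic C.
  move=> u u0; have := anisotropic_congr Tu (anisotropic_congr Bu Ga).
  rewrite TE -(trmx0 (poly_polynomial__canonical__Algebra_Nmodule E) 1 n) => /(_ (row_mx 0%:M u)).
  rewrite qf_block u0 expr0n mulr0 mul0r mul0rn !addr0 => /(_ erefl)/matrixP r0.
  by apply/rowP => j; have := r0 0 (rshift 1 j); rewrite row_mxEr !mxE.
have [U Uu [C' CE]] := IH _ Cs Cu Ca.
pose T1 : 'M[{poly E}]_(1 + n) := block_mx 1%:M 0 0 U.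
have T1u : T1 \in unitmx by rewrite unitmxE det_ublock det1 mul1r -unitmxE.
exists (T1 *m (T *m B)); first by rewrite !unitmx_mul T1u Tu Bu.
have [c cE] : exists c, (B *m G *m B^T) 0 0 = c%:P.
  by move: au; rewrite poly_unitE => /andP[/size_poly1P[c _ ->] _]; exists c.
exists (block_mx c%:M 0 0 C' : 'M_(1 + n)).
have -> : T1 *m (T *m B) *m G *m (T1 *m (T *m B))^T =
   T1 *m (T *m (B *m G *m B^T) *m T^T) *m T1^T.
  by rewrite !trmx_mul !mulmxA.
rewrite TE (@map_block_mx _ _ polyC 1 n 1 n) !raddf0 -CE cE /T1 mulmx_block tr_block_mx mulmx_block.
rewrite !trmx0 !trmx1 !mul0mx !mulmx0 !mul1mx ?mulmx1 ?mul0mx ?mulmx0 !addr0 !add0r ?mul0mx ?mulmx0 ?addr0.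
by rewrite map_scalar_mx.
Qed.

(** If G were anisotropic it would be constant, hence equal to its value at r, which
is isotropic. So G has an isotropic vector, and a plane splits off both G and
its value at r. *)
Lemma totally_isotropic_lift k n (G : 'M[{poly E}]_n) (r : E) :
  G^T = G -> G \in unitmx ->
  totally_isotropic (map_mx (horner_eval r) G) k -> totally_isotropic G k.
Proof.
elim: k n G => [|k IH] n G Gs Gu Tr; first exact: totally_isotropic0.
have [v v0 qv] : exists2 v, v != 0 & qf G v = 0.
  apply: NNPP => no; have Ga : anisotropic G.
    by move=> v qv; apply/eqP/negPn/negP => v0; apply: no; exists v.
  have [U Uu [C UE]] := unimodular_anisotropic_const Gs Gu Ga.
  have := Tr; rewrite -(totally_isotropic_congr _ _ (unitmx_map (horner_eval r) Uu)).
  rewrite map_trmx -!map_mxM UE -map_mx_comp map_mx_id => [TC|c]; last first.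
    by rewrite /= /horner_eval hornerC.
  have [w w0 qw] := totally_isotropic_isotropic TC.
  have := anisotropic_congr Uu Ga (v := map_mx polyC w); rewrite UE qf_map qw.
  move=> /(_ (raddf0 _))/matrixP w00; case/eqP: w0; apply/rowP => j.
  by have := w00 0 j; rewrite !mxE => /eqP; rewrite polyC_eq0 => /eqP.
have n2 : (1 < n)%N.
  case: n G Gs Gu Tr v v0 qv => [|[|//]] G Gs Gu Tr v v0 qv.
    by case/eqP: v0; apply/rowP=> -[].
  case/eqP: v0; move: qv; rewrite /qf [G]mx11_scalar mul_mx_scalar -scalemxAl mxE => /eqP.
  rewrite mulf_eq0 => /orP[/eqP G0|].
    by move: Gu; rewrite [G]mx11_scalar G0 raddf0 unitmxE det0 unitr0.
  rewrite [v]mx11_scalar tr_scalar_mx -scalar_mxM mxE eqxx mulr1n mulf_eq0 orbb => /eqP ->.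
  exact: raddf0.
case: n n2 G Gs Gu Tr v v0 qv => [|[|n]] // _ G Gs Gu Tr v v0 qv.
have [T [d [c [C [Tu du Cs TE]]]]] :=
  split_isotropic (@poly_row_reducible E) (Gs : _ = _ :> 'M_(2 + n)) Gu v0 qv.
have PsE : map_mx (horner_eval r) (plane_sum d c C) =
    plane_sum (horner_eval r d) (horner_eval r c) (map_mx (horner_eval r) C).
  rewrite /plane_sum !map_block_mx map_row_mx map_col_mx !map_scalar_mx.
  by rewrite !raddf0.
have Cu : C \in unitmx.
  have : plane_sum d c C \in unitmx by rewrite -TE !unitmx_mul !unitmx_tr Tu Gu.
  by rewrite unitmxE plane_sum_det unitrM -!unitmxE => /andP[].
rewrite -(totally_isotropic_congr _ _ Tu) TE.
apply: (@plane_sum_totally_isotropic _ d c n C k); apply: (IH _ _ Cs Cu).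
apply: (@plane_sum_cancel _ (horner_eval r d) (horner_eval r c)); last first.
  rewrite -PsE -TE !map_mxM -map_trmx.
  by rewrite (totally_isotropic_congr _ _ (unitmx_map (horner_eval r) Tu)).
by rewrite -unitfE rmorph_unit.
Qed.
End UnimodularPoly.

(** * Diagonalization and forms of trivial discriminant *)

Section FieldDiscriminant.
Variable K : fieldType.
Hypothesis char2 : (2%:R : K) != 0.

Lemma split_value n (M : 'M[K]_n.+1) v : M^T = M -> qf M v != 0 ->
  exists2 T : 'M[K]_(1 + n), T \in unitmx & exists a s C, [/\ C^T = C, s != 0,
    qf M v = a * s ^+ 2 & T *m M *m T^T = block_mx a%:M 0 0 C].
Proof.
move=> Ms qv; have v0 : v != 0 by apply: contraNneq qv => ->; rewrite /qf !mul0mx mxE.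
have [B [d [Bu d0 vE]]] := primitive_row (@field_row_reducible K) v0.
have qE : qf M v = (B *m M *m B^T) 0 0 * d ^+ 2.
  by rewrite -qf_delta0 qf_congr -rowE mulrC -qfZ -vE.
have au : (B *m M *m B^T) 0 0 \is a GRing.unit.
  by rewrite unitfE; apply: contraNneq qv => q0; rewrite qE q0 mul0r.
have [T Tu [C Cs TE]] := split_unit (sym_congr B Ms : _ = _ :> 'M_(1 + n)) au.
exists (T *m B); first by rewrite unitmx_mul Tu.
exists ((B *m M *m B^T) 0 0), d, C; split=> //.
by rewrite -TE !trmx_mul !mulmxA.
Qed.

Lemma block_congr_diag n a (C U : 'M[K]_n) e : U *m C *m U^T = diag_mx e ->
  let T : 'M[K]_(1 + n) := block_mx 1%:M 0 0 U in
  T *m block_mx a%:M 0 0 C *m T^T = diag_mx (row_mx a%:M e).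
Proof.
move=> CE /=; rewrite mulmx_block tr_block_mx mulmx_block.
rewrite !trmx0 !trmx1 !mul0mx !mulmx0 !mul1mx ?mulmx1 ?mul0mx ?mulmx0 !addr0 !add0r ?mul0mx ?mulmx0 ?addr0 CE.
rewrite diag_mx_row; congr (block_mx _ _ _ _).
by apply/matrixP => i j; rewrite !ord1 !mxE.
Qed.

Lemma diagonalize n (M : 'M[K]_n) : M^T = M ->
  exists2 U, U \in unitmx & exists d, U *m M *m U^T = diag_mx d.
Proof.
elim: n M => [|n IH] M Ms.
  by exists 1%:M; rewrite ?unitmx1 //; exists 0; rewrite !flatmx0.
have [->|M0] := eqVneq M 0.
  by exists 1%:M; rewrite ?unitmx1 //; exists 0; rewrite mulmx0 mul0mx raddf0.
have [v qv] : exists v, qf M v != 0.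
  have qe i : qf M (delta_mx 0 i) = M i i by rewrite /qf -rowE trmx_delta -colE !mxE.
  apply: NNPP => no.
  have q0 v : qf M v = 0 by apply/eqP/negPn/negP => qv; apply: no; exists v.
  case/eqP: M0; apply/matrixP => i j; rewrite mxE.
  have qE i' j' : ((delta_mx 0 i' : 'rV_n.+1) *m M *m (delta_mx 0 j' : 'rV_n.+1)^T) 0 0 = M i' j'.
    by rewrite -rowE trmx_delta -colE !mxE.
  have addE (A B : 'M[K]_1) : (A + B) 0 0 = A 0 0 + B 0 0 by rewrite mxE.
  have := q0 (delta_mx 0 i + delta_mx 0 j).
  rewrite /qf mulmxDl linearD /= mulmxDr !mulmxDl !addE !qE -!qe !q0 add0r addr0.
  by rewrite -{1}Ms mxE -mulr2n -mulr_natl => /eqP; rewrite mulf_eq0 (negPf char2) => /eqP.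
have [T Tu [a [s [C [Cs _ _ TE]]]]] := split_value Ms qv.
have [U Uu [e CE]] := IH _ Cs.
pose T1 : 'M[K]_(1 + n) := block_mx 1%:M 0 0 U.
have T1u : T1 \in unitmx by rewrite unitmxE det_ublock det1 mul1r -unitmxE.
exists (T1 *m T); first by rewrite unitmx_mul T1u.
exists (row_mx a%:M e : 'rV_(1 + n)).
by rewrite -(block_congr_diag a CE) -TE !trmx_mul !mulmxA.
Qed.

Lemma diagonalize_value n (M : 'M[K]_n.+1) v : M^T = M -> qf M v != 0 ->
  exists2 U, U \in unitmx & exists (d : 'rV[K]_n.+1) s, [/\ s != 0, qf M v = d 0 0 * s ^+ 2 &
    U *m M *m U^T = diag_mx d].
Proof.
move=> Ms qv; have [T Tu [a [s [C [Cs s0 vE TE]]]]] := split_value Ms qv.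
have [U Uu [e CE]] := diagonalize Cs.
pose T1 : 'M[K]_(1 + n) := block_mx 1%:M 0 0 U.
have T1u : T1 \in unitmx by rewrite unitmxE det_ublock det1 mul1r -unitmxE.
exists (T1 *m T); first by rewrite unitmx_mul T1u.
exists (row_mx a%:M e : 'rV_(1 + n)), s; split => //.
  have aE := @row_mxEl _ 1 1 n a%:M e 0 0; rewrite [RHS]mxE eqxx mulr1n in aE.
  by rewrite vE; congr (_ * _); rewrite -[LHS]aE; congr (row_mx _ _ _ _); apply/val_inj.
by rewrite -(block_congr_diag a CE) -TE !trmx_mul !mulmxA.
Qed.

Definition ternary_isotropic := forall a b c : K, exists x y z,
  [|| x != 0, y != 0 | z != 0] /\ a * x ^+ 2 + b * y ^+ 2 + c * z ^+ 2 = 0.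

Lemma qf_diag n (d : 'rV[K]_n) v : qf (diag_mx d) v = \sum_j d 0 j * v 0 j ^+ 2.
Proof.
rewrite /qf mul_mx_diag mxE; apply: eq_bigr => j _; rewrite !mxE.
by ring.
Qed.

Lemma ternary_isotropic_sym n (M : 'M[K]_n.+3) : ternary_isotropic -> M^T = M ->
  exists2 v, v != 0 & qf M v = 0.
Proof.
move=> tern Ms; have [U Uu [d ME]] := diagonalize Ms.
pose i0 : 'I_n.+3 := 0; pose i1 : 'I_n.+3 := lift 0 0; pose i2 : 'I_n.+3 := lift 0 (lift 0 0).
have [x [y [z [nz q0]]]] := tern (d 0 i0) (d 0 i1) (d 0 i2).
pose v : 'rV_n.+3 := x *: delta_mx 0 i0 + y *: delta_mx 0 i1 + z *: delta_mx 0 i2.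
have v0 : v != 0.
  apply: contraL nz => /eqP/matrixP v0; rewrite !negb_or !negbK.
  have := v0 0 i0; have := v0 0 i1; have := v0 0 i2; rewrite !mxE /=.
  by rewrite !mulr0 !mulr1 ?addr0 ?add0r => -> -> ->; rewrite !eqxx.
exists (v *m U).
  by apply: contra_neq v0 => vU; rewrite -(mulmxK Uu v) vU mul0mx.
rewrite -qf_congr ME qf_diag !big_ord_recl big1 => [|j _]; rewrite !mxE /= ?mulr0 ?mulr1.
  by rewrite ?addr0 ?add0r -q0 !addrA; congr (_ * _ + _ * _ + _ * _).
by rewrite !addr0 expr0n mulr0.
Qed.

Definition disc_square k (M : 'M[K]_(k.*2)) := exists e, (-1) ^+ k * \det M = e ^+ 2.

(** A plane containing an isotropic vector has discriminant 1, so the complement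
keeps a trivial discriminant. *)
Lemma split_disc_square k (M : 'M[K]_(k.+1.*2)) v : M^T = M -> M \in unitmx ->
  disc_square M -> v != 0 -> qf M v = 0 ->
  exists C : 'M[K]_(k.*2), [/\ C^T = C, C \in unitmx, disc_square C &
    forall j, totally_isotropic M j.+1 <-> totally_isotropic C j].
Proof.
move=> Ms Mu [e eE] v0 qv.
have [T [d [c [C [Tu du Cs TE]]]]] :=
  split_isotropic (@field_row_reducible K) (Ms : _ = _ :> 'M_(2 + k.*2)) Mu v0 qv.
have d0 : d != 0 by rewrite -unitfE.
have detE : \det T ^+ 2 * \det M = - d ^+ 2 * \det C.
  by have := plane_sum_det d c C; rewrite -TE !det_mulmx det_tr => <-; ring.
have T0 : \det T != 0 by rewrite -unitfE -unitmxE.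
exists C; split => // [||j].
- have : plane_sum d c C \in unitmx by rewrite -TE !unitmx_mul !unitmx_tr Tu Mu.
  by rewrite unitmxE plane_sum_det unitrM -!unitmxE => /andP[].
- exists (e * \det T / d); rewrite !exprMn -eE exprVn.
  have -> : \det C = - (\det T ^+ 2 * \det M) / d ^+ 2 by rewrite detE; field.
  by rewrite [(-1) ^+ k.+1]exprS; move: ((-1) ^+ k) => s; field.
rewrite -(totally_isotropic_congr _ _ Tu) TE; split.
  exact: plane_sum_cancel.
exact: (@plane_sum_totally_isotropic _ d c).
Qed.

Lemma det_mx22 (M : 'M[K]_2) : \det M = M 0 0 * M 1 1 - M 0 1 * M 1 0.
Proof.
rewrite (expand_det_row _ 0) !big_ord_recl big_ord0 /cofactor !det_mx11 !mxE /= addr0.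
rewrite expr0 expr1 mul1r mulN1r mulrN.
by congr (_ * _ - _ * _); congr (M _ _); apply/val_inj.
Qed.

Lemma binary_disc_square (M : 'M[K]_2) : M^T = M -> disc_square (k := 1) M ->
  totally_isotropic M 1.
Proof.
move=> Ms [s sE].
have i1 : lift ord0 ord0 = 1 :> 'I_2 by apply/val_inj.
have i0 : ord0 = 0 :> 'I_2 by [].
have M10 : M 1 0 = M 0 1 by rewrite -[in LHS]Ms mxE.
have qE (v : 'rV_2) : qf M v =
    M 0 0 * v 0 0 ^+ 2 + 2%:R * M 0 1 * v 0 0 * v 0 1 + M 1 1 * v 0 1 ^+ 2.
  rewrite /qf !mxE !big_ord_recl !big_ord0 !mxE !big_ord_recl !big_ord0 i1 i0 M10.
  by ring.
rewrite expr1 det_mx22 mulN1r M10 in sE.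
have sE' : s ^+ 2 = M 0 1 ^+ 2 - M 0 0 * M 1 1 by rewrite -sE; ring.
have [a0|a0] := eqVneq (M 0 0) 0.
  apply: (@isotropic_totally_isotropic _ _ _ (delta_mx 0 0)).
    by apply/eqP => /matrixP/(_ 0 0); rewrite !mxE => /eqP; rewrite oner_eq0.
  by rewrite qE a0 !mxE /=; ring.
pose v : 'rV[K]_2 := \row_j if j == 0 then s - M 0 1 else M 0 0.
apply: (@isotropic_totally_isotropic _ _ _ v).
  by apply/eqP => /matrixP/(_ 0 1); rewrite !mxE /= => /eqP; rewrite (negPf a0).
rewrite qE /v !mxE /=.
transitivity (M 0 0 * (s ^+ 2 - (M 0 1 ^+ 2 - M 0 0 * M 1 1))); first by ring.
by rewrite sE' subrr mulr0.
Qed.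

(** After splitting k - 1 hyperbolic planes, a binary form of trivial discriminant
is left, and such a form is isotropic. *)
Lemma totally_isotropic_disc_square k (M : 'M[K]_(k.*2)) : M^T = M -> M \in unitmx ->
  disc_square M -> totally_isotropic M k.-1 -> totally_isotropic M k.
Proof.
elim: k M => [|[|k] IH] M Ms Mu Md Mt; first exact: totally_isotropic0.
  exact: binary_disc_square.
have [v v0 qv] := totally_isotropic_isotropic Mt.
have [C [Cs Cu Cd CT]] := split_disc_square Ms Mu Md v0 qv.
by apply/CT; apply: IH => //; apply/CT.
Qed.

Lemma totally_isotropic_ternary k (M : 'M[K]_(k.*2)) : ternary_isotropic ->
  M^T = M -> M \in unitmx -> disc_square M -> totally_isotropic M k.
Proof.
move=> tern; elim: k M => [|[|k] IH] M Ms Mu Md; first exact: totally_isotropic0.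
  exact: binary_disc_square.
have [v v0 qv] := ternary_isotropic_sym (n := k.*2.+1) tern Ms.
have [C [Cs Cu Cd CT]] := split_disc_square Ms Mu Md v0 qv.
by apply/CT; apply: IH.
Qed.
End FieldDiscriminant.

(** * Norms of residue classes *)

Section Norm.
Variable E : fieldType.
Implicit Types (x y s h : {poly E}).

Definition polynorm h s : E := polyquot_norm (polyclass h s).

(** Multiplication by s in the basis of powers of X. *)
Definition redmx h s : 'M[E]_((size h).-1) := \matrix_(i, j) (('X^i * s) %% h)`_j.

Lemma polynormE h s : h != 0 -> polynorm h s = \det (redmx h s).
Proof.
move=> h0; congr (\det _); apply/matrixP => i j; rewrite !mxE.
by rewrite -rmorphM /= val_polyclass // mulrC.
Qed.

Lemma polynorm_mod h s t : h != 0 -> s %% h = t %% h -> polynorm h s = polynorm h t.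
Proof.
move=> h0 st; congr polyquot_norm; apply/val_inj.
by rewrite /= !val_polyclass.
Qed.

Lemma size_modp_pred h s : h != 0 -> (size (s %% h)%R <= (size h).-1)%N.
Proof. by move=> h0; rewrite -ltnS prednK ?size_poly_gt0 // ltn_modp. Qed.

Lemma poly_sum (p : {poly E}) n : (size p <= n)%N -> p = \sum_(i < n) p`_i *: 'X^i.
Proof.
move=> le; rewrite -poly_def; apply/polyP => i; rewrite coef_poly.
by case: ltnP => // /(leq_trans le) /leq_sizeP ->.
Qed.

Lemma polynormM h s t : h != 0 -> polynorm h (s * t) = polynorm h s * polynorm h t.
Proof.
move=> h0; rewrite !polynormE // -det_mulmx; congr (\det _).
apply/matrixP => i j; rewrite !mxE.
have -> : ('X^i * (s * t)) %% h = (('X^i * s) %% h * t) %% h.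
  by rewrite [_ %% h * t]mulrC modp_mul; congr (_ %% h); ring.
rewrite {1}(poly_sum (size_modp_pred ('X^i * s) h0)) mulr_suml (big_morph (fun p => p %% h) (modpD h) (mod0p h)) coef_sum.
by apply: eq_bigr => k _; rewrite !mxE -scalerAl modpZl coefZ.
Qed.

Lemma polynormC h c : h != 0 -> polynorm h c%:P = c ^+ (size h).-1.
Proof.
move=> h0; rewrite polynormE // -det_scalar; congr (\det _).
apply/matrixP => i j; rewrite !mxE mulrC mul_polyC modpZl coefZ modp_small.
  by rewrite coefXn -val_eqE eq_sym mulr_natr.
by rewrite size_polyXn -[X in (_ < X)%N]prednK ?size_poly_gt0 // ltnS.
Qed.

Lemma polynorm1 h : h != 0 -> polynorm h 1 = 1.
Proof. by move=> h0; rewrite polynormC // expr1n. Qed.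

(** The Sylvester matrix of x and y; the first n rows belong to y, so exchanging the
roles of x and y is a cyclic shift of the rows. *)
Definition sylv N n y x : 'M[E]_N :=
  \matrix_(i, j) (if (i < n)%N then 'X^i * y else 'X^(i - n) * x)`_j.

(** Division by x turns the rows X^i y into those of the multiplication by y modulo x,
plus combinations of the rows X^i x. *)
Lemma det_sylv N x y : x != 0 -> N = ((size x).-1 + (size y).-1)%N ->
  y != 0 ->
  \det (sylv N (size x).-1 y x) = polynorm x y * lead_coef x ^+ (size y).-1.
Proof.
move=> x0 -> y0.
pose Q : 'M[E]_(dg x, dg y) := \matrix_(i, j) (('X^i * y) %/ x)`_j.
pose T : 'M[E]_(dg x + dg y) := \matrix_(i, j) (if (i < dg x)%N then 'X^i else 'X^(i - dg x) * x)`_j.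
have -> : sylv (dg x + dg y) (dg x) y x = block_mx (redmx x y) Q 0 1%:M *m T.
  apply/matrixP => i j; rewrite mxE [RHS]mxE big_split_ord /=.
  case: (split_ordP i) => i' -> /=; rewrite ?ltn_ord; last first.
    rewrite ?ltnNge ?leq_addr /= addKn big1 ?add0r => [|k _]; last first.
      by rewrite block_mxEdl mxE mul0r.
    rewrite (bigD1 i') //= big1 ?addr0 => [|k /negPf ki]; last first.
      by rewrite block_mxEdr mxE eq_sym ki mul0r.
    by rewrite block_mxEdr !mxE eqxx /= ?ltnNge ?leq_addr /= addKn mul1r.
  rewrite {1}(divp_eq ('X^i' * y) x) coefD [LHS]addrC; congr (_ + _).
    rewrite {1}(poly_sum (size_modp_pred ('X^i' * y) x0)) coef_sum.
    by apply: eq_bigr => k _; rewrite block_mxEul !mxE /= ltn_ord coefZ.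
  have szQ : (size (('X^i' * y) %/ x)%R <= dg y)%N.
    have [->|q0] := eqVneq (('X^i' * y) %/ x) 0; first by rewrite size_poly0.
    rewrite size_divp // mulrC size_mulXn //.
    have := size_poly_gt0 y; rewrite y0 => sy.
    have := ltn_ord i'.
    move: (nat_of_ord i') => k.
    move: (size x) (size y) sy => a b; lia.
  rewrite {1}(poly_sum szQ) mulr_suml coef_sum.
  apply: eq_bigr => k _; rewrite block_mxEur !mxE /= ?ltnNge ?leq_addr /= addKn.
  by rewrite -scalerAl coefZ.
rewrite det_mulmx det_ublock det1 mulr1 polynormE //; congr (_ * _).
rewrite det_trig; last first.
  apply/is_trig_mxP => i j ij; rewrite mxE; case: ifP => [lt|/negbT].
    by rewrite coefXn eq_sym ltn_eqF.
  rewrite -leqNgt => le; rewrite coefXnM; case: ltnP => // le2.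
  apply: nth_default.
  have : (0 < size x)%N by rewrite size_poly_gt0.
  move: le ij le2; move: (nat_of_ord i) (nat_of_ord j) => a b.
  by move: (size x) => c; lia.
rewrite big_split_ord /= big1 ?mul1r => [|i _]; last first.
  by rewrite mxE /= ltn_ord coefXn eqxx.
rewrite -[in RHS](card_ord (dg y)) -prodr_const; apply: eq_bigr => i _.
by rewrite mxE /= ?ltnNge ?leq_addr /= addKn coefXnM ?ltnNge ?leq_addl /= addnK.
Qed.

Lemma cycle_perm n : {c : 'S_n.+1 | (forall k i, (c ^+ k)%g i = ((i + k) %% n.+1)%N :> nat) &
  odd_perm c = odd n}.
Proof.
pose c := lift_perm ord_max (0 : 'I_n.+1) 1.
have cE i : c i = (i.+1 %% n.+1)%N :> nat.
  rewrite /c; case: (unliftP ord_max i) => [j|] ->.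
    by rewrite lift_perm_lift perm1 lift_max /= /bump modn_small // ltnS.
  by rewrite lift_perm_id /= modnn.
exists c; last by rewrite odd_lift_perm odd_perm1 addbF addbF.
elim=> [|k IH] i; first by rewrite expg0 perm1 addn0 modn_small.
by rewrite expgSr permM cE IH -addn1 modnDml addn1 addnS.
Qed.

(** Both sides are the determinant of a Sylvester matrix, up to a cyclic shift of the
rows whose signature is the sign. *)
Lemma polynorm_reciprocity x y : x != 0 -> y != 0 ->
  polynorm x y * lead_coef x ^+ (size y).-1 =
  (-1) ^+ ((size x).-1 * (size y).-1) * (polynorm y x * lead_coef y ^+ (size x).-1).
Proof.
move=> x0 y0; set n := (size x).-1; set m := (size y).-1.
have <- : \det (sylv (n + m) n y x) = polynorm x y * lead_coef x ^+ m.
  exact: det_sylv.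
have <- : \det (sylv (n + m) m x y) = polynorm y x * lead_coef y ^+ n.
  by apply: det_sylv => //; rewrite addnC.
case NE : (n + m)%N => [|N].
  by move/eqP: NE; rewrite addn_eq0 => /andP[/eqP -> /eqP ->]; rewrite !det_mx00 mul1r.
have [c cE co] := cycle_perm N.
have -> : sylv N.+1 m x y = row_perm (c ^+ n)%g (sylv N.+1 n y x).
  apply/matrixP => i j; rewrite !mxE cE.
  move: (nat_of_ord i) (ltn_ord i) (nat_of_ord j) => k + l; rewrite -NE => ltN.
  case: ltnP => [lt|le].
    by rewrite modn_small ?[(_ + n)%N]addnC ?ltn_add2l // ltnNge leq_addr /= addKn.
  rewrite -(subnK le) -addnA [(m + n)%N]addnC modnDr modn_small; last first.
    by rewrite (leq_ltn_trans (leq_subr _ _)).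
  by rewrite ifT ?addnK // -(ltn_add2r m) subnK.
rewrite row_permE det_mulmx det_perm.
have -> : (c ^+ n)%g = (odd n && odd N) :> bool.
  by elim: n {NE} => [|k IH]; rewrite ?expg0 ?odd_perm1 // expgS odd_permM IH co /=; case: (odd k); case: odd.
have -> : (odd n && odd N) = odd (n * m).
  rewrite oddM; have := congr1 odd NE; rewrite oddD /=.
  by case: odd; case: odd; case: odd.
by rewrite mulrA signr_odd -signr_odd signr_odd -expr2 sqrr_sign mul1r.
Qed.

(** Reciprocity turns this into multiplicativity in the argument. *)
Lemma polynorm_modulusM x y s : x != 0 -> y != 0 -> s != 0 ->
  polynorm (x * y) s = polynorm x s * polynorm y s.
Proof.
move=> x0 y0 s0; have xy0 : x * y != 0 by rewrite mulf_neq0.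
have l0 (p : {poly E}) n : p != 0 -> lead_coef p ^+ n != 0 by move=> p0; rewrite expf_neq0 // lead_coef_eq0.
apply: (mulIf (l0 (x * y) (dg s) xy0)); rewrite polynorm_reciprocity //.
rewrite polynormM // lead_coefM exprMn mulrACA (polynorm_reciprocity x0 s0) (polynorm_reciprocity y0 s0).
by rewrite degM // mulnDl !exprD; ring.
Qed.

Lemma polynorm_neq0 h s : h != 0 -> coprimep s h -> polynorm h s != 0.
Proof.
move=> h0 /Bezout_eq1_coprimepP[[u v] /= uv].
have : polynorm h (u * s) = polynorm h 1.
  by apply: polynorm_mod => //; rewrite -uv modpD modp_mull addr0.
rewrite polynormM // polynorm1 // => /eqP; apply: contraTneq => ->.
by rewrite mulr0 eq_sym oner_neq0.
Qed.

(** Reciprocity pairs the norm of y modulo x with the norm of x modulo y. The leftover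
leading coefficients occur with exponents of the form deg x + deg y, which are
even, and the signs cancel. This is the vanishing at infinity of the ramification
of the quaternion algebra (-yz, -xz). *)
Lemma polynorm_residues_square x y z : x != 0 -> y != 0 -> z != 0 ->
  odd (dg x) = odd (dg z) -> odd (dg y) = odd (dg z) ->
  exists e, polynorm x (- (y * z)) * polynorm y (- (x * z)) * polynorm z (- (x * y)) = e ^+ 2.
Proof.
move=> x0 y0 z0 oxz oyz.
have nN h s : h != 0 -> polynorm h (- s) = (-1) ^+ dg h * polynorm h s.
  move=> h0; rewrite -[- s]mulN1r polynormM //; congr (_ * _).
  by rewrite -(polynormC _ h0) polyCN polyC1.
have evenE (a : E) n : odd n = false -> a ^+ n = (a ^+ n./2) ^+ 2.
  by move=> on; rewrite -exprM muln2 -[in LHS](odd_double_half n) on add0n.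
rewrite !nN // !polynormM //.
have := polynorm_reciprocity x0 y0; have := polynorm_reciprocity x0 z0.
have := polynorm_reciprocity y0 z0.
set i := dg x; set j := dg y; set l := dg z.
set X := lead_coef x; set Y := lead_coef y; set Z := lead_coef z.
move=> yzE xzE xyE.
have X0 n : X ^+ n != 0 by rewrite expf_neq0 // lead_coef_eq0.
have Y0 n : Y ^+ n != 0 by rewrite expf_neq0 // lead_coef_eq0.
have sgn : (-1) ^+ (i + j + l + i * j + i * l + j * l) = 1 :> E.
  rewrite -signr_odd !oddD !oddM oxz oyz -/l.
  by case: (odd l).
have evXY : odd (j + l) = false by rewrite oddD oyz addbb.
have evY : odd (i + l) = false by rewrite oddD oxz addbb.
have evZ : odd (i + j) = false by rewrite oddD oxz oyz addbb.
(* The denominators that reciprocity introduces. *)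
pose D := X ^+ (j + l)./2 * Y ^+ (i + l)./2.
exists (polynorm y x * polynorm z x * polynorm z y * Y ^+ i * Z ^+ (i + j)./2 / D).
have D0 : D != 0 by rewrite mulf_neq0.
apply: (mulIf (expf_neq0 2 D0)); rewrite -exprMn divfK // !exprMn.
rewrite -!evenE //.
transitivity ((-1) ^+ (i + j + l) * Y ^+ i * (polynorm x y * X ^+ j * polynorm y x) *
   (polynorm x z * X ^+ l * polynorm z x) * (polynorm y z * Y ^+ l * polynorm z y)).
  by rewrite !exprD; ring.
rewrite xyE xzE yzE; transitivity ((-1) ^+ (i + j + l + i * j + i * l + j * l) *
  (polynorm y x ^+ 2 * polynorm z x ^+ 2 * polynorm z y ^+ 2 * (Y ^+ i) ^+ 2 * Z ^+ (i + j))).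
  by rewrite !exprD; ring.
by rewrite sgn mul1r.
Qed.
End Norm.

(** * Squarefree polynomials *)

Section SquarefreePoly.
Variable E : fieldType.
Implicit Types (p q f g h d : {poly E}).

Lemma is_unit_polyP p : is_unit p <-> size p = 1%N.
Proof.
split=> [[q pq1]|/eqP/size_poly1P[c c0 ->]].
  have pq0 : p * q != 0 by rewrite pq1 oner_neq0.
  have := congr1 (fun r : {poly E} => size r) pq1; rewrite size_poly1.
  move: pq0; rewrite mulf_eq0 negb_or => /andP[p0 q0]; rewrite size_mul //.
  by move: p0 q0; rewrite -!size_poly_gt0; move: (size p) (size q) => a b; lia.
by exists c^-1%:P; rewrite -polyCM mulfV.
Qed.

Lemma squarefree_polyP p :
  squarefree p <-> p != 0 /\ forall d, d ^+ 2 %| p -> size d = 1%N.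
Proof.
split=> [sp|[p0 sp] x y nx pE].
  have p0 : p != 0.
    apply/eqP => p0; apply: (sp 0 0); rewrite ?mulr0 //.
    by move=> /is_unit_polyP; rewrite size_poly0.
  split=> // d /dvdpP[q pE]; apply: NNPP => sd; apply: (sp d q).
    by move=> /is_unit_polyP.
  by rewrite mulrC.
by apply/nx/is_unit_polyP/sp; rewrite pE dvdp_mulr.
Qed.

Lemma squarefree_neq0 p : squarefree p -> p != 0.
Proof. by case/squarefree_polyP. Qed.

Lemma squarefree_dvdp p q : q %| p -> squarefree p -> squarefree q.
Proof.
move=> qp /squarefree_polyP[p0 sp]; apply/squarefree_polyP; split.
  by apply: contraNneq p0 => q0; move: qp; rewrite q0 dvd0p.
by move=> d dq; apply: sp; apply: dvdp_trans qp.
Qed.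

Lemma squarefree_coprimep p q : squarefree (p * q) -> coprimep p q.
Proof.
case/squarefree_polyP=> _ spq; apply/eqP/spq; rewrite expr2.
by apply: dvdp_mul; [apply: dvdp_gcdl | apply: dvdp_gcdr].
Qed.

Lemma squarefreeM p q : squarefree p -> squarefree q -> coprimep p q ->
  squarefree (p * q).
Proof.
move=> /squarefree_polyP[p0 sp] /squarefree_polyP[q0 sq] cpq.
apply/squarefree_polyP; split; first exact: mulf_neq0.
move=> d dpq; pose e := gcdp d p.
have ep : e %| p := dvdp_gcdr _ _.
have coq : coprimep e q by apply: coprimep_dvdr cpq.
have e1 : size e = 1%N.
  apply: sp; have : e ^+ 2 %| p * q.
    by apply: dvdp_trans dpq; rewrite dvdp_exp2r // dvdp_gcdl.
  by rewrite Gauss_dvdpl // coprimep_expl.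
have : d ^+ 2 %| q by rewrite -(@Gauss_dvdpr _ _ p) // coprimep_expl // /coprimep e1.
exact: sq.
Qed.

Lemma squarefree_unit c : c != 0 -> squarefree (c%:P : {poly E}).
Proof.
move=> c0; apply/squarefree_polyP; split; first by rewrite polyC_eq0.
move=> d dc; have : d %| c%:P by apply: dvdp_trans dc; rewrite expr2 dvdp_mulIl.
move=> /dvdp_leq; rewrite polyC_eq0 => /(_ c0); rewrite size_polyC c0.
have : d != 0 by apply: contraNneq c0 => d0; move: dc; rewrite d0 expr0n dvd0p polyC_eq0.
by rewrite -size_poly_gt0; case: size => // -[].
Qed.

Lemma squarefree_part p : p != 0 -> exists f w, [/\ squarefree f, w != 0 & p = f * w ^+ 2].
Proof.
have [n] := ubnP (size p); elim: n p => // n IH p; rewrite ltnS => le p0.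
have [sp|nsp] := classic (squarefree p).
  by exists p, 1; rewrite expr1n mulr1 oner_neq0.
have [d [dp sd]] : exists d, d ^+ 2 %| p /\ size d <> 1%N.
  apply: NNPP => no; apply: nsp; apply/squarefree_polyP; split=> // d dp.
  by apply: NNPP => sd; apply: no; exists d.
case/dvdpP: dp => q pE.
have [q0 d0] : q != 0 /\ d != 0.
  by move: p0; rewrite pE mulf_eq0 expf_eq0 negb_or => /andP[].
have [|f [w [sf w0 qE]]] := IH q _ q0.
  apply: leq_trans le; rewrite pE size_mul ?expf_neq0 // expr2 size_mul //.
  move: sd; move: d0 q0; rewrite -!size_poly_gt0.
  by move: (size d) (size q) => a b; lia.
by exists f, (w * d); rewrite mulf_neq0 // pE qE; split=> //; ring.
Qed.

(** f and g / gcd(f, g) are coprime because g is squarefree. *)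
Lemma squarefree_lcm f g : squarefree f -> squarefree g ->
  exists m, [/\ squarefree m, f %| m & g %| m].
Proof.
move=> sf sg; pose d := gcdp f g; have g0 := squarefree_neq0 sg.
have gE : g = (g %/ d) * d by rewrite divpK ?dvdp_gcdr.
have d0 : d != 0 by rewrite gcdp_eq0 negb_and g0 orbT.
have cgd : coprimep (g %/ d) d by apply: squarefree_coprimep; rewrite -gE.
exists (f * (g %/ d)); split; last 2 first.
- exact: dvdp_mulIl.
- by rewrite {1}gE mulrC dvdp_mul ?dvdp_gcdl.
apply: squarefreeM => //; first by apply: squarefree_dvdp sg; rewrite {2}gE dvdp_mulIl.
rewrite coprimep_sym; apply/coprimepP => e eg ef; apply/(coprimepP _ _ cgd) => //.
by rewrite dvdp_gcd ef; rewrite gE dvdp_mulr.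
Qed.

Lemma squarefree_common_multiple m (t : 'I_m -> {poly E}) :
  (forall i, squarefree (t i)) ->
  exists2 f, squarefree f & forall i, t i %| f.
Proof.
elim: m t => [|m IH] t st; first by exists 1; [exact/squarefree_unit/oner_neq0 | case].
have [f sf ft] := IH _ (fun i => st (lift ord0 i)).
have [g [sg fg tg]] := squarefree_lcm sf (st ord0).
exists g => // i; case: (unliftP ord0 i) => [j ->|-> //].
exact: dvdp_trans (ft j) fg.
Qed.

Lemma bezout1 p q : coprimep p q -> exists u v, u * p + v * q = 1.
Proof. by move=> /Bezout_eq1_coprimepP[[u v] /= uv]; exists u, v. Qed.

Lemma inverse_modp a h : coprimep a h -> exists b, h %| a * b - 1.
Proof.
case/bezout1=> u [v uv]; exists u; rewrite -uv.
by rewrite (_ : _ - _ = (- v) * h) ?dvdp_mulIr //; ring.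
Qed.

Lemma chinese_poly p q a b : coprimep p q -> exists c, p %| c - a /\ q %| c - b.
Proof.
case/bezout1=> u [v uv]; exists (b * (u * p) + a * (v * q)); split.
  rewrite (_ : _ - _ = ((b - a) * u) * p + a * (u * p + v * q - 1)); last by ring.
  by rewrite uv subrr mulr0 addr0 dvdp_mulIr.
rewrite (_ : _ - _ = ((a - b) * v) * q + b * (u * p + v * q - 1)); last by ring.
by rewrite uv subrr mulr0 addr0 dvdp_mulIr.
Qed.

(** z is the gcd of the squarefree parts of A and B. *)
Lemma coprime_square_classes A B : A != 0 -> B != 0 ->
  exists x y z m1 m2 : {poly E}, [/\ squarefree (x * y * z), m1 != 0, m2 != 0,
    A = y * z * m1 ^+ 2 & B = x * z * m2 ^+ 2].
Proof.
move=> A0 B0.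
have [A1 [m1 [sA m10 AE]]] := squarefree_part A0.
have [B1 [m2 [sB m20 BE]]] := squarefree_part B0.
pose z := gcdp A1 B1; have z0 : z != 0 by rewrite gcdp_eq0 negb_and squarefree_neq0.
have A1E : A1 = (A1 %/ z) * z by rewrite divpK ?dvdp_gcdl.
have B1E : B1 = (B1 %/ z) * z by rewrite divpK ?dvdp_gcdr.
exists (B1 %/ z), (A1 %/ z), z, m1, m2; split=> //; last 2 first.
- by rewrite -A1E.
- by rewrite -B1E.
rewrite -mulrA -A1E; apply: squarefreeM => //.
  by apply: squarefree_dvdp sB; rewrite {2}B1E dvdp_mulIl.
rewrite A1E coprimepMr.
have cz : coprimep (B1 %/ z) z by apply: squarefree_coprimep; rewrite -B1E.
rewrite cz andbT; apply/coprimepP => e eB eA; apply/(coprimepP _ _ cz) => //.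
by rewrite dvdp_gcd; apply/andP; split; [rewrite A1E|rewrite B1E]; rewrite dvdp_mulr.
Qed.

Lemma irreducible_factor f : (1 < size f)%N -> exists2 p, irreducible_poly p & p %| f.
Proof.
have [n] := ubnP (size f); elim: n f => // n IH f; rewrite ltnS => le sf.
have [ip|nip] := classic (irreducible_poly f); first by exists f.
have [d [sd df nd]] : exists d, [/\ size d != 1%N, d %| f & ~~ (d %= f)].
  apply: NNPP => no; apply: nip; split=> // d sd df; apply/negPn/negP => nd.
  by apply: no; exists d.
have f0 : f != 0 by rewrite -size_poly_gt0 ltnW.
have d0 : d != 0 by apply: contraNneq f0 => d0; move: df; rewrite d0 dvd0p.
have ltd : (size d < size f)%N.
  by rewrite ltn_neqAle dvdp_leq // andbT; apply: contra nd => /eqP sE; rewrite -dvdp_size_eqp // sE.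
have [||p ip pd] := IH d; first exact: leq_trans ltd le.
  by move: sd d0; rewrite -size_poly_gt0; case: size => [|[]].
by exists p => //; apply: dvdp_trans df.
Qed.

Lemma squarefree_ind (P : {poly E} -> Prop) :
  (forall c, c != 0 -> P c%:P) ->
  (forall p f, irreducible_poly p -> coprimep p f -> P f -> P (p * f)) ->
  forall f, squarefree f -> P f.
Proof.
move=> P1 PM f; have [n] := ubnP (size f); elim: n f => // n IH f; rewrite ltnS => le sf.
have f0 := squarefree_neq0 sf.
have [s1|] := leqP (size f) 1.
  have := size1_polyC s1 => fE; rewrite fE; apply: P1.
  by move: f0; rewrite {1}fE polyC_eq0.
case/irreducible_factor => p ip /dvdpP[q fE].
have fE' : f = p * q by rewrite mulrC.
rewrite fE' in sf f0 le *; have cpq := squarefree_coprimep sf.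
apply: PM => //; apply: IH; last by apply: squarefree_dvdp sf; rewrite dvdp_mulIr.
apply: leq_trans le; move: f0; rewrite mulf_eq0 negb_or => /andP[p0 q0].
rewrite size_mul //; case: ip => sp _; move: q0; rewrite -size_poly_gt0.
by move: (size p) (size q) sp => a b; lia.
Qed.
End SquarefreePoly.

(** * A unimodular lattice of rank six *)

(** The quotient by the monic associate of p, presented by its projection. *)
Lemma residue_field (E : fieldType) (p : {poly E}) : irreducible_poly p ->
  exists (K : fieldType) (phi : {rmorphism {poly E} -> K}),
    (forall a, (phi a == 0) = (p %| a)) /\ (forall b, exists a, phi a = b).
Proof.
move=> ip; have p0 : p != 0 by case: ip => sp _; rewrite -size_poly_gt0 ltnW.
have l0 : (lead_coef p)^-1 != 0 by rewrite invr_eq0 lead_coef_eq0.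
pose q := (lead_coef p)^-1 *: p.
have qp : q %= p by rewrite eqp_scale.
have sq : size q = size p by apply: size_scale.
have iq : irreducible_poly q.
  split; first by rewrite sq; case: ip.
  by move=> d sd dq; rewrite (eqp_rtrans qp); case: ip => _; apply; rewrite -?(eqp_dvdr _ qp).
have mi : monic_irreducible_poly q.
  by split=> //; apply/monicP; rewrite lead_coefZ mulVf ?lead_coef_eq0.
exists ({poly %/ q with mi} : fieldType), (in_qpoly q : {rmorphism {poly E} -> {poly %/ q}}).
have qE : mk_monic q = q by rewrite mk_monicE.
split=> [a|b]; last first.
  by exists (val (b : {poly %/ q})); apply/val_inj; apply: in_qpoly_small; apply: size_mk_monic.
rewrite -(eqp_dvdl _ qp); apply/eqP/idP => [/(congr1 val) /=|qa].
  by rewrite qE -Pdiv.IdomainMonic.modpE ?mi // => /eqP.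
by apply/val_inj; rewrite /= qE -Pdiv.IdomainMonic.modpE ?mi //; apply/eqP.
Qed.

Section Gram.
Variable R : comNzRingType.
Variables x y z k w u t1 t2 t3 t6 N : R.

Definition gram4 : 'M[R]_4 := diag_mx (\row_i nth 0 [:: x; y; z; - k] i).
Definition gram42 : 'M[R]_(4, 2) :=
  \matrix_(i, j) nth 0 (nth [::] [:: [:: 0; t1]; [:: 0; t2]; [:: 0; t3]; [:: - w; 0]] i) j.
Definition gram2 : 'M[R]_2 := \matrix_(i, j) nth 0 (nth [::] [:: [:: u; t6]; [:: t6; N]] i) j.
(** The form <x, y, z, -k> bordered by two vectors. With g = k u + w^2 its determinant
is -1 when xyzgN is the sum in [det_gram6], which can be solved for N
when that sum vanishes modulo x, y, z and g. *)
Definition gram6 : 'M[R]_(4 + 2) := block_mx gram4 gram42 gram42^T gram2.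

Lemma gram6_sym : gram6^T = gram6.
Proof.
rewrite /gram6 tr_block_mx trmxK tr_diag_mx; congr (block_mx _ _ _ _).
by apply/matrixP => i j; rewrite !mxE; case: i => [[|[|]]] //= ?; case: j => [[|[|]]] //=.
Qed.

Lemma qf_gram4 (v : 'rV[R]_4) : (v *m gram4 *m v^T) 0 0 =
  x * v 0 0 ^+ 2 + y * v 0 1 ^+ 2 + z * v 0 2%:R ^+ 2 - k * v 0 3%:R ^+ 2.
Proof.
rewrite mul_mx_diag mxE !big_ord_recl big_ord0 !mxE /=.
have -> : lift ord0 (ord0 : 'I_3) = 1 by apply/val_inj.
have -> : lift ord0 (lift ord0 (ord0 : 'I_2)) = 2%:R by apply/val_inj.
have -> : lift ord0 (lift ord0 (lift ord0 (ord0 : 'I_1))) = 3%:R by apply/val_inj.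
have -> : ord0 = 0 :> 'I_4 by [].
ring.
Qed.
End Gram.

Lemma gram6_map (R S : comNzRingType) (f : {rmorphism R -> S}) x y z k w u t1 t2 t3 t6 N :
  map_mx f (gram6 x y z k w u t1 t2 t3 t6 N) =
  gram6 (f x) (f y) (f z) (f k) (f w) (f u) (f t1) (f t2) (f t3) (f t6) (f N).
Proof.
rewrite /gram6 map_block_mx; congr (block_mx _ _ _ _); apply/matrixP => i j.
- rewrite !mxE rmorphMn; congr (_ *+ _).
  by case: i => [[|[|[|[|]]]]] //= ?; rewrite ?rmorphN.
- rewrite !mxE; case: i => [[|[|[|[|]]]]] //= ?; case: j => [[|[|]]] //= ?;
  by rewrite ?rmorphN ?rmorph0.
- rewrite !mxE; case: j => [[|[|[|[|]]]]] //= ?; case: i => [[|[|]]] //= ?;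
  by rewrite ?rmorphN ?rmorph0.
- by rewrite !mxE; case: i => [[|[|]]] //= ?; case: j => [[|[|]]] //= ?.
Qed.

(** Schur complement of the diagonal block <x, y, z, -k>. *)
Lemma det_gram6_field (K : fieldType) (x y z k w u t1 t2 t3 t6 N g : K) :
  x != 0 -> y != 0 -> z != 0 -> k != 0 -> g != 0 ->
  k * u = g - w ^+ 2 ->
  x * y * z * g * N = t1 ^+ 2 * (y * z * g) + t2 ^+ 2 * (x * z * g) +
    t3 ^+ 2 * (x * y * g) + t6 ^+ 2 * (x * y * z * k) + 1 ->
  \det (gram6 x y z k w u t1 t2 t3 t6 N) = -1.
Proof.
move=> x0 y0 z0 k0 g0 uE NE.
pose D := gram4 x y z k; pose C := gram42 w t1 t2 t3; pose F := gram2 u t6 N.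
pose Di : 'M[K]_4 := diag_mx (\row_i (nth 0 [:: x; y; z; - k] i)^-1).
have DDi : D *m Di = 1%:M.
  rewrite /D /Di /gram4 mulmx_diag; apply/matrixP => i j; rewrite !mxE.
  case: eqVneq => // -> ; rewrite mulr1n mulfV //.
  by case: j => [[|[|[|[|]]]]] //= _; rewrite ?oppr_eq0.
have DiD : Di *m D = 1%:M by apply: mulmx1C.
pose S := F - C^T *m Di *m C.
have -> : gram6 x y z k w u t1 t2 t3 t6 N = block_mx 1%:M 0 (C^T *m Di) 1%:M *m block_mx D C 0 S.
  rewrite mulmx_block !mul1mx !mul0mx !addr0 -mulmxA DiD mulmx1.
  by rewrite /S addrC subrK.
rewrite det_mulmx det_lblock !det1 !mul1r det_ublock.
have -> : \det D = - (x * y * z * k).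
  by rewrite det_diag !big_ord_recl big_ord0 !mxE /=; ring.
have SE i j : S i j = F i j - \sum_l C l i * C l j * (nth 0 [:: x; y; z; - k] l)^-1.
  rewrite [LHS]mxE [X in _ + X]mxE mul_mx_diag [X in _ - X]mxE; congr (_ - _).
  by apply: eq_bigr => l _; rewrite [X in X * _]mxE [C^T _ _]mxE [X in _ * X * _]mxE; ring.
have i1 : 1 = Ordinal (isT : (1 < 2)%N) by apply/val_inj.
rewrite det_mx22 !SE !big_ord_recl !big_ord0 !mxE /=.
have uE' : u = (g - w ^+ 2) / k by rewrite -uE mulrC mulKf.
have NE' : N = (t1 ^+ 2 * (y * z * g) + t2 ^+ 2 * (x * z * g) +
    t3 ^+ 2 * (x * y * g) + t6 ^+ 2 * (x * y * z * k) + 1) / (x * y * z * g).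
  by rewrite -NE mulrC mulKf // !mulf_neq0.
rewrite uE' NE'; field.
by rewrite oppr_eq0 k0 x0 y0 z0 g0.
Qed.

(** The determinant is computed in E(X), where the diagonal block is invertible. *)
Lemma det_gram6 (E : fieldType) (x y z k w u t1 t2 t3 t6 N g : {poly E}) :
  x != 0 -> y != 0 -> z != 0 -> k != 0 -> g != 0 ->
  k * u = g - w ^+ 2 ->
  x * y * z * g * N = t1 ^+ 2 * (y * z * g) + t2 ^+ 2 * (x * z * g) +
    t3 ^+ 2 * (x * y * g) + t6 ^+ 2 * (x * y * z * k) + 1 ->
  \det (gram6 x y z k w u t1 t2 t3 t6 N) = -1.
Proof.
move=> x0 y0 z0 k0 g0 uE NE; apply/eqP; rewrite -(tofrac_eq _ (-1)); apply/eqP.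
rewrite -det_map_mx gram6_map rmorphN rmorph1.
apply: (@det_gram6_field _ _ _ _ _ _ _ _ _ _ _ _ (tofrac g)); rewrite ?tofrac_eq0 //.
  by rewrite -rmorphXn -rmorphM uE rmorphB.
by have := congr1 tofrac NE; rewrite !(rmorphD, rmorphM, rmorphXn, rmorph1).
Qed.

Section GramVectors.
Variables (K : fieldType) (x y z k w u t1 t2 t3 t6 N : K).
Let G := gram6 x y z k w u t1 t2 t3 t6 N.
Hypothesis G3 : totally_isotropic G 3.

(** A 3-dimensional space meets the 4-dimensional subspace where the last two
coordinates vanish. *)
Lemma gram6_isotropic : exists2 v : 'rV[K]_4, v != 0 &
  x * v 0 0 ^+ 2 + y * v 0 1 ^+ 2 + z * v 0 2%:R ^+ 2 = k * v 0 3%:R ^+ 2.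
Proof.
have [W [V [WV WM]]] := G3.
pose W1 := lsubmx W; pose W2 := rsubmx W.
have WE : W = row_mx W1 W2 by rewrite hsubmxK.
have [r r0 rW2] := tall_row_kernel W2 isT.
exists (r *m W1).
  apply: contra_neq r0 => rW1; have : r *m W = 0 by rewrite WE mul_mx_row rW1 rW2 row_mx0.
  by move=> /(congr1 (mulmx^~ V)); rewrite -mulmxA WV mulmx1 mul0mx.
apply/eqP; rewrite -subr_eq0 -qf_gram4; apply/eqP.
have : (r *m W) *m G *m (r *m W)^T = 0.
  by rewrite trmx_mul !mulmxA -[_ *m W *m G]mulmxA -[_ *m (W *m G) *m _]mulmxA WM mulmx0 mul0mx.
rewrite WE mul_mx_row rW2 /G /gram6 mul_row_block !mul0mx !addr0 tr_row_mx mul_row_col.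
by rewrite trmx0 mulmx0 addr0 => ->; rewrite mxE.
Qed.

(** For k = 0 the fourth basis vector is isotropic, so the argument of
[gram6_isotropic] could produce just that vector. If it produces nothing else, the
3-space contains it, hence is orthogonal to it; as w is nonzero, the 3-space then
has no component along the fifth basis vector, and meets the 4-dimensional
subspace in a plane, a contradiction. *)
Lemma gram6_isotropic3 : k = 0 -> w != 0 -> exists2 v : 'rV[K]_4,
  [|| v 0 0 != 0, v 0 1 != 0 | v 0 2%:R != 0] &
  x * v 0 0 ^+ 2 + y * v 0 1 ^+ 2 + z * v 0 2%:R ^+ 2 = 0.
Proof.
move=> k0 w0; have [v v0 qv] := gram6_isotropic.
have [W [V [WV WM]]] := G3.
pose W1 := lsubmx W; pose W2 := rsubmx W.
have WE : W = row_mx W1 W2 by rewrite hsubmxK.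
have rowW (r : 'rV_3) : r *m W = row_mx (r *m W1) (r *m W2) by rewrite WE mul_mx_row.
have qr (r : 'rV_3) : r *m W2 = 0 -> x * (r *m W1) 0 0 ^+ 2 + y * (r *m W1) 0 1 ^+ 2 +
    z * (r *m W1) 0 2%:R ^+ 2 = 0.
  move=> rW2; have : (r *m W) *m G *m (r *m W)^T = 0.
    by rewrite trmx_mul !mulmxA -[_ *m W *m G]mulmxA -[_ *m (W *m G) *m _]mulmxA WM mulmx0 mul0mx.
  rewrite rowW rW2 /G /gram6 mul_row_block !mul0mx !addr0 tr_row_mx mul_row_col.
  rewrite trmx0 mulmx0 addr0 => /matrixP/(_ 0 0); rewrite qf_gram4 k0 mul0r subr0 => ->.
  by rewrite mxE.
have [[r nz rW2]|none] := classic (exists2 r : 'rV_3,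
    [|| (r *m W1) 0 0 != 0, (r *m W1) 0 1 != 0 | (r *m W1) 0 2%:R != 0] & r *m W2 = 0).
  by exists (r *m W1); rewrite ?qr.
pose e3 : 'rV[K]_4 := delta_mx 0 3%:R.
have onlye3 r : r *m W2 = 0 -> r *m W1 = (r *m W1) 0 3%:R *: e3.
  move=> rW2; have : ~~ [|| (r *m W1) 0 0 != 0, (r *m W1) 0 1 != 0 | (r *m W1) 0 2%:R != 0].
    by apply/negP => nz; apply: none; exists r.
  rewrite !negb_or !negbK => /and3P[/eqP c0 /eqP c1 /eqP c2].
  apply/rowP => j; rewrite [RHS]mxE [e3 _ _]mxE eqxx /=.
  have [->|j3] := eqVneq j 3%:R; first by rewrite mulr1.
  rewrite mulr0; case: j j3 => [[|[|[|[|]]]]] //= lt _.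
  - by rewrite -[RHS]c0; congr (_ _ _); apply/val_inj.
  - by rewrite -[RHS]c1; congr (_ _ _); apply/val_inj.
  - by rewrite -[RHS]c2; congr (_ _ _); apply/val_inj.
have Winj r : r *m W = 0 -> r = 0 :> 'rV_3.
  by move=> /(congr1 (mulmx^~ V)); rewrite -mulmxA WV mulmx1 mul0mx.
have [r r0 rW2] := tall_row_kernel W2 isT.
set a := (r *m W1) 0 3%:R; have rW1 : r *m W1 = a *: e3 := onlye3 _ rW2.
have a0 : a != 0.
  apply: contra_neq r0 => a0; apply: Winj.
  by rewrite rowW rW2 rW1 a0 scale0r row_mx0.
have col0 : col 0 W2 = 0.
  have : (r *m W) *m G *m W^T = 0 by rewrite -!mulmxA [W *m _]mulmxA WM mulmx0.
  rewrite rowW rW2 rW1 {1}WE /G /gram6 mul_row_block !mul0mx !addr0 tr_row_mx mul_row_col.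
  have -> : (a *: e3) *m gram4 x y z k = 0.
    rewrite /gram4 mul_mx_diag; apply/rowP => j; rewrite !mxE eqxx /=.
    by case: j => [[|[|[|[|]]]]] //= lt; rewrite ?k0 ?oppr0 ?mulr0 ?mul0r.
  rewrite mul0mx add0r.
  have -> : (a *: e3) *m gram42 w t1 t2 t3 = - (a * w) *: delta_mx 0 0.
    rewrite -scalemxAl -rowE; apply/rowP => j; rewrite !mxE /=.
    by case: j => [[|[|]]] //= lt; rewrite ?mulr1 ?mulr0 ?mulrN ?mulNr.
  rewrite -scalemxAl -rowE => /eqP; rewrite scaler_eq0 oppr_eq0 mulf_eq0 (negPf a0) (negPf w0) /=.
  by move=> /eqP/(congr1 trmx); rewrite tr_row trmxK trmx0.
pose P := kermx (col 1 W2).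
have PW2 : P *m W2 = 0.
  apply/matrixP => i j; rewrite [RHS]mxE.
  have -> : (P *m W2) i j = (P *m col j W2) i 0 by rewrite colE mulmxA -colE [RHS]mxE.
  have [->|j1] := eqVneq j 1; first by rewrite mulmx_ker mxE.
  have -> : j = 0 by case: j j1 => [[|[|]]] //= lt _; apply/val_inj.
  by rewrite col0 mulmx0 mxE.
have rkP : (1 < \rank P)%N.
  by rewrite mxrank_ker; have := rank_leq_col (col 1 W2); case: (\rank _) => [|[|]].
clearbody P; have : (\rank (P *m W) <= 1)%N.
  have -> : P *m W = col 3%:R (P *m W1) *m row_mx e3 0.
    apply/row_matrixP => i; have PiW2 : row i P *m W2 = 0 by rewrite -row_mul PW2 rowE mulmx0.
    rewrite [LHS]row_mul [RHS]row_mul rowW PiW2 onlye3 // mul_mx_row mulmx0; congr (row_mx _ _).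
    rewrite [row i (col _ _)]mx11_scalar mul_scalar_mx; congr (_ *: _).
    by rewrite -row_mul !mxE.
  by rewrite (leq_trans (mxrankM_maxl _ _)) // rank_leq_col.
rewrite mxrankMfree; last by apply/row_freeP; exists V.
by rewrite leqNgt rkP.
Qed.
End GramVectors.

(** * The lattice attached to a solvable symbol *)

Section Solvable.
Variable E : fieldType.
Implicit Types (h s g x y z k p : {poly E}).

(** Some g is, up to squares, in the class of s modulo h and has h as a square modulo
g: the quaternion algebra (h, g) ramifies at the primes of h as s prescribes, and
not at the primes of g. *)
Definition symbol_solvable h s := exists g t m,
  [/\ g != 0, coprimep g h, h %| g - s * t ^+ 2 & g %| h - m ^+ 2].

(** At the primes dividing h = - xyzk, the algebra (h, s) then has the residues of
(-yz, -xz), whose norm form on pure quaternions is <yz, xz, xy>. *)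
Definition residue_cond x y z k s :=
  [/\ x %| s + y * z, y %| s + x * z, z %| s + x * y & k %| s - 1].

Lemma coprimepNr p q : coprimep p (- q) = coprimep p q.
Proof. by rewrite -scaleN1r coprimepZr // oppr_eq0 oner_neq0. Qed.

Lemma coprimepNl p q : coprimep (- p) q = coprimep p q.
Proof. by rewrite coprimep_sym coprimepNr coprimep_sym. Qed.

Lemma coprimep_congr p a b : p %| a - b -> coprimep b p -> coprimep a p.
Proof.
move=> pab cb; apply/coprimepP => e ea ep; apply/(coprimepP _ _ cb) => //.
by rewrite -(dvdp_addr _ (dvdp_trans ep pab)) subrK.
Qed.

Lemma coprimep_squarefree4 x y z k : squarefree (- (x * y * z * k)) ->
  [/\ coprimep x y, coprimep x z, coprimep y z & [/\ coprimep x k, coprimep y k & coprimep z k]].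
Proof.
move=> sf; have {}sf : squarefree (x * y * z * k).
  by apply: squarefree_dvdp sf; rewrite dvdpNr.
have := squarefree_coprimep sf; rewrite !coprimepMl => /andP[/andP[xk yk] zk].
have sf3 : squarefree (x * y * z) by apply: squarefree_dvdp sf; rewrite dvdp_mulIl.
have := squarefree_coprimep sf3; rewrite !coprimepMl => /andP[xz yz].
have sf2 : squarefree (x * y) by apply: squarefree_dvdp sf3; rewrite dvdp_mulIl.
by split => //; exact: squarefree_coprimep.
Qed.

Lemma coprimep_dvd_sub g s t h : coprimep g h -> h %| g - s * t ^+ 2 -> coprimep t h.
Proof.
move=> cg hg; have : coprimep (s * t ^+ 2) h.
  by apply: coprimep_congr cg; rewrite -dvdpNr opprB.
by rewrite coprimepMl coprimep_pexpl // => /andP[].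
Qed.

(** Each divisibility that N requires comes from one residue of s, except the one by
g, which comes from h being a square modulo g. *)
Lemma gram6_exists x y z k s :
  squarefree (- (x * y * z * k)) -> residue_cond x y z k s ->
  symbol_solvable (- (x * y * z * k)) s ->
  exists w u t1 t2 t3 t6 N, coprimep w k /\
    \det (gram6 x y z k w u t1 t2 t3 t6 N) = -1.
Proof.
set h := - _ => sf [sx sy sz sk] [g [t [m [g0 cgh hg gh]]]].
have [cxy cxz cyz [cxk cyk czk]] := coprimep_squarefree4 sf.
have cth := coprimep_dvd_sub cgh hg.
have h0 := squarefree_neq0 sf.
have [x0 [y0 [z0 k0]]] : x != 0 /\ y != 0 /\ z != 0 /\ k != 0.
  by move: h0; rewrite /h oppr_eq0 !mulf_eq0 !negb_or => /andP[/andP[/andP[]]].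
have split_h q : coprimep q h = [&& coprimep q x, coprimep q y, coprimep q z & coprimep q k].
  by rewrite /h coprimepNr !coprimepMr -!andbA.
have := cth; rewrite split_h => /and4P[ctx cty ctz ctk].
have := cgh; rewrite split_h => /and4P[cgx cgy cgz cgk].
have xh : x %| h by rewrite /h dvdpNr -!mulrA dvdp_mulIl.
have yh : y %| h by rewrite /h dvdpNr -!mulrA dvdp_mull // dvdp_mulIl.
have zh : z %| h by rewrite /h dvdpNr -!mulrA dvdp_mull // dvdp_mull // dvdp_mulIl.
have kh : k %| h by rewrite /h dvdpNr dvdp_mulIr.
(* A solution of t'^2 b g = -1 modulo a prime-to-b divisor a of h where s = -b. *)
have local_root a b : a %| h -> a %| s + b -> coprimep b a -> coprimep t a ->
    exists r, a %| r ^+ 2 * (b * g) + 1.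
  move=> ah sa cb ct.
  have [r rE] : exists r, a %| (b * t) * r - 1.
    by apply: inverse_modp; rewrite coprimepMl cb.
  exists r; have -> : r ^+ 2 * (b * g) + 1 = (r ^+ 2 * b) * (g - s * t ^+ 2) +
     (r ^+ 2 * b * t ^+ 2) * (s + b) - (b * t * r + 1) * (b * t * r - 1) by ring.
  apply: dvdp_sub; last exact: dvdp_mull.
  by apply: dvdp_add; apply: dvdp_mull => //; apply: dvdp_trans ah _.
have cyzx : coprimep (y * z) x by rewrite coprimepMl ![coprimep _ x]coprimep_sym cxy.
have cxzy : coprimep (x * z) y by rewrite coprimepMl cxy coprimep_sym.
have cxyz : coprimep (x * y) z by rewrite coprimepMl cxz.
have [t1 t1E] := local_root _ _ xh sx cyzx ctx.
have [t2 t2E] := local_root _ _ yh sy cxzy cty.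
have [t3 t3E] := local_root _ _ zh sz cxyz ctz.
have cmg : coprimep m g.
  have : coprimep (m ^+ 2) g by apply: (@coprimep_congr _ _ h); [rewrite -dvdpNr opprB | rewrite coprimep_sym].
  by rewrite coprimep_pexpl.
have [t6 t6E] := inverse_modp cmg.
have {}t6E : g %| t6 ^+ 2 * (x * y * z * k) + 1.
  have -> : t6 ^+ 2 * (x * y * z * k) + 1 =
    - t6 ^+ 2 * (h - m ^+ 2) - (m * t6 + 1) * (m * t6 - 1) by rewrite /h; ring.
  by rewrite dvdp_add ?dvdpNr ?dvdp_mull.
have kgt : k %| g - t ^+ 2.
  have -> : g - t ^+ 2 = (g - s * t ^+ 2) + t ^+ 2 * (s - 1) by ring.
  by rewrite dvdp_add ?dvdp_mull // (dvdp_trans kh).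
have [u uE] := dvdpP _ _ kgt.
have NE : x * y * z * g %| t1 ^+ 2 * (y * z * g) + t2 ^+ 2 * (x * z * g) +
    t3 ^+ 2 * (x * y * g) + t6 ^+ 2 * (x * y * z * k) + 1.
  rewrite Gauss_dvdp; last by rewrite !coprimepMl ![coprimep _ g]coprimep_sym cgx cgy.
  rewrite Gauss_dvdp; last by rewrite !coprimepMl cxz.
  rewrite Gauss_dvdp // -!andbA; apply/and4P; split.
  - rewrite [X in _ %| X](_ : _ = (t1 ^+ 2 * (y * z * g) + 1) +
      x * (t2 ^+ 2 * (z * g) + t3 ^+ 2 * (y * g) + t6 ^+ 2 * (y * z * k))); last by ring.
    by apply: dvdp_add => //; apply: dvdp_mulIl.
  - rewrite [X in _ %| X](_ : _ = (t2 ^+ 2 * (x * z * g) + 1) +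
      y * (t1 ^+ 2 * (z * g) + t3 ^+ 2 * (x * g) + t6 ^+ 2 * (x * z * k))); last by ring.
    by apply: dvdp_add => //; apply: dvdp_mulIl.
  - rewrite [X in _ %| X](_ : _ = (t3 ^+ 2 * (x * y * g) + 1) +
      z * (t1 ^+ 2 * (y * g) + t2 ^+ 2 * (x * g) + t6 ^+ 2 * (x * y * k))); last by ring.
    by apply: dvdp_add => //; apply: dvdp_mulIl.
  - rewrite [X in _ %| X](_ : _ = (t6 ^+ 2 * (x * y * z * k) + 1) +
      g * (t1 ^+ 2 * (y * z) + t2 ^+ 2 * (x * z) + t3 ^+ 2 * (x * y))); last by ring.
    by apply: dvdp_add => //; apply: dvdp_mulIl.
have [N NE'] := dvdpP _ _ NE.
exists t, u, t1, t2, t3, t6, N; split=> //.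
apply: (@det_gram6 _ _ _ _ _ _ _ _ _ _ _ _ g) => //.
  by rewrite mulrC -uE.
by rewrite NE' mulrC.
Qed.

Lemma polynorm_congr x s a : x != 0 -> x %| s - a -> polynorm x s = polynorm x a.
Proof.
move=> x0 /modp_eq0P xs; apply: polynorm_mod => //.
by rewrite -[s](subrK a) modpD xs add0r.
Qed.

(** The definition of square-reflexivity, in terms of representatives. *)
Lemma square_reflexive_solvable h s e : square_reflexive h -> coprimep s h ->
  polynorm h s = e ^+ 2 -> symbol_solvable h s.
Proof.
case=> h0 _ hr csh Ns.
have [b sb] := inverse_modp csh.
have cl0 a : h %| a -> polyclass h a = 0.
  by move=> ha; apply/eqP; rewrite polyclass_eq0.
case: (hr (polyclass h s)).
- exists (polyclass h b); rewrite -rmorphM -[1](rmorph1 (polyclass h)); apply/eqP.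
  by rewrite -subr_eq0 -rmorphB; apply/eqP; apply: cl0.
- left; exists e => //; exists e^-1; rewrite mulfV //.
  have := polynorm_neq0 h0 csh; rewrite Ns; apply: contraNneq => ->.
  by rewrite expr0n.
move=> g [g0 cgh [_ [r _ ->] gE] [m _ mE]].
exists g, (r : {poly E}), (m : {poly E}); split=> //.
  rewrite -polyclass_eq0 // rmorphB rmorphM rmorphXn /= polyclass_surj gE.
  by rewrite subrr.
by rewrite -polyclass_eq0 // rmorphB rmorphXn /= polyclass_surj mE subrr.
Qed.

(** The residue - (xy + xz + yz) modulo xyz satisfies the first three conditions at once. *)
Lemma residue_cond_exists x y z k : squarefree (- (x * y * z * k)) ->
  exists s, [/\ s != 0, residue_cond x y z k s & coprimep s (- (x * y * z * k))].
Proof.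
set h := - _ => sf; have h0 := squarefree_neq0 sf.
have [cxy cxz cyz [cxk cyk czk]] := coprimep_squarefree4 sf.
have [x0 [y0 [z0 k0]]] : x != 0 /\ y != 0 /\ z != 0 /\ k != 0.
  by move: h0; rewrite /h oppr_eq0 !mulf_eq0 !negb_or => /andP[/andP[/andP[]]].
have [s [s0 s1 sk]] : exists s,
    [/\ s != 0, x * y * z %| s - - (x * y + x * z + y * z) & k %| s - 1].
  have [s [s1 sk]] : exists s, x * y * z %| s - - (x * y + x * z + y * z) /\ k %| s - 1.
    by apply: chinese_poly; rewrite !coprimepMl cxk cyk.
  have [s0|s0] := eqVneq s 0; last by exists s.
  rewrite s0 in s1 sk; exists h; split=> //.
    by rewrite -[h](addr0) -addrA dvdp_add // /h dvdpNr dvdp_mulIl.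
  by rewrite -[h](addr0) -addrA dvdp_add // /h dvdpNr dvdp_mulIr.
have sE : s + (x * y + x * z + y * z) = s - - (x * y + x * z + y * z) by rewrite opprK.
have sx : x %| s + y * z.
  have -> : s + y * z = (s - - (x * y + x * z + y * z)) - x * (y + z) by ring.
  by rewrite dvdp_add ?dvdpNr ?dvdp_mulIl // (dvdp_trans _ s1) // -mulrA dvdp_mulIl.
have sy : y %| s + x * z.
  have -> : s + x * z = (s - - (x * y + x * z + y * z)) - y * (x + z) by ring.
  by rewrite dvdp_add ?dvdpNr ?dvdp_mulIl // (dvdp_trans _ s1) // mulrAC dvdp_mulIr.
have sz : z %| s + x * y.
  have -> : s + x * y = (s - - (x * y + x * z + y * z)) - z * (x + y) by ring.
  by rewrite dvdp_add ?dvdpNr ?dvdp_mulIl // (dvdp_trans _ s1) // dvdp_mulIr.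
have cs a b : a %| s + b -> coprimep b a -> coprimep s a.
  by move=> ab cb; apply: (@coprimep_congr _ _ (- b)); rewrite ?opprK // coprimepNl.
have csh : coprimep s h.
  rewrite /h coprimepNr !coprimepMr (cs _ _ sx) 1?(cs _ _ sy) 1?(cs _ _ sz) /=.
  - exact: (coprimep_congr sk (coprime1p _)).
  - by rewrite coprimepMl cxz.
  - by rewrite coprimepMl cxy coprimep_sym.
  - by rewrite coprimepMl ![coprimep _ x]coprimep_sym cxy.
by exists s.
Qed.

(** The factor k does not contribute to the norm of s, and the factors x, y, z
contribute a square. *)
Lemma residue_cond_solvable x y z k :
  square_reflexive (- (x * y * z * k)) ->
  odd (dg x) = odd (dg z) -> odd (dg y) = odd (dg z) ->
  exists2 s, residue_cond x y z k s & symbol_solvable (- (x * y * z * k)) s.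
Proof.
set h := - _ => hr oxz oyz; have [h0 sf _] := hr.
have [x0 [y0 [z0 k0]]] : x != 0 /\ y != 0 /\ z != 0 /\ k != 0.
  by move: h0; rewrite /h oppr_eq0 !mulf_eq0 !negb_or => /andP[/andP[/andP[]]].
have [s [s0 rc csh]] := residue_cond_exists sf; have [sx sy sz sk] := rc.
have [e eE] := polynorm_residues_square x0 y0 z0 oxz oyz.
exists s => //; apply: (square_reflexive_solvable (e := e) hr csh).
have -> : h = x * y * z * - k by rewrite /h mulrN.
rewrite !polynorm_modulusM ?mulf_neq0 ?oppr_eq0 // -eE.
rewrite (@polynorm_congr x _ (- (y * z))) ?opprK //.
rewrite (@polynorm_congr y _ (- (x * z))) ?opprK //.
rewrite (@polynorm_congr z _ (- (x * y))) ?opprK //.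
rewrite (@polynorm_congr (- k) _ 1) ?oppr_eq0 ?dvdpNl // polynorm1 ?oppr_eq0 //.
by rewrite mulr1.
Qed.
End Solvable.

(** * Linkage, and norms modulo a prime *)

Section Linkage.
Variable E : fieldType.
Hypothesis char2 : (2%:R : E) != 0.
Implicit Types (h s g x y z k p : {poly E}).

Section GramSix.
Variables x y z k w u t1 t2 t3 t6 N : {poly E}.
Let G := gram6 x y z k w u t1 t2 t3 t6 N.
Hypothesis detG : \det G = -1.

Let Gunit : G \in unitmx.
Proof. by rewrite unitmxE detG unitrN unitr1. Qed.

Lemma gram6_eval_disc r : let M := map_mx (horner_eval r) G in
  [/\ M^T = M, M \in unitmx & disc_square (k := 3) M].
Proof.
split; first by rewrite /= gram6_map gram6_sym.
  exact: unitmx_map.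
exists 1; rewrite det_map_mx detG /= /horner_eval hornerN hornerC.
by ring.
Qed.

(** At a point r of E the form has trivial discriminant, so it is hyperbolic if ternary
forms over E are isotropic, or if a totally isotropic plane is known at r. *)
Lemma gram6_hyperbolic r j : (j = 2%N \/ (j = 0%N /\ ternary_isotropic E)) ->
  totally_isotropic (map_mx (horner_eval r) G) j ->
  totally_isotropic G 3.
Proof.
move=> jE Tj; apply: (totally_isotropic_lift (r := r) (gram6_sym _ _ _ _ _ _ _ _ _ _ _) Gunit).
have [Ms Mu Md] := gram6_eval_disc r.
case: jE => [j2|[_ tern]]; first rewrite j2 in Tj; last exact: (@totally_isotropic_ternary _ char2 3).
exact: (@totally_isotropic_disc_square _ 3).
Qed.
End GramSix.

(** The image of the lattice under phi keeps its totally isotropic 3-space. For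
phi = identity into E(X), this says that <yz, xz, xy> represents - h. *)
Lemma common_slot x y z k s (K : fieldType) (phi : {rmorphism {poly E} -> K}) :
  ternary_isotropic E -> squarefree (- (x * y * z * k)) ->
  residue_cond x y z k s -> symbol_solvable (- (x * y * z * k)) s ->
  exists2 v : 'rV[K]_4, v != 0 & phi x * v 0 0 ^+ 2 + phi y * v 0 1 ^+ 2 +
    phi z * v 0 2%:R ^+ 2 = phi k * v 0 3%:R ^+ 2.
Proof.
move=> tern sf rc sv.
have [w [u [t1 [t2 [t3 [t6 [N [_ dG]]]]]]]] := gram6_exists sf rc sv.
have G3 := gram6_hyperbolic (r := 0) dG (or_intror (conj erefl tern)) (totally_isotropic0 _).
have := totally_isotropic_map phi G3; rewrite gram6_map.
exact: gram6_isotropic.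
Qed.

(** A multiple of m of large degree, of the parity needed, is added to c. *)
Lemma even_degree_rep (m c : {poly E}) : m != 0 -> exists a,
  [/\ m %| a - c, a != 0 & odd (dg a) = false].
Proof.
move=> m0; pose j := (size c + odd (size c + dg m))%N.
have szM : size (m * 'X^j) = (size m + j)%N by rewrite size_mulXn // addnC.
have sm : (0 < size m)%N by rewrite size_poly_gt0.
have szA : size (c + m * 'X^j) = (size m + j)%N.
  by rewrite addrC size_polyDl szM // /j addnCA -addn1 leq_add2l ltn_addr.
exists (c + m * 'X^j); split.
- by rewrite addrC addrA addNr add0r dvdp_mulIl.
- by rewrite -size_poly_gt0 szA addn_gt0 sm.
rewrite szA -(prednK sm) addSn /= oddD /j oddD.
by rewrite oddD; case: (odd (size c)); case: (odd _.-1).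
Qed.

Lemma irreducible_squarefree p : irreducible_poly p -> squarefree p.
Proof.
case=> sp ip; have p0 : p != 0 by rewrite -size_poly_gt0 ltnW.
apply/squarefree_polyP; split=> // d dp; apply/eqP/negPn/negP => sd.
have dp1 : d %| p by apply: dvdp_trans dp; rewrite expr2 dvdp_mulIl.
have := eqp_size (ip d sd dp1) => sE.
have := dvdp_leq p0 dp; rewrite expr2 size_mul; last 2 first.
- by apply: contraNneq p0 => d0; move: dp1; rewrite d0 dvd0p.
- by apply: contraNneq p0 => d0; move: dp1; rewrite d0 dvd0p.
by rewrite sE; move: sp; move: (size p) => n; lia.
Qed.

Hypothesis wsrE : weakly_square_reflexive E.

(** Isotropy of ternary forms over E is a consequence of this lemma, so here the lattice
must be made hyperbolic at some point by hand. Choose r with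
p(r) <> 0 and replace u, v by U, V of even degree, congruent to them modulo p and
with value 1 at r. With - U = yz m1^2, - V = xz m2^2 and k divisible by p (X - r),
the lattice at r contains a totally isotropic plane, since k(r) = 0 and
<y, z> is a hyperbolic plane at r. Modulo p, where k vanishes too, it gives an
isotropic vector of <x, y, z>, that is of <1, - u, - v>. *)
Lemma residue_norm_universal p u v : irreducible_poly p -> ~~ (p %| u) -> ~~ (p %| v) ->
  exists a b, p %| a ^+ 2 - u * b ^+ 2 - v.
Proof.
move=> ip pu pv; have p0 : p != 0 by case: ip => sp _; rewrite -size_poly_gt0 ltnW.
have cop q : coprimep p q = ~~ (p %| q).
  apply: irreducible_poly_coprime; exact: ip.
have [r pr] : exists r, p.[r] != 0.
  apply: NNPP => no.
  have pz r : root p r by apply/negPn/negP => ?; apply: no; exists r.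
  have X2 : ('X * ('X - 1%:P)) %| p.
    rewrite Gauss_dvdp; last by rewrite -[X in coprimep X](subr0) -polyC0 coprimep_XsubC2 // subr0 oner_neq0.
    by rewrite -[X in X %| _](subr0) -polyC0 !dvdp_XsubCl !pz.
  have [_ ip'] := ip.
  have /ip' : size ('X : {poly E}) != 1%N by rewrite size_polyX.
  move=> /(_ (dvdp_trans (dvdp_mulIl _ _) X2)) => Xp.
  move: X2; rewrite -(eqp_dvdr _ Xp) => /dvdp_leq; rewrite polyX_eq0 => /(_ isT).
  by rewrite mulrC size_mulX ?polyXsubC_eq0 // size_XsubC size_polyX.
have crp : coprimep p ('X - r%:P) by rewrite coprimep_XsubC.
have m0 : p * ('X - r%:P) != 0 by rewrite mulf_neq0 // polyXsubC_eq0.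
have rep c : ~~ (p %| c) -> exists a, [/\ a != 0, odd (dg a) = false, p %| a - c & a.[r] = 1].
  move=> pc; have [c' [pc' rc']] := chinese_poly c 1 crp.
  have [a [ma a0 oa]] := even_degree_rep c' m0.
  exists a; split=> //.
    by rewrite -[a](subrK c') -addrA dvdp_add // (dvdp_trans _ ma) // dvdp_mulIl.
  have : 'X - r%:P %| a - 1.
    by rewrite -[a](subrK c') -addrA dvdp_add // (dvdp_trans _ ma) // dvdp_mulIr.
  by rewrite dvdp_XsubCl rootE !hornerE subr_eq0 => /eqP.
have [U [U0 oU pU rU]] := rep u pu; have [V [V0 oV pV rV]] := rep v pv.
have [x [y [z [m1 [m2 [sxyz m10 m20 UE VE]]]]]] : exists x y z m1 m2 : {poly E},
  [/\ squarefree (x * y * z), m1 != 0, m2 != 0, - U = y * z * m1 ^+ 2 & - V = x * z * m2 ^+ 2].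
  by apply: coprime_square_classes; rewrite oppr_eq0.
have xyz0 := squarefree_neq0 sxyz.
have [x0 [y0 z0]] : x != 0 /\ y != 0 /\ z != 0.
  by move: xyz0; rewrite !mulf_eq0 !negb_or => /andP[/andP[]].
have dgM (q q' : {poly E}) : q != 0 -> q' != 0 -> odd (dg (q * q')) = odd (dg q) (+) odd (dg q').
  by move=> q0 q'0; rewrite degM // oddD.
have oyz : odd (dg y) = odd (dg z).
  have : odd (dg (- U)) = false by rewrite size_polyN.
  rewrite UE expr2 !dgM ?mulf_neq0 // addbb addbF.
  by case: odd; case: odd.
have oxz : odd (dg x) = odd (dg z).
  have : odd (dg (- V)) = false by rewrite size_polyN.
  rewrite VE expr2 !dgM ?mulf_neq0 // addbb addbF.
  by case: odd; case: odd.
have pUn : coprimep p (- U).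
  by rewrite coprimepNr coprimep_sym; apply: (coprimep_congr pU); rewrite coprimep_sym cop.
have pVn : coprimep p (- V).
  by rewrite coprimepNr coprimep_sym; apply: (coprimep_congr pV); rewrite coprimep_sym cop.
move: pUn pVn; rewrite UE VE !coprimepMr => /andP[/andP[py pz] /andP[pm1 _]] /andP[/andP[px _] /andP[pm2 _]].
have UrE := congr1 (fun q : {poly E} => q.[r]) UE.
have VrE := congr1 (fun q : {poly E} => q.[r]) VE.
rewrite hornerN 2!hornerM horner_exp rU in UrE; rewrite hornerN 2!hornerM horner_exp rV in VrE.
have ur0 : y.[r] * z.[r] * m1.[r] ^+ 2 != 0 by rewrite -UrE oppr_eq0 oner_neq0.
have vr0 : x.[r] * z.[r] * m2.[r] ^+ 2 != 0 by rewrite -VrE oppr_eq0 oner_neq0.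
have [yr zr m1r] : [/\ y.[r] != 0, z.[r] != 0 & m1.[r] != 0].
  by move: ur0; rewrite !mulf_eq0 !negb_or => /andP[/andP[-> ->] /andP[]].
have xr : x.[r] != 0 by move: vr0; rewrite !mulf_eq0 !negb_or => /andP[/andP[]].
pose f := x * y * z * (p * ('X - r%:P)).
have sf : squarefree f.
  apply: squarefreeM => //; last first.
    rewrite !coprimepMl !coprimepMr ![coprimep _ p]coprimep_sym px py pz.
    by rewrite !coprimep_XsubC !rootE xr yr zr.
  apply: squarefreeM => //; first exact: irreducible_squarefree.
  apply: irreducible_squarefree; split; first by rewrite size_XsubC.
  move=> d sd; exact: (irredp_XsubC r).2.
have [h hr fh] := wsrE sf.
have [q hE] := dvdpP _ _ fh.
pose k := - (q * (p * ('X - r%:P))).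
have hE' : h = - (x * y * z * k) by rewrite hE /k /f; ring.
rewrite hE' in hr; have [s rc sv] := residue_cond_solvable hr oxz oyz.
have sh : squarefree (- (x * y * z * k)) by case: hr.
have [w [t [t1 [t2 [t3 [t6 [N [cwk dG]]]]]]]] := gram6_exists sh rc sv.
have kr : k.[r] = 0 by rewrite /k hornerN !hornerM hornerXsubC subrr !mulr0 oppr0.
have G3 : totally_isotropic (gram6 x y z k w t t1 t2 t3 t6 N) 3.
  apply: (gram6_hyperbolic (r := r) (j := 2) dG); first by left.
  rewrite gram6_map /= /horner_eval kr.
  pose A : 'M[E]_(2, 4) := \matrix_(i, j)
    nth 0 (nth [::] [:: [:: 0; z.[r]; m1.[r]^-1; 0]; [:: 0; 0; 0; 1]] i) j.
  pose B : 'M[E]_(4, 2) := \matrix_(i, j)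
    nth 0 (nth [::] [:: [:: 0; 0]; [:: z.[r]^-1; 0]; [:: 0; 0]; [:: 0; 1]] i) j.
  exists (row_mx A 0), (col_mx B 0); split.
    rewrite mul_row_col mul0mx addr0; apply/matrixP => i j; rewrite !mxE.
    rewrite !big_ord_recl big_ord0 !mxE /=.
    by case: i => [[|[|]]] //= ?; case: j => [[|[|]]] //= ?;
       rewrite ?mulr0 ?mul0r ?addr0 ?add0r ?mulr1 ?mulfV.
  rewrite /gram6 mul_row_block !mul0mx !addr0 tr_row_mx mul_row_col trmx0 mulmx0 addr0.
  rewrite mul_mx_diag; apply/matrixP => i j; rewrite !mxE.
  rewrite !big_ord_recl big_ord0 !mxE /=.
  case: i => [[|[|]]] //= ?; case: j => [[|[|]]] //= ?;
    rewrite ?(mulr0, mul0r, oppr0, addr0, add0r) //.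
  transitivity (z.[r] / m1.[r] ^+ 2 * (y.[r] * z.[r] * m1.[r] ^+ 2 + 1)).
    by field; rewrite m1r.
  by rewrite -UrE addNr mulr0.
have [K [phi [phi0 phis]]] := residue_field ip.
have := totally_isotropic_map phi G3; rewrite gram6_map => /gram6_isotropic3 [].
- by apply/eqP; rewrite phi0 /k dvdpNr dvdp_mull // dvdp_mulIl.
- rewrite phi0 -cop coprimep_sym; apply: (coprimep_dvdl _ cwk).
  by rewrite /k dvdpNr dvdp_mull // dvdp_mulIl.
move=> c nz qc.
have pn (q' : {poly E}) : coprimep p q' -> phi q' != 0 by rewrite cop phi0.
have phiU : phi u = - (phi y * phi z * phi m1 ^+ 2).
  rewrite -rmorphXn -!rmorphM -rmorphN -UE opprK.
  by apply/esym/eqP; rewrite -subr_eq0 -rmorphB phi0.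
have phiV : phi v = - (phi x * phi z * phi m2 ^+ 2).
  rewrite -rmorphXn -!rmorphM -rmorphN -VE opprK.
  by apply/esym/eqP; rewrite -subr_eq0 -rmorphB phi0.
have two : (2%:R : K) != 0.
  rewrite -(rmorph_nat phi) -polyC_natr phi0; apply/negP => /dvdp_leq.
  by rewrite polyC_eq0 char2 size_polyC char2 leqNgt => /(_ isT); case: ip => ->.
pose c0 := c 0 0 / phi m2; pose c1 := c 0 1 / phi m1; pose Z := phi z * c 0 2%:R.
have qE : Z ^+ 2 = phi u * c1 ^+ 2 + phi v * c0 ^+ 2.
  transitivity (phi z * (phi x * c 0 0 ^+ 2 + phi y * c 0 1 ^+ 2 + phi z * c 0 2%:R ^+ 2)
     - phi z * phi x * c 0 0 ^+ 2 - phi z * phi y * c 0 1 ^+ 2); first by rewrite /Z; ring.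
  by rewrite qc mulr0 phiU phiV /c0 /c1; field; rewrite !pn.
have nzZ : [|| Z != 0, c1 != 0 | c0 != 0].
  move: nz; rewrite /Z /c0 /c1 !mulf_eq0 !negb_or !invr_eq0 !pn //.
  by case: (_ != 0); case: (_ != 0); case: (_ != 0).
clearbody c0 c1 Z.
suff [a [b ab]] : exists a b, a ^+ 2 - phi u * b ^+ 2 = phi v.
  have [a' aE] := phis a; have [b' bE] := phis b; exists a', b'.
  by rewrite -phi0 !(rmorphB, rmorphM, rmorphXn) /= aE bE ab subrr.
have [c00|c00] := eqVneq c0 0; last first.
  by exists (Z / c0), (c1 / c0); rewrite !expr_div_n qE; field.
have c10 : c1 != 0.
  apply: contraTneq nzZ => c10; move: qE; rewrite c00 c10 !expr0n !mulr0 addr0 => /eqP.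
  by rewrite expf_eq0 /= => /eqP ->; rewrite !eqxx.
have uE : phi u = (Z / c1) ^+ 2.
  by rewrite expr_div_n qE c00 expr0n mulr0 addr0 mulfK ?expf_neq0.
have u0 : Z / c1 != 0.
  by have := pn u; rewrite cop pu uE => /(_ isT); rewrite expf_eq0.
exists ((phi v + 1) / 2%:R), ((1 - phi v) / (2%:R * (Z / c1))).
rewrite uE; move: (Z / c1) u0 => rho rho0; field; by rewrite rho0 two.
Qed.
End Linkage.

(** * Three-fold Pfister forms *)

Section Quaternion.
Variable R : idomainType.
Implicit Types (u v e s : R) (a b : R * R * R * R).

(** The reduced norm of the quaternion algebra (u, v), and its product. *)
Definition qnorm u v a :=
  let: (a0, a1, a2, a3) := a in a0 ^+ 2 - u * a1 ^+ 2 - v * a2 ^+ 2 + u * v * a3 ^+ 2.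

Definition qmul u v a b : R * R * R * R :=
  let: (a0, a1, a2, a3) := a in let: (b0, b1, b2, b3) := b in
  (a0 * b0 + u * (a1 * b1) + v * (a2 * b2) - u * v * (a3 * b3),
   a0 * b1 + a1 * b0 - v * (a2 * b3) + v * (a3 * b2),
   a0 * b2 + a2 * b0 + u * (a1 * b3) - u * (a3 * b1),
   a0 * b3 + a3 * b0 + a1 * b2 - a2 * b1).

Lemma qnormM u v a b : qnorm u v (qmul u v a b) = qnorm u v a * qnorm u v b.
Proof. by case: a => [[[a0 a1] a2] a3]; case: b => [[[b0 b1] b2] b3] /=; ring. Qed.

Lemma qnorm0 u v : qnorm u v 0 = 0.
Proof. by rewrite /qnorm /=; ring. Qed.

(** Isotropy of the 3-fold Pfister form <<u, v, e>>, the norm form of (u, v) minus e times itself. *)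
Definition pfister_isotropic u v e := exists a b,
  (a != 0) || (b != 0) /\ qnorm u v a = e * qnorm u v b.

Lemma quad_eq0 (x y z t : R) : ((x, y, z, t) == 0) = [&& x == 0, y == 0, z == 0 & t == 0].
Proof. by rewrite -!pair_eqE /= /pair_eq /= -!pair_eqE /= /pair_eq /= -!andbA. Qed.

Lemma pfister_isotropic_qnorm u v e a : a != 0 -> qnorm u v a = 0 -> pfister_isotropic u v e.
Proof. by move=> a0 qa; exists a, 0; rewrite a0 qnorm0 mulr0. Qed.

Lemma pfister_isotropicC u v e : pfister_isotropic u v e -> pfister_isotropic v u e.
Proof.
case=> -[[[a0 a1] a2] a3] [[[[b0 b1] b2] b3] [nz /= qE]].
exists (a0, a2, a1, a3), (b0, b2, b1, b3); split.
  by move: nz; rewrite !quad_eq0 !negb_and; do 8!case: (_ != 0).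
transitivity (a0 ^+ 2 - u * a1 ^+ 2 - v * a2 ^+ 2 + u * v * a3 ^+ 2); first by rewrite /=; ring.
by rewrite qE /=; ring.
Qed.

Lemma pfister_isotropic_swap u v e : pfister_isotropic u v e -> pfister_isotropic u e v.
Proof.
case=> -[[[a0 a1] a2] a3] [[[[b0 b1] b2] b3] [nz /= /eqP qE]].
exists (a0, a1, b0, b1), (a2, a3, b2, b3); split.
  by move: nz; rewrite !quad_eq0 !negb_and; do 8!case: (_ != 0).
by apply/eqP; rewrite /= -subr_eq0; move: qE; rewrite -subr_eq0 => /eqP <-; apply/eqP; ring.
Qed.

Lemma pfister_isotropic_square u v e s : s != 0 ->
  pfister_isotropic u v (e * s ^+ 2) <-> pfister_isotropic u v e.
Proof.
move=> s0; split=> -[a [[[[b0 b1] b2] b3] [nz qE]]].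
  exists a, (s * b0, s * b1, s * b2, s * b3); split.
    by move: nz; rewrite !quad_eq0 !mulf_eq0 (negPf s0).
  by rewrite qE /=; ring.
case: a nz qE => [[[a0 a1] a2] a3] nz qE.
exists (s * a0, s * a1, s * a2, s * a3), (b0, b1, b2, b3); split.
  by move: nz; rewrite !quad_eq0 !mulf_eq0 (negPf s0).
transitivity (s ^+ 2 * qnorm u v (a0, a1, a2, a3)); first by rewrite /=; ring.
by rewrite qE; ring.
Qed.

Lemma pfister_isotropic_square1 u v e s : s != 0 ->
  pfister_isotropic (u * s ^+ 2) v e <-> pfister_isotropic u v e.
Proof.
move=> s0; split => /pfister_isotropicC/pfister_isotropic_swap H;
  apply/pfister_isotropicC/pfister_isotropic_swap;
  by move: H; rewrite pfister_isotropic_square.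
Qed.

Lemma pfister_isotropic_square2 u v e s : s != 0 ->
  pfister_isotropic u (v * s ^+ 2) e <-> pfister_isotropic u v e.
Proof.
move=> s0; split => /pfister_isotropicC H; apply/pfister_isotropicC;
  by move: H; rewrite pfister_isotropic_square1.
Qed.

(** Values of the norm form are similarity factors of it. *)
Lemma pfister_isotropic_norm u v e c : qnorm u v c != 0 ->
  pfister_isotropic u v (e * qnorm u v c) -> pfister_isotropic u v e.
Proof.
move=> qc [a [b [nz qE]]].
have [cb0|cb0] := eqVneq (qmul u v c b) 0; last first.
  by exists a, (qmul u v c b); rewrite cb0 orbT qE qnormM mulrA.
have qb : qnorm u v b = 0.
  apply/eqP; have /eqP := congr1 (qnorm u v) cb0.
  by rewrite qnormM qnorm0 mulf_eq0 (negPf qc).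
case/orP: nz => [a0|b0]; last exact: pfister_isotropic_qnorm b0 qb.
by apply: pfister_isotropic_qnorm a0 _; rewrite qE qb mulr0.
Qed.

(** The algebras (u, v) and (u + v, - uv) are isomorphic: the latter is generated by i + j and ij. *)
Lemma pfister_isotropic_add u v e : u + v != 0 ->
  pfister_isotropic (u + v) (- (u * v)) e -> pfister_isotropic u v e.
Proof.
move=> uv0.
pose f a : R * R * R * R := let: (a0, a1, a2, a3) := a in (a0, a1 + v * a3, a1 - u * a3, a2).
have fE a : qnorm u v (f a) = qnorm (u + v) (- (u * v)) a.
  by case: a => [[[a0 a1] a2] a3] /=; ring.
have f0 a : f a = 0 -> a = 0.
  case: a => [[[a0 a1] a2] a3] /eqP; rewrite /f quad_eq0 => /and4P[/eqP -> /eqP h1 /eqP h2 /eqP ->].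
  have a30 : a3 = 0.
    apply/eqP; have : (u + v) * a3 == 0.
      have -> : (u + v) * a3 = (a1 + v * a3) - (a1 - u * a3) by ring.
      by rewrite h1 h2 subrr.
    by rewrite mulf_eq0 (negPf uv0).
  by move: h1; rewrite a30 mulr0 addr0 => ->.
case=> a [b [nz qE]]; exists (f a), (f b); rewrite !fE; split => //.
by apply/orP; case/orP: nz => nz; [left|right]; apply: contraNneq nz => /f0 ->.
Qed.

(** The form <u, v, e> is, up to sign, a subform of the Pfister form. *)
Lemma pfister_isotropic_pure u v e c1 c2 c3 : [|| c1 != 0, c2 != 0 | c3 != 0] ->
  u * c1 ^+ 2 + v * c2 ^+ 2 + e * c3 ^+ 2 = 0 -> pfister_isotropic u v e.
Proof.
move=> nz qE; exists (0, c1, c2, 0), (c3, 0, 0, 0); split.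
  by rewrite !quad_eq0 !eqxx /= !andbT !negb_and -orbA.
apply/eqP; rewrite -subr_eq0 /=; apply/eqP.
transitivity (- (u * c1 ^+ 2 + v * c2 ^+ 2 + e * c3 ^+ 2)); first by ring.
by rewrite qE oppr0.
Qed.
End Quaternion.

Lemma pfister_isotropic_map (R S : idomainType) (f : {rmorphism R -> S}) u v e :
  injective f -> pfister_isotropic u v e -> pfister_isotropic (f u) (f v) (f e).
Proof.
move=> fi [[[[a0 a1] a2] a3] [[[[b0 b1] b2] b3] [nz /= qE]]].
exists (f a0, f a1, f a2, f a3), (f b0, f b1, f b2, f b3); split.
  have f0 x : (f x == 0) = (x == 0) by rewrite -(inj_eq fi) rmorph0.
  by move: nz; rewrite !quad_eq0 !f0.
have sE u' v' x0 x1 x2 x3 : f (x0 ^+ 2 - u' * x1 ^+ 2 - v' * x2 ^+ 2 + u' * v' * x3 ^+ 2) =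
    f x0 ^+ 2 - f u' * f x1 ^+ 2 - f v' * f x2 ^+ 2 + f u' * f v' * f x3 ^+ 2.
  by rewrite -!rmorphXn -!rmorphM -!rmorphB -rmorphD.
by have := congr1 f qE; rewrite rmorphM !sE.
Qed.

(** * Descent on the last slot *)

Section NormLattice.
Variables (R : comNzRingType) (u e al be r : R).

(** The norm form of (u, v) divided by e, on the lattice spanned by (e, 0, 0, 0),
(0, e, 0, 0), (al, be, 1, 0) and (u be, al, 0, 1), with
e r = al^2 - u be^2 - v. It is integral there because the last two vectors have
norm divisible by e. *)
Definition norm_gram : 'M[R]_(2 + 2) :=
  block_mx (\matrix_(i, j) nth 0 (nth [::] [:: [:: e; 0]; [:: 0; - (u * e)]] i) j)
           (\matrix_(i, j) nth 0 (nth [::] [:: [:: al; u * be]; [:: - (u * be); - (u * al)]] i) j)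
           (\matrix_(i, j) nth 0 (nth [::] [:: [:: al; - (u * be)]; [:: u * be; - (u * al)]] i) j)
           (\matrix_(i, j) nth 0 (nth [::] [:: [:: r; 0]; [:: 0; - (u * r)]] i) j).

Lemma norm_gram_sym : norm_gram^T = norm_gram.
Proof.
rewrite /norm_gram tr_block_mx; congr (block_mx _ _ _ _); apply/matrixP => i j; rewrite !mxE;
 by case: i => [[|[|]]] //= ?; case: j => [[|[|]]] //= ?.
Qed.
End NormLattice.

Lemma norm_gram_map (R S : comNzRingType) (f : {rmorphism R -> S}) u e al be r :
  map_mx f (norm_gram u e al be r) = norm_gram (f u) (f e) (f al) (f be) (f r).
Proof.
rewrite /norm_gram map_block_mx; congr (block_mx _ _ _ _); apply/matrixP => i j; rewrite !mxE;
 by case: i => [[|[|]]] //= ?; case: j => [[|[|]]] //= ?; rewrite ?(rmorphN, rmorphM, rmorph0).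
Qed.

Lemma qf_norm_gram (R : idomainType) (u v e al be r : R) (c : 'rV[R]_(2 + 2)) :
  e * r = al ^+ 2 - u * be ^+ 2 - v -> exists c0 c1 c2 c3,
  [/\ c = row_mx (\row_i nth 0 [:: c0; c1] i) (\row_i nth 0 [:: c2; c3] i) &
   e * qf (norm_gram u e al be r) c =
   qnorm u v (e * c0 + al * c2 + u * be * c3, e * c1 + be * c2 + al * c3, c2, c3)].
Proof.
move=> rE; exists (lsubmx c 0 0), (lsubmx c 0 1), (rsubmx c 0 0), (rsubmx c 0 1).
have i1 : lift ord0 ord0 = 1 :> 'I_2 by apply/val_inj.
have cE (d : 'rV[R]_2) : d = \row_i nth 0 [:: d 0 0; d 0 1] i.
  apply/rowP => -[[|[|]]] //= lt; rewrite mxE /=; congr (d _ _); exact/val_inj.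
split; first by rewrite -!cE hsubmxK.
rewrite /qf -[in LHS](hsubmxK c) /norm_gram mul_row_block tr_row_mx mul_row_col.
move: (lsubmx c) (rsubmx c) => a b.
rewrite !mulmxDl !mxE !big_ord_recl !big_ord0 !mxE !big_ord_recl !big_ord0 !mxE /= !i1.
have -> : ord0 = 0 :> 'I_2 by [].
have -> : v = al ^+ 2 - u * be ^+ 2 - e * r by rewrite rE; ring.
by ring.
Qed.

Lemma det_norm_gram_field (K : fieldType) (u v e al be r : K) : u != 0 -> e != 0 ->
  e * r = al ^+ 2 - u * be ^+ 2 - v -> \det (norm_gram u e al be r) = u ^+ 2 * v ^+ 2.
Proof.
move=> u0 e0 rE.
have rE' : r = (al ^+ 2 - u * be ^+ 2 - v) / e by rewrite -rE mulrC mulKf.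
pose Di : 'M[K]_2 := \matrix_(i, j) nth 0 (nth [::] [:: [:: e^-1; 0]; [:: 0; - (u * e)^-1]] i) j.
rewrite /norm_gram; set D := (X in block_mx X); set C := (X in block_mx _ X).
set C' := (X in block_mx _ _ X); set F := (X in block_mx _ _ _ X).
have i1 : lift ord0 ord0 = 1 :> 'I_2 by apply/val_inj.
have DiD : Di *m D = 1%:M.
  apply/matrixP => i j; rewrite !mxE !big_ord_recl big_ord0 !mxE /=.
  by case: i => [[|[|]]] //= ?; case: j => [[|[|]]] //= ?;
    rewrite ?(mulr0, mul0r, addr0, add0r, mulrNN) // mulVf ?mulf_neq0.
have -> : block_mx D C C' F = block_mx 1%:M 0 (C' *m Di) 1%:M *m block_mx D C 0 (F - C' *m Di *m C).
  rewrite mulmx_block !mul1mx !mul0mx !addr0 -mulmxA DiD mulmx1.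
  by rewrite addrC subrK.
rewrite det_mulmx det_lblock !det1 !mul1r det_ublock !det_mx22 !mxE.
rewrite !big_ord_recl !big_ord0 !mxE /= !big_ord_recl !big_ord0 !mxE /= rE'.
by field; rewrite u0 e0.
Qed.

Section PfisterDescent.
Variable E : fieldType.
Implicit Types (u v e f p : {poly E}).

Lemma det_norm_gram u v e al be r : u != 0 -> e != 0 ->
  e * r = al ^+ 2 - u * be ^+ 2 - v -> \det (norm_gram u e al be r) = u ^+ 2 * v ^+ 2.
Proof.
move=> u0 e0 rE; apply/eqP; rewrite -tofrac_eq; apply/eqP.
rewrite -det_map_mx norm_gram_map rmorphM !rmorphXn.
apply: det_norm_gram_field; rewrite ?tofrac_eq0 //.
by rewrite -!rmorphXn -!rmorphM -!rmorphB rE.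
Qed.

(** A vector of small value on the lattice of [norm_gram] exhibits e e' as a norm of
(u, v), so that e and e' define isometric Pfister forms. *)
Lemma pfister_descent_local u v e al be : u != 0 -> v != 0 -> e != 0 ->
  e %| al ^+ 2 - u * be ^+ 2 - v -> pfister_isotropic u v e \/
  exists e', [/\ e' != 0, ((dg e').*2 <= dg u + dg v)%N &
    pfister_isotropic u v e' -> pfister_isotropic u v e].
Proof.
move=> u0 v0 e0 /dvdpP[r rE].
have rE' : e * r = al ^+ 2 - u * be ^+ 2 - v by rewrite rE mulrC.
have dG := det_norm_gram u0 e0 rE'.
have iso c : c != 0 -> qf (norm_gram u e al be r) c = 0 -> pfister_isotropic u v e.
  move=> c0 qc; have [c0' [c1 [c2 [c3 [cE qE]]]]] := qf_norm_gram c rE'.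
  move: qE; rewrite qc mulr0 => /esym; apply: pfister_isotropic_qnorm.
  apply: contra_neq c0; rewrite cE => /eqP; rewrite quad_eq0 => /and4P[h0 h1 /eqP c20 /eqP c30].
  move: h0 h1; rewrite c20 c30 !mulr0 !addr0 !mulf_eq0 (negPf e0) => /eqP -> /eqP ->.
  apply/rowP => j; rewrite !mxE; case: split => -[[|[|]]] //= ?; by rewrite mxE.
have [[c c0 qc]|an] := classic (exists2 c, c != 0 & qf (norm_gram u e al be r) c = 0).
  by left; apply: iso qc.
have Ga : anisotropic (norm_gram u e al be r).
  by move=> c qc; apply/eqP/negPn/negP => c0; apply: an; exists c.
have [c c0 cH] := hermite_bound (norm_gram_sym u e al be r : _ = _ :> 'M_(3.+1)) Ga.
right; exists (qf (norm_gram u e al be r) c); split.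
- by apply: contra_neq c0 => /Ga.
- move: cH; rewrite dG size_mul ?expf_neq0 // !expr2 !size_mul //.
  have : (0 < size u)%N by rewrite size_poly_gt0.
  have : (0 < size v)%N by rewrite size_poly_gt0.
  clear; move: (size u) (size v) => a b; move: (size _) => d; lia.
move=> H.
have q0 : qf (norm_gram u e al be r) c != 0 by apply: contra_neq c0 => /Ga.
have [c0' [c1 [c2 [c3 [cE qE]]]]] := qf_norm_gram c rE'.
apply: (@pfister_isotropic_norm _ _ _ _
  (e * c0' + al * c2 + u * be * c3, e * c1 + be * c2 + al * c3, c2, c3)).
  by rewrite -qE mulf_neq0.
by rewrite -qE mulrA -expr2 mulrC pfister_isotropic_square.
Qed.

Hypothesis char2 : (2%:R : E) != 0.
Hypothesis wsrE : weakly_square_reflexive E.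

Lemma norm_congruence f u v : squarefree f -> coprimep f u -> coprimep f v ->
  exists a b, f %| a ^+ 2 - u * b ^+ 2 - v.
Proof.
move: f; apply: squarefree_ind => [c c0 _ _|p f ip cpf IH].
  exists 0, 0; have : c%:P %| (1 : {poly E}) by rewrite dvdp1 size_polyC c0.
  by move/dvdp_trans; apply; apply: dvd1p.
rewrite !coprimepMl => /andP[pu fu] /andP[pv fv].
have [a2 [b2 h2]] := IH fu fv.
have ndiv q : coprimep p q -> ~~ (p %| q).
  by rewrite irreducible_poly_coprime.
have [a1 [b1 h1]] := residue_norm_universal char2 wsrE ip (ndiv _ pu) (ndiv _ pv).
have [a [ap af]] := chinese_poly a1 a2 cpf.
have [b [bp bf]] := chinese_poly b1 b2 cpf.
exists a, b; rewrite Gauss_dvdp //.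
have step g a' b' : g %| a - a' -> g %| b - b' -> g %| a' ^+ 2 - u * b' ^+ 2 - v ->
    g %| a ^+ 2 - u * b ^+ 2 - v.
  move=> ga gb gv; have -> : a ^+ 2 - u * b ^+ 2 - v = (a + a') * (a - a') -
    u * (b + b') * (b - b') + (a' ^+ 2 - u * b' ^+ 2 - v) by ring.
  by apply: dvdp_add => //; apply: dvdp_sub; apply: dvdp_mull.
by rewrite (step _ a1 b1) // (step _ a2 b2).
Qed.
End PfisterDescent.

(** * Isotropy of three-fold Pfister forms over E(X) *)

Section PfisterInduction.
Variable E : fieldType.
Implicit Types (u v e f p : {poly E}).

Lemma squarefree_gcd_split a e : squarefree a ->
  exists a0 a1, [/\ a = a0 * a1, a0 %| e, coprimep a1 e & coprimep a0 a1].
Proof.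
move=> sa; pose a0 := gcdp a e.
have aE : a = a0 * (a %/ a0) by rewrite mulrC divpK ?dvdp_gcdl.
have c01 : coprimep a0 (a %/ a0) by apply: squarefree_coprimep; rewrite -aE.
exists a0, (a %/ a0); split => //; first exact: dvdp_gcdr.
apply/coprimepP => q q1 qe; apply/(coprimepP _ _ c01) => //.
by rewrite dvdp_gcd qe andbT aE dvdp_mull.
Qed.

(** The common divisors of e with u and v are removed by multiplying e with a norm:
splitting u, v along gcd(u, v) and then along the primes of e, one writes down a
quaternion whose norm is L n1, where L is the product of the primes common to e
and uv and where n1 is prime to uv. *)
Lemma pfister_coprime_slot u v e : squarefree u -> squarefree v -> squarefree e ->
  pfister_isotropic u v e \/ exists f, [/\ squarefree f, coprimep f u, coprimep f v &
    pfister_isotropic u v f -> pfister_isotropic u v e].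
Proof.
move=> su sv se; pose d := gcdp u v.
have uE : u = d * (u %/ d) by rewrite mulrC divpK ?dvdp_gcdl.
have vE : v = d * (v %/ d) by rewrite mulrC divpK ?dvdp_gcdr.
have cdu : coprimep d (u %/ d) by apply: squarefree_coprimep; rewrite -uE.
have cdv : coprimep d (v %/ d) by apply: squarefree_coprimep; rewrite -vE.
have cuv : coprimep (u %/ d) (v %/ d).
  apply/coprimepP => q qu qv; apply/(coprimepP _ _ cdu) => //.
  by rewrite dvdp_gcd uE vE !dvdp_mull.
have sd : squarefree d by apply: squarefree_dvdp su; rewrite uE dvdp_mulIl.
have su' : squarefree (u %/ d) by apply: squarefree_dvdp su; rewrite [X in _ %| X]uE dvdp_mulIr.
have sv' : squarefree (v %/ d) by apply: squarefree_dvdp sv; rewrite [X in _ %| X]vE dvdp_mulIr.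
move: cdu cdv cuv su' sv' uE vE; move: (u %/ d) (v %/ d) => u' v' cdu cdv cuv su' sv' uE vE.
have [d0 [d1 [dE d0e d1e d01]]] := squarefree_gcd_split e sd.
have [p0 [p1 [pE p0e p1e p01]]] := squarefree_gcd_split e su'.
have [q0 [q1 [qE q0e q1e q01]]] := squarefree_gcd_split e sv'.
have d_0 := squarefree_neq0 sd; have u_0 := squarefree_neq0 su'; have v_0 := squarefree_neq0 sv'.
rewrite {}dE {}pE {}qE in cdu cdv cuv uE vE d_0 u_0 v_0; clear sd su' sv' d.
move: cdu cdv cuv; rewrite !coprimepMl !coprimepMr.
move=> /andP[/andP[d0p0 d0p1] /andP[d1p0 d1p1]] /andP[/andP[d0q0 d0q1] /andP[d1q0 d1q1]]
  /andP[/andP[p0q0 p0q1] /andP[p1q0 p1q1]].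
have /dvdpP[e1 eE] : d0 * p0 * q0 %| e.
  by rewrite Gauss_dvdp ?coprimepMl ?d0q0 // Gauss_dvdp // d0e p0e.
pose L := d0 * p0 * q0; rewrite -/L in eE.
have L0 : L != 0.
  by move: d_0 u_0 v_0; rewrite /L !mulf_eq0 !negb_or => /andP[-> _] /andP[-> _] /andP[-> _].
(* Modulo each of d0, d1, p0, p1, q0, q1 exactly one of the three terms survives. *)
pose n1 := L - d1 ^+ 3 * p1 ^+ 3 * q0 * q1 ^+ 2 - d0 ^+ 2 * d1 ^+ 3 * p0 * p1 ^+ 2 * q1 ^+ 3.
pose c := (L, d1 * p1 * q0 * q1, d0 * d1 * p0 * p1 * q1, 0 : {poly E}).
have nE : qnorm u v c = L * n1 by rewrite /= uE vE /n1 /L; ring.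
have [n0|n0] := eqVneq (qnorm u v c) 0.
  by left; apply: pfister_isotropic_qnorm n0; rewrite quad_eq0 negb_and L0.
right; have n10 : n1 != 0 by apply: contraNneq n0 => n1z; rewrite nE n1z mulr0.
have e10 : e1 != 0.
  by have := squarefree_neq0 se; rewrite eE mulf_eq0 negb_or => /andP[].
have [f [w [sf w0 mE]]] := squarefree_part (mulf_neq0 e10 n10).
have ce1L : coprimep e1 L by apply: squarefree_coprimep; rewrite -eE.
have ce1 : [&& coprimep e1 d0, coprimep e1 d1, coprimep e1 p0, coprimep e1 p1,
    coprimep e1 q0 & coprimep e1 q1].
  have e1e : e1 %| e by rewrite eE dvdp_mulIl.
  move: ce1L; rewrite /L !coprimepMr => /andP[/andP[-> ->] ->].
  by rewrite ![coprimep e1 _]coprimep_sym !(coprimep_dvdl e1e).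
have nc b g q : n1 = g + q * b -> coprimep g b -> coprimep n1 b.
  by move=> nE1; apply: coprimep_congr; rewrite nE1 addrAC subrr add0r dvdp_mull.
have cn1 : [&& coprimep n1 d0, coprimep n1 d1, coprimep n1 p0, coprimep n1 p1,
    coprimep n1 q0 & coprimep n1 q1].
  pose A := - (d1 ^+ 3 * p1 ^+ 3 * q0 * q1 ^+ 2).
  pose B := - (d0 ^+ 2 * d1 ^+ 3 * p0 * p1 ^+ 2 * q1 ^+ 3).
  have sy := coprimep_sym.
  apply/and5P; split; last (apply/andP; split).
  - apply: (@nc _ A (p0 * q0 - d0 * d1 ^+ 3 * p0 * p1 ^+ 2 * q1 ^+ 3)).
      by rewrite /n1 /L /A; ring.
    rewrite /A coprimepNl !(coprimepMl, coprimep_pexpl) //.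
    by rewrite ![coprimep _ d0]sy d01 d0p1 d0q0 d0q1.
  - apply: (@nc _ L (- (d1 ^+ 2 * p1 ^+ 3 * q0 * q1 ^+ 2) - d0 ^+ 2 * d1 ^+ 2 * p0 * p1 ^+ 2 * q1 ^+ 3)).
      by rewrite /n1 /L; ring.
    by rewrite /L !coprimepMl d01 [coprimep p0 _]sy d1p0 [coprimep q0 _]sy d1q0.
  - apply: (@nc _ A (d0 * q0 - d0 ^+ 2 * d1 ^+ 3 * p1 ^+ 2 * q1 ^+ 3)).
      by rewrite /n1 /L /A; ring.
    rewrite /A coprimepNl !(coprimepMl, coprimep_pexpl) //.
    by rewrite d1p0 ![coprimep _ p0]sy p01 p0q0 p0q1.
  - apply: (@nc _ L (- (d1 ^+ 3 * p1 ^+ 2 * q0 * q1 ^+ 2) - d0 ^+ 2 * d1 ^+ 3 * p0 * p1 * q1 ^+ 3)).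
      by rewrite /n1 /L; ring.
    by rewrite /L !coprimepMl d0p1 p01 [coprimep q0 _]sy p1q0.
  - apply: (@nc _ B (d0 * p0 - d1 ^+ 3 * p1 ^+ 3 * q1 ^+ 2)).
      by rewrite /n1 /L /B; ring.
    rewrite /B coprimepNl !(coprimepMl, coprimep_pexpl) //.
    by rewrite d0q0 d1q0 p0q0 p1q0 [coprimep q1 _]sy q01.
  - apply: (@nc _ L (- (d1 ^+ 3 * p1 ^+ 3 * q0 * q1) - d0 ^+ 2 * d1 ^+ 3 * p0 * p1 ^+ 2 * q1 ^+ 2)).
      by rewrite /n1 /L; ring.
    by rewrite /L !coprimepMl d0q1 p0q1 q01.
have cm b : coprimep e1 b -> coprimep n1 b -> coprimep f b.
  move=> c1 c2; apply: (coprimep_dvdr (p := e1 * n1)).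
    by rewrite mE dvdp_mulIl.
  by rewrite coprimepMl c1.
move/and5P: ce1 => [c1 c2 c3 c4 /andP[c5 c6]]; move/and5P: cn1 => [k1 k2 k3 k4 /andP[k5 k6]].
exists f; split => //.
- by rewrite uE !coprimepMr !cm.
- by rewrite vE !coprimepMr !cm.
rewrite -(pfister_isotropic_square u v f w0) -mE -(pfister_isotropic_square u v _ L0).
move=> H; apply: (pfister_isotropic_norm n0); rewrite nE eE.
by move: H; congr pfister_isotropic; ring.
Qed.

Hypothesis char2 : (2%:R : E) != 0.
Hypothesis wsrE : weakly_square_reflexive E.

(** Once e is coprime to uv, v is a norm modulo e and the local descent applies. *)
Lemma pfister_descent u v e : u != 0 -> v != 0 -> e != 0 ->
  pfister_isotropic u v e \/
  exists f, [/\ f != 0, ((dg f).*2 <= dg u + dg v)%N &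
    pfister_isotropic u v f -> pfister_isotropic u v e].
Proof.
move=> u0 v0 e0.
have [u1 [s [su s0 uE]]] := squarefree_part u0.
have [v1 [t [sv t0 vE]]] := squarefree_part v0.
have [e1 [r [se r0 eE]]] := squarefree_part e0.
have dgl (f g : {poly E}) : f != 0 -> g != 0 -> (dg f <= dg (f * g ^+ 2)%R)%N.
  move=> f0 g0; rewrite -!subn1 leq_sub2r // dvdp_leq ?dvdp_mulIl //.
  by rewrite mulf_neq0 ?expf_neq0.
have isoE g : pfister_isotropic u v g <-> pfister_isotropic u1 v1 g.
  by rewrite uE vE pfister_isotropic_square1 // pfister_isotropic_square2.
have isoE1 : pfister_isotropic u v e <-> pfister_isotropic u1 v1 e1.
  by rewrite isoE eE pfister_isotropic_square.
case: (pfister_coprime_slot su sv se) => [H|[f [sf fu fv fH]]]; first by left; apply/isoE1.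
have [a [b ab]] := norm_congruence char2 wsrE sf fu fv.
have u10 := squarefree_neq0 su; have v10 := squarefree_neq0 sv.
case: (pfister_descent_local u10 v10 (squarefree_neq0 sf) ab) => [H|[g [g0 gd gH]]].
  by left; apply/isoE1/fH.
right; exists g; split=> //.
  by rewrite (leq_trans gd) // leq_add // ?uE ?vE dgl.
by rewrite isoE => /gH/fH/isoE1.
Qed.

(** The residue field of the prime X is E. *)
Lemma ternary_isotropic_const : ternary_isotropic E.
Proof.
have iX : irreducible_poly ('X : {poly E}).
  by have := @irredp_XsubC E 0; rewrite subr0.
move=> a b c.
have [a0|a0] := eqVneq a 0; first by exists 1, 0, 0; rewrite oner_neq0 a0 !expr0n /=; split=> //; ring.
have [b0|b0] := eqVneq b 0; first by exists 0, 1, 0; rewrite oner_neq0 b0 orbT !expr0n /=; split=> //; ring.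
have [c0|c0] := eqVneq c 0; first by exists 0, 0, 1; rewrite oner_neq0 c0 !orbT !expr0n /=; split=> //; ring.
have ndiv d : d != 0 -> ~~ ('X %| (d%:P : {poly E})).
  by move=> d0; rewrite -['X]subr0 -polyC0 dvdp_XsubCl rootE hornerC.
have [||x [y]] := residue_norm_universal char2 wsrE iX (u := (- (b / a))%:P) (v := (- (c / a))%:P).
- by rewrite ndiv // oppr_eq0 mulf_neq0 // invr_eq0.
- by rewrite ndiv // oppr_eq0 mulf_neq0 // invr_eq0.
rewrite -[X in X %| _]subr0 -polyC0 dvdp_XsubCl rootE.
rewrite !hornerD !hornerN horner_exp hornerM horner_exp !hornerC => /eqP xy.
exists x.[0], y.[0], 1; rewrite oner_neq0 !orbT; split=> //.
have {xy} := xy; move: x.[0] y.[0] => r t xy.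
transitivity (a * (r ^+ 2 - - (b / a) * t ^+ 2 - - (c / a))); last by rewrite xy mulr0.
by field.
Qed.

Lemma coef_cancel_size n (w : {poly E}) : (0 < n)%N -> (size w <= n.+1)%N -> w`_n = 0 ->
  (dg w < n)%N.
Proof.
move=> n0 sw wn; have {}sw : (size w <= n)%N.
  apply/leq_sizeP => j; rewrite leq_eqVlt => /orP[/eqP <- //|nj].
  exact: (leq_sizeP _ _ sw).
by move: sw n0; case: (size w) => [|m] //= ; lia.
Qed.

Section Cancellation.
Variables (n : nat) (n0 : (0 < n)%N).
Hypothesis IH : forall u v e, u != 0 -> v != 0 -> e != 0 -> (dg u < n)%N ->
  pfister_isotropic u v e.

(** If the leading terms of two slots cancel in U + V, the isometry
<<U, V, e>> = <<U + V, - UV, e>> produces a slot of smaller degree. *)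
Lemma pfister_isotropic_cancel2 u v e c1 c2 : u != 0 -> v != 0 -> e != 0 ->
  dg u = n -> dg v = n -> (c1 != 0) || (c2 != 0) ->
  lead_coef u * c1 ^+ 2 + lead_coef v * c2 ^+ 2 = 0 -> pfister_isotropic u v e.
Proof.
move=> u0 v0 e0 du dv nz lcE.
have lu : lead_coef u != 0 by rewrite lead_coef_eq0.
have lv : lead_coef v != 0 by rewrite lead_coef_eq0.
have [c10 c20] : c1 != 0 /\ c2 != 0.
  split; apply: contraTneq nz => cz; move/eqP: lcE; rewrite cz expr0n /= mulr0 ?add0r ?addr0;
  by rewrite mulf_eq0 expf_eq0 /= ?(negPf lu) ?(negPf lv) /= => /eqP ->; rewrite eqxx.
have cP c : c != 0 -> c%:P != 0 :> {poly E} by rewrite polyC_eq0.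
rewrite -(pfister_isotropic_square1 u v e (cP _ c10)) -(pfister_isotropic_square2 _ v e (cP _ c20)).
set U := u * _; set V := v * _.
have U0 : U != 0 by rewrite mulf_neq0 // expf_neq0 // cP.
have V0 : V != 0 by rewrite mulf_neq0 // expf_neq0 // cP.
have [UV|UV] := eqVneq (U + V) 0.
  by apply: (pfister_isotropic_pure (c1 := 1) (c2 := 1) (c3 := 0));
    rewrite ?oner_neq0 // expr1n expr0n /= mulr0 !mulr1 addr0.
apply: pfister_isotropic_add => //; apply: IH => //.
  by rewrite oppr_eq0 mulf_neq0.
apply: coef_cancel_size n0 _ _.
  have sZ (p : {poly E}) c : c != 0 -> size (p * c%:P ^+ 2)%R = size p.
    by move=> c0; rewrite -polyC_exp mulrC mul_polyC size_scale // expf_neq0.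
  rewrite (leq_trans (size_polyD _ _)) // geq_max !sZ // -{1}du -dv.
  by rewrite !leqSpred.
by rewrite coefD /U /V -!polyC_exp !coefMC -[RHS]lcE !lead_coefE du dv.
Qed.

(** Leading coefficients of u, v, e are cancelled by an isotropic vector of the ternary
form that they define over E; if all three coefficients c are nonzero, the change of
slots is applied twice. *)
Lemma pfister_isotropic_cancel u v e : u != 0 -> v != 0 -> e != 0 ->
  dg u = n -> dg v = n -> dg e = n -> pfister_isotropic u v e.
Proof.
move=> u0 v0 e0 du dv de.
have [c1 [c2 [c3 [nz lcE]]]] :=
  ternary_isotropic_const (lead_coef u) (lead_coef v) (lead_coef e).
have z2 (c : E) : c * 0 ^+ 2 = 0 by rewrite expr0n mulr0.
have [c30|c30] := eqVneq c3 0.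
  apply: (pfister_isotropic_cancel2 (c1 := c1) (c2 := c2)) => //.
    by move: nz; rewrite c30 eqxx orbF.
  by move: lcE; rewrite c30 z2 addr0.
have [c20|c20] := eqVneq c2 0.
  apply: pfister_isotropic_swap.
  apply: (pfister_isotropic_cancel2 (c1 := c1) (c2 := c3)) => //.
    by rewrite c30 orbT.
  by move: lcE; rewrite c20 z2 addr0.
have [c10|c10] := eqVneq c1 0.
  apply/pfister_isotropicC/pfister_isotropic_swap.
  apply: (pfister_isotropic_cancel2 (c1 := c2) (c2 := c3)) => //.
    by rewrite c30 orbT.
  by move: lcE; rewrite c10 z2 add0r.
have cP c : c != 0 -> c%:P != 0 :> {poly E} by rewrite polyC_eq0.
rewrite -(pfister_isotropic_square1 u v e (cP _ c10)) -(pfister_isotropic_square2 _ v e (cP _ c20)).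
rewrite -(pfister_isotropic_square _ _ e (cP _ c30)).
have sZ (p : {poly E}) c : c != 0 -> size (p * c%:P ^+ 2)%R = size p.
  by move=> c0; rewrite -polyC_exp mulrC mul_polyC size_scale // expf_neq0.
set U := u * _; set V := v * _; set W := e * _.
have U0 : U != 0 by rewrite mulf_neq0 // expf_neq0 // cP.
have V0 : V != 0 by rewrite mulf_neq0 // expf_neq0 // cP.
have W0 : W != 0 by rewrite mulf_neq0 // expf_neq0 // cP.
have [UVW|UVW] := eqVneq (U + V + W) 0.
  by apply: (pfister_isotropic_pure (c1 := 1) (c2 := 1) (c3 := 1));
    rewrite ?oner_neq0 // expr1n !mulr1.
have [UV|UV] := eqVneq (U + V) 0.
  by apply: (pfister_isotropic_pure (c1 := 1) (c2 := 1) (c3 := 0));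
    rewrite ?oner_neq0 // expr1n expr0n /= mulr0 !mulr1 addr0.
apply: pfister_isotropic_add => //; apply: pfister_isotropic_swap.
apply: pfister_isotropic_add => //; apply: IH; [exact: UVW|by rewrite oppr_eq0 mulf_neq0|by rewrite oppr_eq0 mulf_neq0|].
apply: coef_cancel_size n0 _ _.
  have sn p c : c != 0 -> dg p = n -> (size (p * c%:P ^+ 2)%R <= n.+1)%N.
    by move=> c0 <-; rewrite sZ // leqSpred.
  rewrite (leq_trans (size_polyD _ _)) // geq_max (leq_trans (size_polyD _ _)) ?geq_max;
    by rewrite ?sn.
rewrite !coefD /U /V /W -!polyC_exp !coefMC -[RHS]lcE !lead_coefE du dv de; ring.
Qed.
End Cancellation.

(** The largest slot can be descended until all slots have degree at most deg u. If
one of them is then smaller, the induction on the smallest degree applies;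
otherwise leading terms cancel. For constants, ternary isotropy over E suffices. *)
Lemma pfister_isotropic_degree n u v e : u != 0 -> v != 0 -> e != 0 -> (dg u <= n)%N ->
  pfister_isotropic u v e.
Proof.
elim: n u v e => [|n IHn] u v e u0 v0 e0 du.
  have [m dm] := ubnP (dg v + dg e); elim: m v e v0 e0 dm => // m IHm v e v0 e0 dm.
  wlog ve : v e v0 e0 dm / (dg v <= dg e)%N => [wl|].
    case/orP: (leq_total (dg v) (dg e)) => ve; first exact: wl.
    by apply: pfister_isotropic_swap; apply: wl; rewrite // addnC.
  have [de|de] := posnP (dg e); last first.
    case: (pfister_descent u0 v0 e0) => // -[f [f0 fd fH]]; apply: fH.
    by apply: IHm => //; lia.
  have cst (p : {poly E}) : dg p = 0%N -> p = (p`_0)%:P.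
    by move=> dp; apply: size1_polyC; rewrite (leq_trans (leqSpred _)) // dp.
  have [c1 [c2 [c3 [nz lcE]]]] := ternary_isotropic_const u`_0 v`_0 e`_0.
  apply: (pfister_isotropic_pure (c1 := c1%:P) (c2 := c2%:P) (c3 := c3%:P)).
    by rewrite !polyC_eq0; move: nz; rewrite -?orbA.
  have du0 : dg u = 0%N by apply/eqP; rewrite -leqn0.
  have dv0 : dg v = 0%N by apply/eqP; rewrite -leqn0 -de.
  rewrite {1}(cst _ du0) {1}(cst _ dv0) {1}(cst _ de).
  by rewrite -!polyC_exp -!polyCM -!polyCD lcE.
have [m dm] := ubnP (dg v + dg e); elim: m v e v0 e0 dm => // m IHm v e v0 e0 dm.
wlog ve : v e v0 e0 dm / (dg v <= dg e)%N => [wl|].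
  case/orP: (leq_total (dg v) (dg e)) => ve; first exact: wl.
  by apply: pfister_isotropic_swap; apply: wl; rewrite // addnC.
have [de|de] := leqP (dg e) n.+1; last first.
  case: (pfister_descent u0 v0 e0) => // -[f [f0 fd fH]]; apply: fH.
  by apply: IHm => //; lia.
have [dun|dun] := leqP (dg u) n; first exact: IHn.
have [dvn|dvn] := leqP (dg v) n; first by apply/pfister_isotropicC/IHn.
have [den|den] := leqP (dg e) n.
  by apply/pfister_isotropic_swap/pfister_isotropicC/IHn.
apply: (@pfister_isotropic_cancel n.+1) => //.
- by apply/eqP; rewrite eqn_leq du.
- by apply/eqP; rewrite eqn_leq dvn (leq_trans ve).
- by apply/eqP; rewrite eqn_leq den de.
Qed.

Lemma pfister_isotropic_poly u v e : u != 0 -> v != 0 -> e != 0 -> pfister_isotropic u v e.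
Proof. by move=> u0 v0 e0; apply: (@pfister_isotropic_degree (dg u)). Qed.

Lemma tofrac_inj : injective (@FracField.tofrac {poly E}).
Proof. by move=> a b ab; apply/eqP; rewrite -tofrac_eq ab. Qed.

Lemma frac_numden (a : {fraction {poly E}}) : exists n d, d != 0 /\ a = tofrac n / tofrac d.
Proof.
elim/quotW: a => -[[n d] /= d0]; exists n, d; split=> //.
rewrite -[RHS]/(FracField.mul _ (FracField.inv _)); unlock FracField.tofrac.
rewrite !piE; apply/eqmodP; rewrite /= FracField.equivfE /FracField.mulf /FracField.invf.
rewrite ![(frac (Ratio _ 1)).1]numer_Ratio ?oner_eq0 // ![(frac (Ratio _ 1)).2]denom_Ratio ?oner_eq0 //.
rewrite [(frac (Ratio 1 d)).1]numer_Ratio // [(frac (Ratio 1 d)).2]denom_Ratio // mulr1 mul1r.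
by rewrite numer_Ratio // denom_Ratio //= mulrC.
Qed.

Lemma frac_square_class (a : {fraction {poly E}}) : a != 0 ->
  exists p s, [/\ p != 0, s != 0 & a = tofrac p * s ^+ 2].
Proof.
have [n [d [_ ->]]] := frac_numden a; rewrite mulf_eq0 invr_eq0 !tofrac_eq0 negb_or => /andP[n0 d0].
exists (n * d), (tofrac d)^-1; rewrite mulf_neq0 // invr_eq0 tofrac_eq0; split => //.
by rewrite tofracM expr2 mulrA mulfK ?tofrac_eq0.
Qed.

Lemma pfister_isotropic_frac (u v e : {fraction {poly E}}) : u != 0 -> v != 0 -> e != 0 ->
  pfister_isotropic u v e.
Proof.
move=> /frac_square_class[p [r [p0 r0 ->]]] /frac_square_class[q [s [q0 s0 ->]]].
move=> /frac_square_class[f [t [f0 t0 ->]]].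
apply: (proj2 (pfister_isotropic_square _ _ _ t0)).
apply: (proj2 (pfister_isotropic_square1 _ _ _ r0)).
apply: (proj2 (pfister_isotropic_square2 _ _ _ s0)).
exact: (pfister_isotropic_map tofrac_inj (pfister_isotropic_poly p0 q0 f0)).
Qed.
End PfisterInduction.

(** * Euler's criterion modulo a prime polynomial *)

Lemma polynorm_map (E K : fieldType) (f : {rmorphism E -> K}) (h s : {poly E}) : h != 0 ->
  f (polynorm h s) = polynorm (map_poly f h) (map_poly f s).
Proof.
move=> h0; rewrite !polynormE ?map_poly_eq0 // -det_map_mx /redmx size_map_poly.
congr (\det _); apply/matrixP => i j; rewrite !mxE.
by rewrite -(map_polyXn f) -rmorphM -map_modp coef_map.
Qed.

Lemma polynorm_XsubC (E : fieldType) (c : E) s : polynorm ('X - c%:P) s = s.[c].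
Proof.
have X0 : 'X - c%:P != 0 :> {poly E} by rewrite polyXsubC_eq0.
rewrite (@polynorm_mod _ _ s s.[c]%:P) // ?polynormC ?size_XsubC //.
apply/eqP; rewrite -subr_eq0 -modpN -modpD; apply/eqP/modp_eq0P.
by rewrite dvdp_XsubCl rootE !hornerE subrr.
Qed.

Lemma polynorm_modulus1 (E : fieldType) (s : {poly E}) : polynorm 1 s = 1.
Proof.
rewrite polynormE ?oner_neq0 //.
by move: (redmx 1 s); rewrite size_poly1 => M; rewrite det_mx00.
Qed.

(** The norm modulo X - c is the value at c, and norms are multiplicative in the modulus. *)
Lemma polynorm_prod_XsubC (E : fieldType) (rs : seq E) s : s != 0 ->
  polynorm (\prod_(c <- rs) ('X - c%:P)) s = \prod_(c <- rs) s.[c].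
Proof.
move=> s0; elim: rs => [|c rs IH]; last first.
  by rewrite !big_cons polynorm_modulusM ?polyXsubC_eq0 ?polynorm_XsubC ?IH // monic_neq0 ?monic_prod_XsubC.
by rewrite !big_nil polynorm_modulus1.
Qed.

Lemma finField_odd_card (K : finFieldType) : odd #|K| -> exists2 m, (0 < m)%N & #|K| = (m * 2).+1.
Proof.
have := finNzRing_gt1 K; case: #|K| => [|[|n]] //= _; rewrite negbK => oK.
by exists (n.+1)./2; lia.
Qed.

(** The group of units is cyclic of even order. *)
Lemma finField_square (K : finFieldType) (x : K) : odd #|K| -> x ^+ (#|K|.-1)./2 = 1 ->
  exists y, x = y ^+ 2.
Proof.
move=> /finField_odd_card[m m0 mE]; rewrite mE /= muln2 doubleK => xE.
have x0 : x != 0.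
  by apply: contra_eq_neq xE => ->; rewrite expr0n gtn_eqF // eq_sym oner_neq0.
have [g gE] : exists g : {unit K}, [set: {unit K}]%G = <[g]>%G.
  have /cyclicP[g gE] := field_unit_group_cyclic [set: {unit K}]%G.
  by exists g; apply/val_inj.
have ux : x \is a GRing.unit by rewrite unitfE.
pose X := FinRing.unit K ux.
have : X \in <[g]>%g by rewrite -[<[g]>%g]/(gval <[g]>%G) -gE inE.
case/cycleP => k Xk.
have og : #[g]%g = (m * 2)%N.
  by rewrite orderE -[<[g]>%g]/(gval <[g]>%G) -gE finfield.card_finField_unit mE.
have : (X ^+ m)%g = 1%g by apply/val_inj; rewrite FinRing.val_unitX.
rewrite Xk -expgM => /eqP; rewrite -order_dvdn og mulnC dvdn_pmul2r // => /dvdnP[l kE].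
exists (val (g ^+ l)%g); rewrite -FinRing.val_unitX -expgM -kE -Xk //.
Qed.

Lemma card_pchar (E : finFieldType) : [pchar E].-nat #|E|.
Proof.
have [l pl charE] := finPcharP E.
have := abelem_pgroup (fin_ring_pchar_abelem charE); rewrite /pgroup cardsT => lq.
by apply: sub_in_pnat lq => n _; rewrite inE => /eqP ->.
Qed.

Section ResidueNorm.
Variables (E K : finFieldType) (phi : {rmorphism {poly E} -> K}) (p : {poly E}).
Hypothesis surj : forall b, exists a, phi a = b.
Hypothesis kerE : forall a, (phi a == 0) = (p %| a).
Hypothesis mp : p \is monic.
Hypothesis cardK : #|K| = (#|E| ^ dg p)%N.

Let psi : {rmorphism E -> K} := phi \o polyC.
Let theta := phi 'X.
Let q := #|E|.

Lemma residue_horner a : phi a = (map_poly psi a).[theta].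
Proof.
rewrite -{1}(coefK a) poly_def rmorph_sum /= horner_coef size_map_poly.
apply: eq_bigr => i _; rewrite coef_map /= -rmorphXn -rmorphM /=.
by rewrite mul_polyC.
Qed.

Lemma q_pchar : [pchar K].-nat q.
Proof.
by rewrite (eq_pnat _ (fmorph_pchar psi)) card_pchar.
Qed.

Lemma frobenius_horner a i : (map_poly psi a).[theta ^+ (q ^ i)] = phi a ^+ (q ^ i).
Proof.
elim: i => [|i IH]; first by rewrite !expn0 !expr1 residue_horner.
rewrite expnSr !exprM -{}IH; move: (theta ^+ _) => t.
have qD (x y : K) : (x + y) ^+ q = x ^+ q + y ^+ q by rewrite exprDn_pchar // q_pchar.
have q0 : (0 < q)%N by apply: ltnW (finNzRing_gt1 E).
have q0E : 0 ^+ q = 0 :> K by rewrite expr0n gtn_eqF.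
rewrite !horner_coef [RHS](big_morph (fun x : K => x ^+ q) qD q0E).
apply: eq_bigr => j _; rewrite coef_map exprMn -!exprM [(j * q)%N]mulnC; congr (_ * _).
by rewrite -rmorphXn expf_card.
Qed.

Lemma frobenius_uniq : uniq [seq theta ^+ (q ^ i) | i <- iota 0 (dg p)].
Proof.
have q1 : (1 < q)%N by apply: finNzRing_gt1.
rewrite map_inj_in_uniq ?iota_uniq // => i j; rewrite !mem_iota /= !add0n.
wlog ij : i j / (i <= j)%N => [wl|].
  by case/orP: (leq_total i j) => ij hi hj e; [apply: wl|symmetry; apply: wl].
move=> _ jd; rewrite -(subnKC ij) => fE; apply/eqP; rewrite eqn_leq leq_addr /=.
rewrite leqNgt -{1}[i]addn0 ltn_add2l; apply/negP => k0; move: fE.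
set k := (j - i)%N in k0 *.
have kd : (k < dg p)%N by rewrite (leq_ltn_trans (leq_subr _ _)).
rewrite expnD mulnC exprM => fE.
have injF (x y : K) : x ^+ (q ^ i) = y ^+ (q ^ i) -> x = y.
  have iq : [pchar K].-nat (q ^ i)%N by rewrite pnatX q_pchar.
  move=> /eqP; rewrite -subr_eq0 -(exprNn_pchar _ iq) -exprDn_pchar //.
  by rewrite expf_eq0 subr_eq0 => /andP[_ /eqP].
have {injF}fE : theta ^+ (q ^ k) = theta by symmetry; apply: injF.
have all_fixed (x : K) : x ^+ (q ^ k) = x.
  by have [a <-] := surj x; rewrite -frobenius_horner fE residue_horner.
have k1 : (1 < q ^ k)%N by rewrite -(exp1n k) ltn_exp2r.
pose P : {poly K} := 'X^(q ^ k) - 'X.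
have sP : size P = (q ^ k).+1 by rewrite size_polyDl size_polyXn // size_polyN size_polyX.
have P0 : P != 0 by rewrite -size_poly_eq0 sP.
have aP : all (root P) (enum K) by apply/allP => x _; rewrite rootE !hornerE all_fixed subrr.
have := max_poly_roots P0 aP (enum_uniq K).
by rewrite sP -cardE cardK -/q ltnS leq_exp2l // leqNgt kd.
Qed.

(** The conjugates of theta are its iterated Frobenius images, and they are distinct
because theta generates the residue field. *)
Lemma map_residue_poly : map_poly psi p =
  \prod_(c <- [seq theta ^+ (q ^ i) | i <- iota 0 (dg p)]) ('X - c%:P).
Proof.
rewrite [LHS](all_roots_prod_XsubC (rs := [seq theta ^+ (q ^ i) | i <- iota 0 (dg p)])).
- by rewrite lead_coef_map (monicP mp) rmorph1 scale1r.
- by rewrite size_map_poly size_map size_iota prednK // size_poly_gt0 monic_neq0.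
- apply/allP => c /mapP[i _ ->]; rewrite rootE frobenius_horner.
  have /eqP -> : phi p == 0 by rewrite kerE.
  by rewrite expr0n gtn_eqF // expn_gt0 (ltnW (finNzRing_gt1 E)).
- by rewrite uniq_rootsE frobenius_uniq.
Qed.

Lemma residue_norm a : a != 0 ->
  psi (polynorm p a) = phi a ^+ (\sum_(i < dg p) q ^ i).
Proof.
move=> a0; rewrite polynorm_map ?monic_neq0 // map_residue_poly polynorm_prod_XsubC ?map_poly_eq0 //.
rewrite big_map -[dg p]subn0 -/(index_iota 0 (dg p)) big_mkord.
rewrite subn0; under eq_bigr do rewrite frobenius_horner.
by rewrite -expr_sum.
Qed.

(** The exponent of the norm, 1 + q + ... + q^(d-1), times (q - 1) / 2 is
(q^d - 1) / 2, Euler's exponent in the residue field. *)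
Lemma euler_residue a : odd q -> a != 0 -> polynorm p a ^+ (q.-1)./2 = 1 ->
  exists m, p %| a - m ^+ 2.
Proof.
move=> oq a0 nE; have oK : odd #|K| by rewrite cardK oddX oq orbT.
have [m m0 qE] := finField_odd_card oq.
have [y yE] : exists y, phi a = y ^+ 2.
  apply: (finField_square oK); rewrite cardK -/q predn_exp.
  have -> : (q.-1 * \sum_(i < dg p) q ^ i)./2 = (\sum_(i < dg p) q ^ i * (q.-1)./2)%N.
    by rewrite -big_distrl; move: (bigop _ _ _) => S /=; rewrite /q qE /= muln2 doubleK mulnC -doubleMr doubleK.
  by rewrite -big_distrl /= exprM -residue_norm // -rmorphXn nE rmorph1.
have [b bE] := surj y; exists b.
by rewrite -kerE rmorphB rmorphXn bE yE subrr.
Qed.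
End ResidueNorm.

(** * Divisor sums of a quadratic character *)

Section PolySums.
Import Order.TTheory Num.Theory.
Variable E : finFieldType.
Implicit Types (a b g p : {poly E}) (P Q : pred {poly E}).

(** Finite sets of polynomials are lists here, so that sums can be reindexed by functions
between polynomials of different sizes. *)
Definition polys n : seq {poly E} := [seq val x | x : {poly_n E}].

Lemma mem_polys n a : (a \in polys n) = (size a <= n)%N.
Proof.
apply/idP/idP => [/mapP[x _ ->]|sa]; first exact: size_npoly.
by apply/mapP; exists (npolyp n a); rewrite ?mem_enum // /= npolypK.
Qed.

Lemma polys_uniq n : uniq (polys n).
Proof. by rewrite map_inj_uniq ?enum_uniq //; apply: val_inj. Qed.

Lemma reindex_polys m n P Q (f f' : {poly E} -> {poly E}) (F : {poly E} -> int) :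
  (forall b, (size b <= n)%N -> Q b -> [/\ (size (f b) <= m)%N, P (f b) & f' (f b) = b]) ->
  (forall a, (size a <= m)%N -> P a -> [/\ (size (f' a) <= n)%N, Q (f' a) & f (f' a) = a]) ->
  \sum_(a <- polys m | P a) F a = \sum_(b <- polys n | Q b) F (f b).
Proof.
move=> fP f'P; rewrite -[LHS]big_filter -[RHS]big_filter -[RHS](big_map f xpredT F).
apply: perm_big; apply: uniq_perm.
- by rewrite filter_uniq ?polys_uniq.
- rewrite map_inj_in_uniq ?filter_uniq ?polys_uniq // => x y.
  rewrite !mem_filter !mem_polys => /andP[Qx sx] /andP[Qy sy] fE.
  by have [_ _ <-] := fP x sx Qx; have [_ _ <-] := fP y sy Qy; rewrite fE.
move=> a; rewrite mem_filter mem_polys; apply/andP/mapP => [[Pa sa]|[b]].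
  have [s1 Q1 fE] := f'P a sa Pa.
  by exists (f' a); rewrite ?fE // mem_filter Q1 mem_polys.
by rewrite mem_filter mem_polys => /andP[Qb sb] ->; have [] := fP b sb Qb.
Qed.

Lemma widen_polys m n P F : (forall a, P a -> (size a <= m)%N) -> (m <= n)%N ->
  \sum_(a <- polys n | P a) F a = \sum_(a <- polys m | P a) F a :> int.
Proof.
move=> Pm mn; apply: (@reindex_polys _ _ _ _ id id) => a sa Pa; split => //.
  exact: leq_trans mn.
exact: Pm.
Qed.

Variables (h : {poly E}) (chi : {poly E} -> int).
Hypothesis chiM : forall a b, a \is monic -> b \is monic -> chi (a * b) = chi a * chi b.
Hypothesis chi1 : chi 1 = 1.
Hypothesis chi3 : forall a, [|| chi a == 0, chi a == 1 | chi a == -1].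
Hypothesis chi_square : forall p, p \is monic -> irreducible_poly p -> chi p != -1 ->
  exists m, p %| h - m ^+ 2.
Hypothesis chi_coprime : forall a, a \is monic -> chi a != 0 -> coprimep a h.

(** For chi the Jacobi symbol of h, the coefficients of the series zeta(s) L(s, chi), which
count ideals in the quadratic extension by the square root of h. *)
Definition dsum g := \sum_(a <- polys (size g) | (a \is monic) && (a %| g)) chi a.

Lemma dsumE n g : g != 0 -> (size g <= n)%N ->
  dsum g = \sum_(a <- polys n | (a \is monic) && (a %| g)) chi a.
Proof. by move=> g0 gn; symmetry; apply: widen_polys => // a /andP[_ /dvdp_leq ->]. Qed.

Lemma dsum1 : dsum 1 = 1.
Proof.
rewrite /dsum size_poly1 (@reindex_polys 1 0 _ [pred b | b == 0] (fun=> 1) (fun=> 0)).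
- rewrite (big_rem 0) ?mem_polys ?size_poly0 //= eqxx chi1 big1_seq ?addr0 // => a /andP[/eqP ->].
  by rewrite mem_rem_uniqF ?polys_uniq.
- by move=> b _ /eqP ->; rewrite size_poly1 monic1 dvdpp.
- move=> a _ /andP[ma]; rewrite dvdp1 => /size_poly1P[c _ aE].
  split; rewrite ?size_poly0 ?inE //.
  by move: ma; rewrite aE monicE lead_coefC => /eqP ->.
Qed.

(** Divisors of p^(v+1) m are those prime to p, which divide m, and p times the divisors of p^v m. *)
Lemma dsum_rec p m v : p \is monic -> irreducible_poly p -> m != 0 -> ~~ (p %| m) ->
  dsum (p ^+ v.+1 * m) = dsum m + chi p * dsum (p ^+ v * m).
Proof.
move=> mp ip m0 pm; have p0 := monic_neq0 mp.
have pv0 k : p ^+ k * m != 0 by rewrite mulf_neq0 ?expf_neq0.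
rewrite /dsum (bigID (fun a => p %| a)) /= addrC; congr (_ + _).
  rewrite (@widen_polys (size m)).
  - apply: eq_bigl => a; case ma: (a \is monic) => //=.
    apply/andP/idP => [[apm pa]|am].
      rewrite -(Gauss_dvdpr m (q := p ^+ v.+1)) // coprimep_expr //.
      by rewrite coprimep_sym irreducible_poly_coprime.
    by rewrite dvdp_mull //; split=> //; apply: contra pm => /dvdp_trans; apply.
  - move=> a /andP[/andP[ma apm] pa]; apply: dvdp_leq => //.
    rewrite -(Gauss_dvdpr m (q := p ^+ v.+1)) // coprimep_expr //.
    by rewrite coprimep_sym irreducible_poly_coprime.
  - by rewrite dvdp_leq // dvdp_mull.
rewrite mulr_sumr (@reindex_polys _ (size (p ^+ v * m)) _ 
  [pred b | (b \is monic) && (b %| p ^+ v * m)] (fun b => p * b) (fun a => a %/ p)).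
- by apply: eq_bigr => b /andP[mb _]; rewrite chiM.
- move=> b _ /andP[mb bv]; rewrite mulKp // monicMl // mb /= exprS -mulrA dvdp_mul2l // bv dvdp_mulIl.
  by split => //; rewrite dvdp_leq ?dvdp_mul2l // -?exprS mulrA -exprS.
- move=> a sa /andP[/andP[ma apm] pa].
  have aE : p * (a %/ p) = a by rewrite mulrC divpK.
  have dv : a %/ p %| p ^+ v * m by rewrite -(dvdp_mul2l _ _ p0) aE mulrA -exprS.
  by rewrite dvdp_leq //= dv andbT -(monicMl _ mp) aE.
Qed.

Definition geometric (x : int) v : int := \sum_(i < v.+1) x ^+ i.

Lemma geometricS x v : geometric x v.+1 = 1 + x * geometric x v.
Proof.
by rewrite /geometric big_ord_recl expr0 mulr_sumr; congr (_ + _); apply: eq_bigr => i _; rewrite -exprS.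
Qed.

Lemma geometric0 x : geometric x 0 = 1.
Proof. by rewrite /geometric big_ord1. Qed.

Lemma geometric_chi a v : (0 <= geometric (chi a) v) *
  ((geometric (chi a) v == 0) = (chi a == -1) && odd v).
Proof.
have [/eqP ->|/eqP ->|/eqP ->] := or3P (chi3 a).
- by split; case: v => [|v]; rewrite ?geometricS ?geometric0 ?mul0r.
- suff -> : geometric 1 v = v.+1%:R by split; rewrite ?ler0n // pnatr_eq0.
  by elim: v => [|v IH]; rewrite ?geometricS ?geometric0 // IH mul1r -[in RHS]natr1 addrC.
- suff -> : geometric (-1) v = (~~ odd v)%:R by split; case: (odd v).
  by elim: v => [|v IH]; rewrite ?geometricS ?geometric0 // IH /=; case: (odd v).
Qed.

Lemma dsum_pow p m v : p \is monic -> irreducible_poly p -> m != 0 -> ~~ (p %| m) ->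
  dsum (p ^+ v * m) = geometric (chi p) v * dsum m.
Proof.
move=> mp ip m0 pm; elim: v => [|v IH]; first by rewrite geometric0 expr0 !mul1r.
by rewrite dsum_rec // IH geometricS mulrDl mul1r mulrA.
Qed.

(** The sum is a product over the primes p of g, where p^v contributes v + 1, 1 or the
parity of v + 1 for chi(p) = 1, 0 or -1. If it is nonzero, primes of odd
multiplicity do not have chi(p) = -1. *)
Lemma dsum_square_part g : g \is monic -> 0 <= dsum g /\ (dsum g != 0 ->
  exists f w, [/\ f \is monic, w != 0, g = f * w ^+ 2 & exists m, f %| h - m ^+ 2]).
Proof.
have [n] := ubnP (size g); elim: n g => // n IH g sg mg.
have [sg1|sg1] := leqP (size g) 1.
  have -> : g = 1.
    by move: mg; rewrite (size1_polyC sg1) monicE lead_coefC => /eqP ->.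
  rewrite dsum1; split=> // _; exists 1, 1; rewrite monic1 oner_neq0 expr1n mulr1; split=> //.
  by exists 0; rewrite dvd1p.
have [p0 ip0 p0g] := irreducible_factor sg1.
pose p := (lead_coef p0)^-1 *: p0.
have p00 : p0 != 0 by apply: contraTneq p0g => ->; rewrite dvd0p monic_neq0.
have pp : p %= p0 by rewrite eqp_scale // invr_eq0 lead_coef_eq0.
have mp : p \is monic by apply/monicP; rewrite lead_coefZ mulVf ?lead_coef_eq0.
have pg : p %| g by rewrite (eqp_dvdl _ pp).
have ip : irreducible_poly p.
  case: ip0 => s0 H; split; first by rewrite (eqp_size pp).
  by move=> d sd dp; rewrite (eqp_rtrans pp); apply: H; rewrite // -(eqp_dvdr _ pp).
have [v [m [pm gE]]] : exists v m, ~~ (p %| m) /\ g = p ^+ v * m.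
  have g0 := monic_neq0 mg; have pn0 := monic_neq0 mp; clear -g0 ip pn0.
  have [n] := ubnP (size g); elim: n g g0 => // n IH g g0 sg.
  have [pg|pg] := boolP (p %| g); last by exists 0%N, g; rewrite expr0 mul1r.
  have gE : g = p * (g %/ p) by rewrite mulrC divpK.
  move: g0 sg; rewrite {1 2}gE mulf_eq0 negb_or => /andP[_ q0]; rewrite size_mul // => sg.
  have [|v [m [pm qE]]] := IH _ q0.
    by case: ip => sp _; move: sp sg; move: (size p) (size (g %/ p)) => [|[|k]] l //=; lia.
  by exists v.+1, m; rewrite exprS -mulrA -qE.
have v0 : (0 < v)%N by case: v gE => // gE; move: pm; rewrite -[m]mul1r -(expr0 p) -gE pg.
have mm : m \is monic by rewrite -(monicMl _ (monic_exp v mp)) -gE.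
have m0 := monic_neq0 mm; have pn0 := monic_neq0 mp.
have sm : (size m < n)%N.
  have pv : p ^+ v != 0 by rewrite expf_neq0.
  apply: leq_trans (sg : (size g <= n)%N); rewrite gE size_mul //.
  suff : (1 < size (p ^+ v))%N.
    by clear; move: (size _) (size m) => [|[|k]] l //= _; rewrite ltnS leq_addl.
  have [sp _] := ip; apply: leq_trans sp _; rewrite dvdp_leq //.
  by case: v v0 {gE pv} => // k _; rewrite exprS dvdp_mulIl.
have [m_ge m_good] := IH m sm mm; rewrite gE dsum_pow // mulr_ge0 ?geometric_chi //; split=> //.
rewrite mulf_eq0 negb_or geometric_chi negb_and => /andP[cp /m_good[f [w [mf w0 mE [k fk]]]]].
have := odd_double_half v; move: (v./2) => j; move: cp; case: (odd v) => /= cp vE; last first.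
  exists f, (p ^+ j * w); rewrite mulf_neq0 ?expf_neq0 //; split => //; last by exists k.
  by rewrite -vE mE add0n -muln2 exprM exprMn mulrCA.
have [k' pk'] : exists m, p %| h - m ^+ 2 by apply: chi_square; rewrite // orbF in cp *.
have cpf : coprimep p f.
  by rewrite irreducible_poly_coprime //; apply: contra pm; rewrite mE; apply: dvdp_mulr.
exists (p * f), (p ^+ j * w); rewrite mulf_neq0 ?expf_neq0 ?monicMr //; split => //.
  by rewrite -vE mE add1n exprS -muln2 exprM exprMn mulrACA mulrA.
have [c [c1 c2]] := chinese_poly k' k cpf.
have cong q x y : q %| x - y -> q %| h - y ^+ 2 -> q %| h - x ^+ 2.
  move=> xy hy; have -> : h - x ^+ 2 = (h - y ^+ 2) - (x - y) * (x + y) by ring.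
  by rewrite dvdp_sub // dvdp_mulr.
by exists c; rewrite Gauss_dvdp // (cong p _ k') // (cong f _ k).
Qed.

Local Notation D := (dg h).

(** Pair a with g / a: their symbols agree because chi(g) = 1, and one of them has degree
less than D. *)
Lemma dsum_pairing g : g \is monic -> size g = D.*2 -> chi g = 1 ->
  dsum g = (\sum_(a <- polys D | (a \is monic) && (a %| g)) chi a) *+ 2.
Proof.
move=> mg sg cg; have g0 := monic_neq0 mg.
have D0 : (0 < D)%N by move: g0; rewrite -size_poly_gt0 sg double_gt0.
have qP a : a \is monic -> a %| g -> [/\ g %/ a \is monic, g %/ a %| g,
    g %/ (g %/ a) = a & (size a + size (g %/ a)%R = (D.*2).+1)%N].
  move=> ma ag; have a0 := monic_neq0 ma.
  have gE : g = a * (g %/ a) by rewrite mulrC divpK.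
  have mb : g %/ a \is monic by rewrite -(monicMl _ ma) -gE.
  have b0 := monic_neq0 mb; split=> //.
  - by rewrite [X in _ %| X]gE dvdp_mulIr.
  - by rewrite {1}gE mulpK.
  - have := sg; rewrite gE size_mul // mulrC mulpK //; move: b0 a0; rewrite -!size_poly_gt0.
    by clear -D0; move: (size a) (size (g %/ a)) => [|k] l //=; lia.
rewrite /dsum sg (bigID (fun a : {poly E} => (size a <= D)%N)) /= mulr2n; congr (_ + _).
  rewrite (@widen_polys D); first by rewrite big_seq_cond [RHS]big_seq_cond; apply: eq_bigl => a;
    rewrite mem_polys; case: (leqP (size a)) => //=; rewrite ?andbT ?andbF.
    by move=> a /andP[_].
  by rewrite -addnn leq_addr.
rewrite (@reindex_polys _ D _ [pred a : {poly E} | (a \is monic) && (a %| g)]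
  (fun a => g %/ a) (fun a => g %/ a)).
- apply: eq_bigr => a /andP[ma ag]; have [mb _ _ _] := qP a ma ag.
  have := cg; rewrite -{1}(divpK ag) chiM //.
  by have [/eqP ->|/eqP ->|/eqP ->] := or3P (chi3 (g %/ a));
     have [/eqP ->|/eqP ->|/eqP ->] := or3P (chi3 a).
- move=> b sb /andP[mb bg]; have [mc cgd cE sz] := qP b mb bg; rewrite mc cgd cE; split => //.
    by rewrite -sg dvdp_leq.
  by move: sb sz; clear -D0; move: (size b) (size (g %/ b)) => k l /=; lia.
- move=> a sa /andP[/andP[ma ag] ba]; have [mc cgd cE sz] := qP a ma ag.
  rewrite /= mc cgd cE; split => //.
  by move: ba sz; clear -D0; move: (size a) (size (g %/ a)) => k l /=; lia.
Qed.

(** By the Chinese remainder theorem some g0 of degree less than 2D - 1 is congruent to s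
modulo h and divisible by a; adding g0 and multiplying by the monic multiple of h
is the bijection. *)
Lemma class_bijection s a : coprimep a h -> h != 0 -> a != 0 -> (size a <= D)%N ->
  \sum_(g <- polys D.*2 | [&& g \is monic, size g == D.*2, h %| g - s & a %| g]) (1 : int) =
  \sum_(g <- polys D | [&& g \is monic, size g == D & a %| g]) (1 : int).
Proof.
move=> cah h0 a0 sa.
pose l := lead_coef h; have l0 : l != 0 by rewrite lead_coef_eq0.
pose h1 := l^-1 *: h; have h10 : h1 != 0 by rewrite scaler_eq0 negb_or invr_eq0 l0.
have mh : h1 \is monic by apply/monicP; rewrite lead_coefZ mulVf.
have sh : size h1 = size h by rewrite size_scale // invr_eq0.
have hh p : (h1 %| p) = (h %| p) by rewrite dvdpZl // invr_eq0.
have [c [ac hc]] := chinese_poly 0 s cah; rewrite subr0 in ac.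
pose g0 := c %% (a * h).
have ag0 : a %| g0 by rewrite -(dvdp_mod _ (dvdp_mulIl a h)).
have hg0 : h %| g0 - s.
  have -> : g0 - s = (c - s) - (c %/ (a * h) * a) * h.
    by rewrite /g0 {2}(divp_eq c (a * h)); ring.
  by rewrite dvdp_sub // dvdp_mulIr.
have shD : size h = D.+1 by rewrite prednK ?size_poly_gt0.
have sg0 : (size g0 < D.*2)%N.
  apply: leq_trans (_ : (size (a * h)%R <= _)%N); first by rewrite ltn_modp mulf_neq0.
  by rewrite size_mul // shD addnS /= -addnn leq_add2r.
have sHg g : g \is monic -> size g = D -> size (h1 * g + g0) = D.*2 /\ h1 * g + g0 \is monic.
  move=> mg sg; have shg : size (h1 * g) = D.*2.
    by rewrite size_mul ?monic_neq0 // sh shD sg addSn addnn.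
  by rewrite size_polyDl ?shg // monicE lead_coefDl ?shg // -monicE monicMl.
apply: (@reindex_polys _ _ _ _ (fun g => h1 * g + g0) (fun g => (g - g0) %/ h1)) => g _ /=.
  case/and3P=> mg /eqP sg ag; have [s1 m1] := sHg g mg sg.
  rewrite s1 m1 eqxx leqnn addrK mulKp //; split => //=.
  have -> : h %| h1 * g + g0 - s by rewrite -addrA dvdp_add // dvdp_mulr // -hh.
  by rewrite dvdp_add // dvdp_mull.
case/and4P=> mg /eqP sg hg ag.
have hq : h1 * ((g - g0) %/ h1) = g - g0.
  rewrite mulrC divpK // hh (_ : g - g0 = (g - s) - (g0 - s)); last by ring.
  by rewrite dvdp_sub.
rewrite hq subrK; move: (_ %/ _) hq => g' hq.
have s1 : size (g - g0) = D.*2 by rewrite size_polyDl ?size_polyN ?sg.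
have m1 : g - g0 \is monic by rewrite monicE lead_coefDl ?size_polyN ?sg // -monicE.
have m2 : g' \is monic by rewrite -(monicMl _ mh) hq.
have s2 : size g' = D.
  move: s1; rewrite -hq size_mul ?monic_neq0 // sh shD; clear; move: (size g') D => k m.
  by rewrite addSn /= -addnn => /addnI.
rewrite s2 m2 eqxx leqnn; split => //=.
have cah1 : coprimep a h1 by rewrite coprimepZr // invr_eq0.
by rewrite -(Gauss_dvdpr _ cah1) hq dvdp_sub.
Qed.

(** Both sides count, for each a of degree less than D, its multiples in the range of g. *)
Lemma class_dsum s : h != 0 ->
  (forall g, g \is monic -> size g = D.*2 -> h %| g - s -> chi g = 1) ->
  \sum_(g <- polys D.*2 | [&& g \is monic, size g == D.*2 & h %| g - s]) dsum g =
  (\sum_(g <- polys D | (g \is monic) && (size g == D)) dsum g) *+ 2.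
Proof.
move=> h0 cg1.
have inner n (P : pred {poly E}) : \sum_(g <- polys n | P g)
    (\sum_(a <- polys D | (a \is monic) && (a %| g)) chi a) =
  \sum_(a <- polys D | a \is monic) chi a * \sum_(g <- polys n | P g && (a %| g)) 1.
  rewrite (eq_bigr (fun g => \sum_(a <- polys D | a \is monic) if a %| g then chi a else 0)).
    rewrite exchange_big; apply: eq_bigr => a _; rewrite -big_mkcondr /= mulr_sumr.
    by apply: eq_bigr => g _; rewrite mulr1.
  by move=> g _; rewrite -big_mkcondr.
rewrite (eq_bigr (fun g => (\sum_(a <- polys D | (a \is monic) && (a %| g)) chi a) *+ 2)); last first.
  by move=> g /and3P[mg /eqP sg hg]; rewrite dsum_pairing // cg1.
rewrite sumrMnl; congr (_ *+ 2).
rewrite [RHS](eq_bigr (fun g => \sum_(a <- polys D | (a \is monic) && (a %| g)) chi a)); last first.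
  by move=> g /andP[mg /eqP sg]; apply: dsumE; rewrite ?monic_neq0 ?sg.
rewrite !inner big_seq_cond [RHS]big_seq_cond; apply: eq_bigr => a /andP[].
rewrite mem_polys => sa ma; have [->|ca] := eqVneq (chi a) 0; first by rewrite !mul0r.
congr (_ * _); have := class_bijection s (chi_coprime ma ca) h0 (monic_neq0 ma) sa.
by under eq_bigl do rewrite !andbA; under [RHS]eq_bigl do rewrite andbA; rewrite /= => <-;
  apply: eq_bigl => g; rewrite !andbA.
Qed.

(** The square X^(D-1) contributes at least 1. *)
Lemma dsum_sum_gt0 : odd D ->
  0 < \sum_(g <- polys D | (g \is monic) && (size g == D)) dsum g.
Proof.
move=> oD; have [j DE] : exists j, D = (j.*2).+1.
  by exists D./2; rewrite -[LHS]odd_double_half oD.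
have iX : irreducible_poly ('X : {poly E}).
  by have := @irredp_XsubC E 0; rewrite subr0.
rewrite (big_rem 'X^(j.*2)) ?mem_polys ?size_polyXn ?DE //= monicXn eqxx /=.
rewrite ltr_pwDl //; last first.
  by rewrite sumr_ge0 // => g /andP[mg _]; have [] := dsum_square_part mg.
rewrite -[X in dsum X]mulr1 dsum_pow ?monicX ?oner_neq0 ?dvdp1 ?size_polyX //.
by rewrite dsum1 mulr1 lt_neqAle eq_sym !geometric_chi odd_double andbF.
Qed.

Lemma class_square_part s : h != 0 -> odd D ->
  (forall g, g \is monic -> size g = D.*2 -> h %| g - s -> chi g = 1) ->
  exists f w m, [/\ f \is monic, w != 0, h %| f * w ^+ 2 - s & f %| h - m ^+ 2].
Proof.
move=> h0 oD cg1; have sE := class_dsum h0 cg1.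
have [|no] := classic (exists g, [/\ g \is monic, h %| g - s & dsum g != 0]).
  case=> g [mg hg /(proj2 (dsum_square_part mg))[f [w [mf w0 gE [m fm]]]]].
  by exists f, w, m; rewrite -gE.
have := dsum_sum_gt0 oD; rewrite -(pmulrn_lgt0 _ (isT : (0 < 2)%N)) -sE big1 ?ltxx // => g /and3P[mg _ hg].
by apply/eqP/negPn/negP => ng; apply: no; exists g.
Qed.
End PolySums.

(** * Symbols over a finite field *)

Section FiniteSolvable.
Variable E : finFieldType.
Hypothesis char2 : (2%:R : E) != 0.
Implicit Types (a b h s p : {poly E}).

Lemma odd_card : odd #|E|.
Proof.
apply: contraT; rewrite -dvdn2 => /pnat_dvd /(_ (card_pchar E)).
by rewrite pnatE // inE (negPf char2) andbF.
Qed.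

Lemma euler_irreducible p a : p \is monic -> irreducible_poly p -> a != 0 ->
  polynorm p a ^+ (#|E|.-1)./2 = 1 -> exists m, p %| a - m ^+ 2.
Proof.
move=> mp ip; pose mi : monic_irreducible_poly p := conj ip mp.
pose phi : {rmorphism {poly E} -> {poly %/ p with mi}} := in_qpoly p.
have pE : mk_monic p = p by rewrite mk_monicE.
apply: (@euler_residue E {poly %/ p with mi} phi) => //.
- by move=> b; exists (val (b : {poly %/ p})); apply/val_inj; apply: in_qpoly_small; apply: size_mk_monic.
- move=> b; apply/eqP/idP => [/(congr1 val) /=|pb].
    by rewrite pE -Pdiv.IdomainMonic.modpE // => /eqP.
  by apply/val_inj; rewrite /= pE -Pdiv.IdomainMonic.modpE //; apply/eqP.
- exact: card_qfpoly.
- exact: odd_card.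
Qed.

Local Notation e := (#|E|.-1)./2.

Definition quadratic_character (c : E) : int :=
  if c == 0 then 0 else if c ^+ e == 1 then 1 else -1.
Local Notation eta := quadratic_character.

Lemma sqr_expf_half (c : E) : c != 0 -> (c ^+ 2) ^+ e = 1.
Proof.
move=> c0; have [m m0 mE] := finField_odd_card odd_card.
have -> : e = m by rewrite mE /= muln2 doubleK.
by rewrite -exprM; apply: (mulIf c0); rewrite -exprSr mulnC -mE expf_card mul1r.
Qed.

Lemma quadratic_character_sqr c : c != 0 -> eta (c ^+ 2) = 1.
Proof. by move=> c0; rewrite /eta expf_eq0 (negPf c0) sqr_expf_half ?eqxx. Qed.

Lemma quadratic_characterM c d : eta (c * d) = eta c * eta d.
Proof.
rewrite /eta mulf_eq0; have [|c0] := eqVneq c 0; first by rewrite mul0r.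
have [|d0] /= := eqVneq d 0; first by rewrite mulr0.
have two (x : E) : x != 0 -> x ^+ e = 1 \/ x ^+ e = -1.
  move=> x0; have /eqP := sqr_expf_half x0.
  by rewrite exprAC sqrf_eq1 => /orP[/eqP|/eqP]; [left|right].
have m1 : (-1 == 1 :> E) = false.
  by apply: contraNF char2 => /eqP m1; rewrite mulr2n -{1}m1 addNr.
by rewrite exprMn; case: (two c c0) => ->; case: (two d d0) => ->;
  rewrite ?mul1r ?mulr1 ?mulrNN ?mul1r ?eqxx ?m1.
Qed.

(** The symbol of g is read off its class modulo h by reciprocity, and scaling s by the
constant c makes it 1 on the whole class, as D is odd; the same constant is divided
out of the solution. *)
Lemma finite_symbol_solvable h s : h != 0 -> odd (dg h) -> coprimep s h -> symbol_solvable h s.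
Proof.
move=> h0 oD csh; pose chi a := eta (polynorm a h).
(* With this constant the norm of h modulo g is a square for every monic g of degree
   2D - 1 congruent to c s modulo h. *)
pose c := - lead_coef h * polynorm h s.
have c0 : c != 0 by rewrite mulf_neq0 ?polynorm_neq0 // oppr_eq0 lead_coef_eq0.
have [||||||f [w [m [mf w0 hf fm]]]] :=
  @class_square_part E h chi _ _ _ _ _ (c *: s) h0 oD.
- by move=> a b ma mb; rewrite /chi polynorm_modulusM ?(monic_neq0 ma) ?(monic_neq0 mb) // quadratic_characterM.
- by rewrite /chi polynorm_modulus1 -(expr1n _ 2) quadratic_character_sqr ?oner_neq0.
- by move=> a; rewrite /chi /eta; case: ifP => // _; case: ifP.
- move=> p mp ip; rewrite /chi /eta; case: ifP => [/eqP p0 _|_].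
    exists 0; rewrite expr0n subr0; apply: contraT => ph.
    have chp : coprimep h p by rewrite coprimep_sym irreducible_poly_coprime.
    by have := polynorm_neq0 (monic_neq0 mp) chp; rewrite p0 eqxx.
  by case: ifP => // /eqP /euler_irreducible H _; apply: H.
- move=> a ma; apply: contraNT; rewrite /coprimep => ncop.
  have a0 := monic_neq0 ma.
  have aE : a = gcdp a h * (a %/ gcdp a h) by rewrite mulrC divpK ?dvdp_gcdl.
  have := a0; rewrite {1}aE mulf_eq0 negb_or => /andP[d0 q0].
  rewrite /chi aE polynorm_modulusM // (@polynorm_mod _ _ h 0%:P) //; last first.
    by rewrite mod0p; apply/modp_eq0P/dvdp_gcdr.
  rewrite polynormC // expr0n gtn_eqF; first by rewrite mul0r /eta eqxx.
  by move: d0 ncop; rewrite -size_poly_eq0; case: (size _) => [|[|k]].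
- move=> g mg sg hg; have [j DE] : exists j, dg h = (j.*2).+1.
    by exists (dg h)./2; rewrite -[LHS]odd_double_half oD.
  have := polynorm_reciprocity (monic_neq0 mg) h0.
  rewrite (monicP mg) expr1n mulr1 -signr_odd oddM sg oD andbT.
  have -> : odd (dg h).*2.-1 by rewrite DE doubleS /= odd_double.
  have -> : polynorm h g = polynorm h (c%:P * s).
    apply: polynorm_mod => //; apply/eqP; rewrite -subr_eq0 -modpN -modpD; apply/eqP/modp_eq0P.
    by rewrite mul_polyC.
  rewrite expr1 polynormM // polynormC // DE doubleS /= => gE.
  rewrite /chi gE (_ : _ * _ = (c ^+ j.+1 * lead_coef h ^+ j.*2) ^+ 2).
    by rewrite quadratic_character_sqr // mulf_neq0 ?expf_neq0 // lead_coef_eq0.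
  have -> : (c ^+ j.+1 * lead_coef h ^+ j.*2) ^+ 2 = c ^+ j.*2.+1 * c * lead_coef h ^+ j.*2.*2.
    by rewrite exprMn -!exprM !muln2 doubleS exprSr.
  rewrite [lead_coef h ^+ _.+1]exprSr; move: (c ^+ _) (lead_coef h ^+ _) => C L; rewrite /c; ring.
have w0h : coprimep (f * w ^+ 2) h by apply: coprimep_congr hf _; rewrite coprimepZl.
have [cfh cwh] : coprimep f h /\ coprimep w h.
  by move: w0h; rewrite coprimepMl coprimep_pexpl // => /andP.
have [t tE] := inverse_modp cwh.
exists (c^-1 *: f), t, m; split.
- by rewrite scaler_eq0 negb_or invr_eq0 c0 monic_neq0.
- by rewrite coprimepZl // invr_eq0.
- have -> : c^-1 *: f - s * t ^+ 2 = c^-1 *: (f - (c *: s) * t ^+ 2).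
    by rewrite scalerBr -scalerAl scalerA mulVf // scale1r.
  rewrite dvdpZr ?invr_eq0 //.
  have -> : f - (c *: s) * t ^+ 2 =
      (f * w ^+ 2 - c *: s) * t ^+ 2 - (w * t - 1) * (f * (w * t + 1)) by ring.
  by rewrite dvdp_sub // dvdp_mulr.
- by rewrite dvdpZl // invr_eq0.
Qed.
End FiniteSolvable.

(** * Common values of ternary forms *)

Section TernaryValue.
Variable K : fieldType.
Implicit Types a b t : K.

(** Either <a, b, ab> is isotropic or it represents t; over a field of characteristic
different from 2 the form represents t in both cases. *)
Definition ternary_value a b t := exists d1 d2 d3 d4,
  [|| d1 != 0, d2 != 0, d3 != 0 | d4 != 0] /\
  a * d1 ^+ 2 + b * d2 ^+ 2 + a * b * d3 ^+ 2 = t * d4 ^+ 2.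

Lemma ternary_value_squares a b t r s : r != 0 -> s != 0 ->
  ternary_value (a * r ^+ 2) (b * s ^+ 2) t -> ternary_value a b t.
Proof.
move=> r0 s0 [d1 [d2 [d3 [d4 [nz dE]]]]].
exists (d1 * r), (d2 * s), (d3 * (r * s)), d4; split.
  by rewrite !mulf_eq0 (negPf r0) (negPf s0) !orbF.
by rewrite -dE; ring.
Qed.

Lemma ternary_value_squaresV a b t r s : r != 0 -> s != 0 ->
  ternary_value a b t -> ternary_value (a * r ^+ 2) (b * s ^+ 2) t.
Proof.
move=> r0 s0 H; apply: (@ternary_value_squares _ _ _ r^-1 s^-1); rewrite ?invr_eq0 //.
by rewrite -(mulrA a) -(mulrA b) -!exprMn !mulfV // expr1n !mulr1.
Qed.
End TernaryValue.

Section CommonValue.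
Variable E : fieldType.
Hypothesis char2 : (2%:R : E) != 0.
Hypothesis wsrE : weakly_square_reflexive E.

(** The isotropic vector of <x, y, z, -k> is scaled by xyz, and squares are absorbed. *)
Lemma linked_value (K : fieldType) (phi : {rmorphism {poly E} -> K}) (x y z k s m1 m2 : {poly E}) :
  injective phi -> m1 != 0 -> m2 != 0 ->
  squarefree (- (x * y * z * k)) -> residue_cond x y z k s ->
  symbol_solvable (- (x * y * z * k)) s ->
  ternary_value (phi (y * z * m1 ^+ 2)) (phi (x * z * m2 ^+ 2)) (phi (x * y * z * k)).
Proof.
move=> inj m10 m20 sf rc sv.
have phi0 p : (phi p == 0) = (p == 0) by rewrite -(inj_eq inj) rmorph0.
have [v v0 vE] := common_slot char2 phi (ternary_isotropic_const char2 wsrE) sf rc sv.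
have := squarefree_neq0 sf; rewrite oppr_eq0 !mulf_eq0 !negb_or => /andP[/andP[/andP[x0 y0] z0] k0].
rewrite [phi (y * z * _)]rmorphM [phi (x * z * _)]rmorphM !rmorphXn.
apply: ternary_value_squaresV; rewrite ?phi0 // !rmorphM.
move: vE; have : [|| v 0 0 != 0, v 0 1 != 0, v 0 2%:R != 0 | v 0 3%:R != 0].
  apply: contraNT v0; rewrite !negb_or !negbK => /and4P[/eqP h0 /eqP h1 /eqP h2 /eqP h3].
  apply/eqP/rowP => i; rewrite mxE; case: i => [[|[|[|[|//]]]] ip].
  - by rewrite -[RHS]h0; congr (v 0 _); apply/val_inj.
  - by rewrite -[RHS]h1; congr (v 0 _); apply/val_inj.
  - by rewrite -[RHS]h2; congr (v 0 _); apply/val_inj.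
  - by rewrite -[RHS]h3; congr (v 0 _); apply/val_inj.
move: (v 0 0) (v 0 1) (v 0 2%:R) (v 0 3%:R) => c1 c2 c3 c4 nz vE.
exists (phi x * c1), (phi y * c2), c3, c4; split.
  by rewrite !mulf_eq0 !phi0 (negPf x0) (negPf y0).
transitivity (phi x * phi y * phi z * (phi k * c4 ^+ 2)); first by rewrite -vE; ring.
by ring.
Qed.

(** The quaternion algebras attached to the forms are ramified, away from infinity, only
at primes of f. *)
Lemma common_class_modulus m (A B : 'I_m -> {poly E}) :
  (forall i, A i != 0) -> (forall i, B i != 0) ->
  exists2 f : {poly E}, squarefree f & forall h, h != 0 -> f %| h -> forall i,
    exists x y z k m1 m2 : {poly E}, [/\ h = - (x * y * z * k), m1 != 0, m2 != 0,
      A i = y * z * m1 ^+ 2 & B i = x * z * m2 ^+ 2].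
Proof.
move=> A0 B0.
have /fin_all_exists[d dP] (i : 'I_m) : exists d : {poly E} * {poly E} * {poly E},
    let: (x, y, z) := d in squarefree (x * y * z) /\ exists m1 m2,
    [/\ m1 != 0, m2 != 0, A i = y * z * m1 ^+ 2 & B i = x * z * m2 ^+ 2].
  have [x [y [z [m1 [m2 [sf m10 m20 AE BE]]]]]] := coprime_square_classes (A0 i) (B0 i).
  by exists (x, y, z); split=> //; exists m1, m2.
have [|f sf fP] := @squarefree_common_multiple E m (fun i => (d i).1.1 * (d i).1.2 * (d i).2).
  by move=> i; have := dP i; case: (d i) => [[x y] z] [].
exists f => // h h0 fh i; have := dP i; have := fP i; case: (d i) => [[x y] z] /= xf [_ [m1 [m2 [m10 m20 AE BE]]]].
have /dvdpP[k hE] := dvdp_trans xf fh.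
by exists x, y, z, (- k), m1, m2; split => //; rewrite hE; ring.
Qed.

(** Even degrees make deg x, deg y, deg z of the same parity. *)
Lemma common_value_even (K : fieldType) (phi : {rmorphism {poly E} -> K}) m (A B : 'I_m -> {poly E}) :
  injective phi -> (forall i, A i != 0) -> (forall i, B i != 0) ->
  (forall i, ~~ odd (dg (A i))) -> (forall i, ~~ odd (dg (B i))) ->
  exists2 t, t != 0 & forall i, ternary_value (phi (A i)) (phi (B i)) t.
Proof.
move=> inj A0 B0 eA eB; have [f sf fP] := common_class_modulus A0 B0.
have [h hr fh] := wsrE sf; have [h0 sh _] := hr.
exists (- phi h); first by rewrite oppr_eq0 -(rmorph0 phi) (inj_eq inj).
move=> i; have [x [y [z [k [m1 [m2 [hE m10 m20 AE BE]]]]]]] := fP h h0 fh i.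
have := h0; rewrite hE oppr_eq0 !mulf_eq0 !negb_or => /andP[/andP[/andP[x0 y0] z0] k0].
have par (a b c : {poly E}) : a != 0 -> b != 0 -> c != 0 -> ~~ odd (dg (a * b * c ^+ 2)%R) ->
    odd (dg a) = odd (dg b).
  by move=> a0 b0 c0; rewrite expr2 !degM ?mulf_neq0 // addnn oddD odd_double addbF oddD; case: odd; case: odd.
have [|||s rc sv] := @residue_cond_solvable E x y z k.
- by rewrite -hE.
- by have := eB i; rewrite BE; apply: par.
- by have := eA i; rewrite AE; apply: par.
rewrite AE BE -rmorphN opprK; apply: linked_value inj m10 m20 _ rc sv.
by rewrite -hE.
Qed.

Lemma common_value_solvable (K : fieldType) (phi : {rmorphism {poly E} -> K}) m (A B : 'I_m -> {poly E}) :
  injective phi -> (forall h s : {poly E}, h != 0 -> odd (dg h) -> coprimep s h -> symbol_solvable h s) ->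
  (forall i, A i != 0) -> (forall i, B i != 0) ->
  exists2 t, t != 0 & forall i, ternary_value (phi (A i)) (phi (B i)) t.
Proof.
move=> inj solv A0 B0; have [f sf fP] := common_class_modulus A0 B0.
have f0 := squarefree_neq0 sf.
have [h [sh oh fh]] : exists h, [/\ squarefree h, odd (dg h) & f %| h].
  have [odf|ef] := boolP (odd (dg f)); first by exists f.
  (* A prime-to-f polynomial of odd degree, whose squarefree part is multiplied to f. *)
  have g0 : 1 + f * 'X != 0 :> {poly E}.
    by apply/eqP => /(congr1 (horner_eval 0)); rewrite /horner_eval !hornerE => /eqP; rewrite oner_eq0.
  have [e [w [se w0 eE]]] := squarefree_part g0.
  have e0 := squarefree_neq0 se.
  have cef : coprimep f e.
    have : coprimep (e * w ^+ 2) f.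
      by rewrite -eE; apply: (@coprimep_congr _ _ _ 1); rewrite ?coprime1p // addrAC subrr add0r dvdp_mulIl.
    by rewrite coprimepMl coprimep_sym => /andP[].
  have sz : size (1 + f * 'X)%R = (size f).+1.
    by rewrite addrC size_polyDl ?size_mulX // size_poly1 ltnS size_poly_gt0.
  exists (f * e); split; [exact: squarefreeM| |exact: dvdp_mulIl].
  have : dg (e * w ^+ 2)%R = (dg f).+1 by rewrite -eE sz prednK // size_poly_gt0.
  rewrite expr2 !degM ?mulf_neq0 // addnn => dE.
  have := congr1 odd dE; rewrite oddD odd_double addbF /= => oe.
  by rewrite oddD oe (negPf ef).
have h0 := squarefree_neq0 sh.
exists (- phi h); first by rewrite oppr_eq0 -(rmorph0 phi) (inj_eq inj).
move=> i; have [x [y [z [k [m1 [m2 [hE m10 m20 AE BE]]]]]]] := fP h h0 fh i.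
rewrite hE in sh h0 oh *; have [s [s0 rc csh]] := residue_cond_exists sh.
rewrite AE BE -rmorphN opprK; apply: linked_value inj m10 m20 sh rc _.
exact: solv.
Qed.

End CommonValue.

(** * Moving the point at infinity *)

Section Reversal.
Variable E : fieldType.
Implicit Types (f : {poly E}) (N : nat).

(** X^N f(1/X); the exponent N is free so that reversed polynomials can have a prescribed
degree. *)
Definition polyrev N f := \poly_(i < N.+1) f`_(N - i).

Lemma polyrevK N f : (size f <= N.+1)%N -> polyrev N (polyrev N f) = f.
Proof.
move=> sf; apply/polyP => i; rewrite coef_poly; case: ltnP => iN; last first.
  by rewrite (leq_sizeP _ _ sf).
by rewrite coef_poly ltnS leq_subr subKn.
Qed.

Lemma size_polyrev N f : f`_0 != 0 -> size (polyrev N f) = N.+1.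
Proof. by move=> f0; rewrite size_poly_eq // subnn. Qed.

Variables (K : fieldType) (iota : {rmorphism {poly E} -> K}) (r : E).
Hypothesis inj : injective iota.

Let u : K := iota ('X - r%:P).
Let psi : {rmorphism E -> K} := iota \o polyC.
Let phi : {rmorphism {poly E} -> K} := horner_eval u^-1 \o map_poly psi.

Lemma iota_eq0 f : (iota f == 0) = (f == 0).
Proof. by rewrite -(inj_eq inj) rmorph0. Qed.

Lemma infinity_coordinate_neq0 : u != 0.
Proof. by rewrite iota_eq0 polyXsubC_eq0. Qed.

(** Substituting 1/(X - r) in f and clearing denominators. *)
Lemma polyrev_shift N f : (size f <= N.+1)%N ->
  iota (polyrev N f \Po ('X - r%:P)) = u ^+ N * phi f.
Proof.
move=> sf; have u0 := infinity_coordinate_neq0.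
have -> : phi f = \sum_(i < N.+1) psi f`_i * u^-1 ^+ i.
  rewrite {1}(poly_sum sf) rmorph_sum; apply: eq_bigr => i _.
  by rewrite /= /horner_eval map_polyZ map_polyXn hornerZ hornerXn.
rewrite /polyrev poly_def raddf_sum rmorph_sum mulr_sumr [RHS](reindex_inj rev_ord_inj).
apply: eq_bigr => i _ /=; have iN : (i <= N)%N by rewrite -ltnS.
rewrite comp_polyZ comp_Xn_poly -mul_polyC rmorphM rmorphXn subSS mulrCA; congr (_ * _).
have -> : u ^+ N = u ^+ (N - i) * u ^+ i by rewrite -exprD subnK.
by rewrite exprVn mulrAC mulfV ?mul1r // expf_neq0.
Qed.

Lemma infinity_coordinate_inj : injective phi.
Proof.
apply: raddf_inj => f f0; have sf := leqnSn (size f).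
have := polyrev_shift sf; rewrite f0 mulr0 => /eqP; rewrite iota_eq0 => /eqP H.
rewrite -(polyrevK sf).
have <- : (polyrev (size f) f \Po ('X - r%:P)) \Po ('X + r%:P) = polyrev (size f) f.
  by rewrite -comp_polyA comp_polyB comp_polyX comp_polyC addrK comp_polyXr.
by rewrite H comp_poly0; apply/polyP => i; rewrite coef_poly !coef0 if_same.
Qed.

Hypothesis char2 : (2%:R : E) != 0.
Hypothesis wsrE : weakly_square_reflexive E.

(** At r the polynomials are units, so in the coordinate 1/(X - r) they become, up to
even powers of X - r, polynomials of even degree. *)
Lemma common_value_nonroot m (A B : 'I_m -> {poly E}) :
  (forall i, (A i).[r] != 0) -> (forall i, (B i).[r] != 0) ->
  exists2 t, t != 0 & forall i, ternary_value (iota (A i)) (iota (B i)) t.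
Proof.
move=> Ar Br; have u0 := infinity_coordinate_neq0.
pose rv f := polyrev (size f).*2 (f \Po ('X + r%:P)).
have rv_size f : f.[r] != 0 -> size (rv f) = (size f).*2.+1.
  move=> fr; apply: size_polyrev.
  by rewrite -horner_coef0 horner_comp !hornerE.
have rvE f : iota f = phi (rv f) * (u ^+ size f) ^+ 2.
  rewrite -exprM muln2 mulrC -polyrev_shift; last first.
    exact: size_poly.
  rewrite polyrevK; last first.
    by rewrite size_comp_poly2 ?size_XaddC // (leq_trans _ (leqnSn _)) // -addnn leq_addr.
  by rewrite -comp_polyA comp_polyD comp_polyX comp_polyC subrK comp_polyXr.
have rv0 f : f.[r] != 0 -> rv f != 0 by move=> fr; rewrite -size_poly_eq0 rv_size.
have [||||t t0 tP] := common_value_even char2 wsrE infinity_coordinate_inj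
    (A := fun i => rv (A i)) (B := fun i => rv (B i)).
- by move=> i; apply: rv0.
- by move=> i; apply: rv0.
- by move=> i; rewrite rv_size // odd_double.
- by move=> i; rewrite rv_size // odd_double.
exists t => // i; rewrite !rvE; apply: ternary_value_squaresV; rewrite ?expf_neq0 //.
Qed.
End Reversal.

Lemma infinite_uniq (T : eqType) : ~ (exists s : seq T, forall x, x \in s) ->
  forall n, exists2 s : seq T, uniq s & size s = n.
Proof.
move=> inf; elim=> [|n [s us <-]]; first by exists [::].
have [x xs] : exists x, x \notin s.
  apply: NNPP => no; apply: inf; exists s => x.
  by apply: contraT => xs; case: no; exists x.
by exists (x :: s); rewrite //= xs.
Qed.

Section CommonValueFrac.
Variable E : fieldType.
Hypothesis char2 : (2%:R : E) != 0.
Hypothesis wsrE : weakly_square_reflexive E.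

Lemma finite_field_solvable (s : seq E) : (forall x, x \in s) ->
  forall h g : {poly E}, h != 0 -> odd (size h).-1 -> coprimep g h -> symbol_solvable h g.
Proof.
move=> sP.
have ax : Finite.axiom (undup s).
  by move=> x; rewrite count_uniq_mem ?undup_uniq // mem_undup sP.
have pK : pcancel (fun x => index x s) (nth None [seq Some x | x <- s]).
  by move=> x; rewrite (nth_map x) ?index_mem // nth_index.
pose E' : finFieldType := HB.pack E (isCountable.Build E pK) (isFinite.Build E ax).
exact: (@finite_symbol_solvable E' char2).
Qed.

Lemma common_value_poly (K : fieldType) (iota : {rmorphism {poly E} -> K}) m (A B : 'I_m -> {poly E}) :
  injective iota -> (forall i, A i != 0) -> (forall i, B i != 0) ->
  exists2 t, t != 0 & forall i, ternary_value (iota (A i)) (iota (B i)) t.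
Proof.
move=> inj A0 B0; have [[s sP]|inf] := classic (exists s : seq E, forall x, x \in s).
  by apply: common_value_solvable => // h g; apply: (finite_field_solvable sP).
pose P := \prod_i (A i * B i).
have P0 : P != 0 by apply/prodf_neq0 => i _; rewrite mulf_neq0.
have [r rP] : exists r, ~~ root P r.
  have [s us sz] := infinite_uniq inf (size P).
  have [aP|] := boolP (all (root P) s); last by case/allPn => r _; exists r.
  by have := max_poly_roots P0 aP us; rewrite sz ltnn.
have ABr i : ((A i).[r] != 0) && ((B i).[r] != 0).
  rewrite -negb_or -mulf_eq0 -hornerM; apply: contra rP => /eqP ABr.
  by rewrite rootE horner_prod (bigD1 i) //= ABr mul0r.
by apply: (common_value_nonroot (r := r)) => // i; have /andP[] := ABr i.
Qed.

Lemma common_value_frac m (a b : 'I_m -> {fraction {poly E}}) :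
  (forall i, a i != 0) -> (forall i, b i != 0) ->
  exists2 t, t != 0 & forall i, ternary_value (a i) (b i) t.
Proof.
move=> a0 b0.
have /fin_all_exists[A AP] i := frac_square_class (a0 i).
have /fin_all_exists[B BP] i := frac_square_class (b0 i).
have A0 i : A i != 0 by have [s []] := AP i.
have B0 i : B i != 0 by have [s []] := BP i.
have [t t0 tP] := common_value_poly (@tofrac_inj E) A0 B0.
exists t => // i; have [r [_ r0 ->]] := AP i; have [s [_ s0 ->]] := BP i.
exact (@ternary_value_squaresV _ _ _ _ _ _ r0 s0 (tP i)).
Qed.
End CommonValueFrac.

(** * Ternary and quinary forms over a field *)

Section Forms.
Variable K : fieldType.
Hypothesis char2 : (2%:R : K) != 0.

(** The value at l v + e_i is affine in l, with slope 2 d_i v_i. *)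
Lemma diag_isotropic_universal n (d v : 'rV[K]_n) : (forall i, d 0 i != 0) -> v != 0 ->
  \sum_i d 0 i * v 0 i ^+ 2 = 0 -> forall t, exists w : 'rV[K]_n,
  \sum_i d 0 i * w 0 i ^+ 2 = t.
Proof.
move=> d0 v0 qv t.
have [i vi] : exists i, v 0 i != 0.
  apply: NNPP => no; case/eqP: v0; apply/rowP => i; rewrite mxE.
  by apply/eqP/negPn/negP => vi; apply: no; exists i.
pose l := (t - d 0 i) / (2%:R * d 0 i * v 0 i).
exists (l *: v + delta_mx 0 i).
have <- : l ^+ 2 * (\sum_j d 0 j * v 0 j ^+ 2) + d 0 i * (2%:R * l * v 0 i + 1) = t.
  rewrite qv mulr0 add0r /l; field.
  by rewrite char2 d0 vi.
rewrite mulr_sumr (bigD1 i) //= [in RHS](bigD1 i) //= addrAC; congr (_ + _).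
  by rewrite !mxE !eqxx /=; ring.
by apply: eq_bigr => j ji; rewrite !mxE eqxx (negPf ji) /= addr0; ring.
Qed.

Lemma sum3 (F : 'I_3 -> K) : \sum_i F i = F 0 + F 1 + F 2%:R.
Proof.
rewrite !big_ord_recl big_ord0 addr0 addrA; congr (_ + F _ + F _); exact/val_inj.
Qed.

Lemma prod3 (F : 'I_3 -> K) : \prod_i F i = F 0 * F 1 * F 2%:R.
Proof.
by rewrite !big_ord_recl big_ord0 mulr1 mulrA; congr (_ * F _ * F _); exact/val_inj.
Qed.

Definition diag3 (a b c : K) (v : K * K * K) : K :=
  a * v.1.1 ^+ 2 + b * v.1.2 ^+ 2 + c * v.2 ^+ 2.

Definition row3 (v : K * K * K) : 'rV[K]_3 := \row_i nth 0 [:: v.1.1; v.1.2; v.2] i.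

Lemma row3K (w : 'rV[K]_3) : row3 (w 0 0, w 0 1, w 0 2%:R) = w.
Proof.
by apply/rowP => i; rewrite mxE; case: i => [[|[|[|//]]]] ip /=; congr (w 0 _); apply/val_inj.
Qed.

Lemma diag3E a b c v : diag3 a b c v = qf (diag_mx (row3 (a, b, c))) (row3 v).
Proof. by rewrite qf_diag sum3 !mxE. Qed.

Lemma row3_eq0 v : row3 v = 0 -> v = 0.
Proof.
case: v => [[x y] z] v0; have v0i (i : 'I_3) := congr1 (fun w : 'rV[K]_3 => w 0 i) v0.
by move: (v0i 0) (v0i 1) (v0i 2%:R); rewrite !mxE /= => -> -> ->.
Qed.

Lemma diag3_universal a b c v t : a != 0 -> b != 0 -> c != 0 -> v != 0 ->
  diag3 a b c v = 0 -> exists w, diag3 a b c w = t.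
Proof.
move=> a0 b0 c0 v0 qv.
have [|||w wE] := @diag_isotropic_universal _ (row3 (a, b, c)) (row3 v) _ _ _ t.
- by case=> [[|[|[|//]]]] ip; rewrite mxE.
- by apply: contra_neq v0; apply: row3_eq0.
- by rewrite -qf_diag -diag3E.
by exists (w 0 0, w 0 1, w 0 2%:R); rewrite diag3E row3K qf_diag.
Qed.

(** A vector of nonzero value is the first vector of an orthogonal basis; T is the change
of coordinates. *)
Lemma diag3_split (a b c : K) u : a != 0 -> b != 0 -> c != 0 -> diag3 a b c u != 0 ->
  exists m n w (T : K * K * K -> K * K * K),
  [/\ m != 0, n != 0, w != 0 & diag3 a b c u * m * n = a * b * c * w ^+ 2] /\
  (forall x, T x = 0 -> x = 0) /\
  forall x, diag3 a b c (T x) = diag3 (diag3 a b c u) m n x.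
Proof.
move=> a0 b0 c0; rewrite {1}diag3E => qu.
have [U Uu [d [s [s0 dE UE]]]] := diagonalize_value char2 (tr_diag_mx _) qu.
have detE : d 0 0 * d 0 1 * d 0 2%:R = a * b * c * (\det U) ^+ 2.
  have := congr1 determinant UE; rewrite !det_mulmx det_tr !det_diag.
  by rewrite !prod3 !mxE /= => <-; ring.
have detU : \det U != 0 by rewrite -unitfE -unitmxE.
have : d 0 0 * d 0 1 * d 0 2%:R != 0 by rewrite detE !mulf_neq0 ?expf_neq0.
rewrite !mulf_eq0 !negb_or -andbA => /and3P[d00 d10 d20].
pose T (x : K * K * K) : K * K * K :=
  let w := row3 (x.1.1 * s, x.1.2, x.2) *m U in (w 0 0, w 0 1, w 0 2%:R).
exists (d 0 1), (d 0 2%:R), (\det U * s), T; rewrite mulf_neq0 //; split; [split=> //|split].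
- rewrite diag3E dE; transitivity (d 0 0 * d 0 1 * d 0 2%:R * s ^+ 2); first by ring.
  by rewrite detE; ring.
- move=> [[x y] z] /(congr1 row3); rewrite row3K /= => /(congr1 (mulmx^~ (invmx U))).
  rewrite mulmxK // (_ : row3 0 = 0) ?mul0mx => [/row3_eq0 [/eqP]|]; last first.
    by apply/rowP => i; rewrite !mxE; case: i => [[|[|[|//]]]].
  by rewrite mulf_eq0 (negPf s0) orbF => /eqP -> -> ->.
move=> x; rewrite [LHS]diag3E row3K -qf_congr UE qf_diag sum3 !mxE /=.
by rewrite /diag3 -/(diag3 a b c u) diag3E dE /=; ring.
Qed.

Lemma qform_diagonal n (q : qform K n) : exists2 U, U \in unitmx & exists d : 'rV[K]_n,
  [/\ (forall i, d 0 i != 0), \prod_i d 0 i = \det (gram q) * \det U ^+ 2 &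
    forall v, qvalue q (v *m U) = \sum_i d 0 i * v 0 i ^+ 2].
Proof.
have [U Uu [d UE]] := diagonalize char2 (gram_sym q).
have dE : \prod_i d 0 i = \det (gram q) * \det U ^+ 2.
  by rewrite -det_diag -UE !det_mulmx det_tr; ring.
exists U => //; exists d; split=> // [i|v]; last by rewrite -qf_diag -UE qf_congr.
have : \prod_i d 0 i != 0.
  by rewrite dE mulf_neq0 ?expf_neq0 // -unitfE -unitmxE // gram_regular.
by rewrite (bigD1 i) //= mulf_eq0 negb_or => /andP[].
Qed.

(** The third diagonal entry is ab up to a square. *)
Lemma trivial_det_slots (q : qform K 3) : trivial_det q -> exists a b : K,
  [/\ a != 0, b != 0 & forall t, ternary_value a b t -> represents q t].
Proof.
case=> x [y xy1] qE; have [U Uu [d [d0 dE qd]]] := qform_diagonal q.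
rewrite prod3 qE -exprMn in dE.
have s0 : x * \det U != 0.
  by rewrite -sqrf_eq0 -dE !mulf_neq0.
move: (x * _) s0 dE => s s0 dE; exists (d 0 0), (d 0 1); split=> // t.
case=> c1 [c2 [c3 [c4 [nz cE]]]].
pose w := (c1, c2, c3 * (d 0 0 * d 0 1) / s).
have wE : \sum_i d 0 i * row3 w 0 i ^+ 2 = t * c4 ^+ 2.
  rewrite -cE sum3 !mxE /=; congr (_ + _).
  rewrite exprMn exprVn -dE; move: (d0 0) (d0 1) (d0 2%:R); move: (d 0 0) (d 0 1) (d 0 2%:R).
  by move=> a b c a0 b0 cn0; field; rewrite cn0 b0 a0.
have [w' w'E] : exists w' : 'rV[K]_3, \sum_i d 0 i * w' 0 i ^+ 2 = t.
  have [c40|c40] := eqVneq c4 0; last first.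
    exists (c4^-1 *: row3 w); rewrite -[RHS](mulfK (expf_neq0 2 c40)) -wE mulr_suml.
    by apply: eq_bigr => i _; rewrite [in LHS]mxE; field.
  apply: (diag_isotropic_universal (v := row3 w)) => //; last by rewrite wE c40 expr0n mulr0.
  apply/eqP => /row3_eq0 [c10 c20 /eqP]; rewrite !mulf_eq0 invr_eq0 (negPf s0) !(negPf (d0 _)) !orbF.
  by move=> /eqP c30; move: nz; rewrite c10 c20 c30 c40 eqxx.
by exists (w' *m U); rewrite qd.
Qed.

Hypothesis common_value : forall m (a b : 'I_m -> K),
  (forall i, a i != 0) -> (forall i, b i != 0) ->
  exists2 t, t != 0 & forall i, ternary_value (a i) (b i) t.

Lemma ternary_common_value m (q : 'I_m -> qform K 3) : (forall i, trivial_det (q i)) ->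
  exists2 c : K, c != 0 & forall i, represents (q i) c.
Proof.
move=> qdet; have /fin_all_exists[a aP] i := trivial_det_slots (qdet i).
have /fin_all_exists[b bP] i := aP i.
have [||t t0 tP] := @common_value m a b; try by move=> i; have [] := bP i.
by exists t => // i; have [_ _] := bP i; apply.
Qed.

Hypothesis pfister : forall u v e : K, u != 0 -> v != 0 -> e != 0 -> pfister_isotropic u v e.

(** <m, n, al, be> is m times the norm form of (- mn, - m al); the vanishing of
<<- mn, - m al, - m del>> says that this form represents - del. *)
Lemma quaternary_value (m n al be del s : K) : m != 0 -> n != 0 -> al != 0 -> be != 0 -> del != 0 ->
  s != 0 -> m * n * al * be = s ^+ 2 ->
  exists p q x y z : K, [|| p != 0, q != 0, x != 0, y != 0 | z != 0] /\
    m * p ^+ 2 + n * q ^+ 2 + al * x ^+ 2 + be * y ^+ 2 + del * z ^+ 2 = 0.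
Proof.
move=> m0 n0 al0 be0 del0 s0 sE.
have red (a0 a1 a2 a3 z : K) : [|| a0 != 0, a1 != 0, a2 != 0, a3 != 0 | z != 0] ->
    m * qnorm (- (m * n)) (- (m * al)) (a0, a1, a2, a3) + del * z ^+ 2 = 0 ->
    exists p q x y z : K, [|| p != 0, q != 0, x != 0, y != 0 | z != 0] /\
    m * p ^+ 2 + n * q ^+ 2 + al * x ^+ 2 + be * y ^+ 2 + del * z ^+ 2 = 0.
  move=> nz qE; exists a0, (m * a1), (m * a2), (m * n * al * m * a3 / s), z; split.
    by rewrite !mulf_eq0 invr_eq0 (negPf s0) (negPf m0) (negPf n0) (negPf al0) !orbF.
  rewrite -{}qE /=; congr (_ + _); rewrite !exprMn exprVn -sE; field.
  by rewrite be0 al0 n0 m0.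
have [|||[[[a0 a1] a2] a3] [b [nz qE]]] := @pfister (- (m * n)) (- (m * al)) (- (m * del)).
- by rewrite oppr_eq0 mulf_neq0.
- by rewrite oppr_eq0 mulf_neq0.
- by rewrite oppr_eq0 mulf_neq0.
have [qb0|qb0] := eqVneq (qnorm (- (m * n)) (- (m * al)) b) 0.
  have [c [c0 qc]] : exists c, c != 0 /\ qnorm (- (m * n)) (- (m * al)) c = 0.
    case/orP: nz => [a_0|b_0]; last by exists b.
    by exists (a0, a1, a2, a3); rewrite qE qb0 mulr0.
  case: c c0 qc => [[[c0 c1] c2] c3]; rewrite quad_eq0 !negb_and => nzc qc.
  apply: (red c0 c1 c2 c3 0); first by rewrite eqxx orbF.
  by rewrite qc; ring.
have [c cE] : exists c, c = qmul (- (m * n)) (- (m * al)) (a0, a1, a2, a3) b by eexists.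
have := qnormM (- (m * n)) (- (m * al)) (a0, a1, a2, a3) b; rewrite -cE qE.
case: c cE => [[[c0 c1] c2] c3] _; move: qb0; move: (qnorm _ _ b) => N N0 qc.
apply: (red c0 c1 c2 c3 (m * N)); first by rewrite mulf_neq0 ?orbT.
by rewrite qc; ring.
Qed.

(** If <a, b, c> or <e, f, -del> is isotropic the conclusion is direct, the common value
of the two forms being taken by every isotropic form. *)
Lemma quinary_isotropic (a b c e f : K) : a != 0 -> b != 0 -> c != 0 -> e != 0 -> f != 0 ->
  exists v (x y : K), [|| v != 0, x != 0 | y != 0] /\
    diag3 a b c v + e * x ^+ 2 + f * y ^+ 2 = 0.
Proof.
move=> a0 b0 c0 e0 f0; pose P := a * b * c; pose del := P * e * f.
have P0 : P != 0 by rewrite !mulf_neq0.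
have del0 : del != 0 by rewrite !mulf_neq0.
have [||t t0 tP] := @common_value 2 (fun i => if i == 0 then b * c else - (P * e))
  (fun i => if i == 0 then a * c else - (P * f)).
- by move=> i; case: ifP; rewrite ?oppr_eq0 !mulf_neq0.
- by move=> i; case: ifP; rewrite ?oppr_eq0 !mulf_neq0.
pose tau := t / P; have tau0 : tau != 0 by rewrite mulf_neq0 ?invr_eq0.
have [[v0 [v0n qv0]]|noiso] :=
  classic (exists v, v != 0 /\ diag3 a b c v = 0).
  by exists v0, 0, 0; rewrite v0n qv0; split => //; ring.
have [u uE] : exists u, diag3 a b c u = tau.
  have [c1 [c2 [c3 [c4 [nz cE]]]]] := tP 0.
  have uE : diag3 a b c (c1 / a, c2 / b, c3) = tau * c4 ^+ 2.
    transitivity (t * c4 ^+ 2 / P); last by rewrite /tau; ring.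
    by rewrite -cE /diag3 /P /=; field; rewrite c0 b0 a0.
  have [c40|c40] := eqVneq c4 0.
    case: noiso; exists (c1 / a, c2 / b, c3); rewrite uE c40 expr0n mulr0; split => //.
    apply: contraTneq nz => -[/eqP + /eqP + ->]; rewrite !mulf_eq0 !invr_eq0 (negPf a0) (negPf b0) !orbF.
    by move=> /eqP -> /eqP ->; rewrite c40 eqxx.
  exists (c1 / a / c4, c2 / b / c4, c3 / c4); transitivity (tau * c4 ^+ 2 / c4 ^+ 2); last by field.
  by rewrite -uE /diag3 /=; field; rewrite c40 b0 a0.
have [w wE] : exists w, diag3 e f (- del) w = - tau.
  have [c1 [c2 [c3 [c4 [nz cE]]]]] := tP 1.
  have wE : diag3 e f (- del) (c1, c2, c3) = - tau * c4 ^+ 2.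
    transitivity (- (t * c4 ^+ 2) / P); last by rewrite /tau; ring.
    by rewrite -cE /diag3 /del /=; field.
  have [c40|c40] := eqVneq c4 0.
    apply: (diag3_universal (v := (c1, c2, c3))) => //; rewrite ?oppr_eq0 //.
      by apply: contraTneq nz => -[-> -> ->]; rewrite c40 eqxx.
    by rewrite wE c40 expr0n mulr0.
  exists (c1 / c4, c2 / c4, c3 / c4); transitivity (- tau * c4 ^+ 2 / c4 ^+ 2); last by field.
  by rewrite -wE /diag3 /=; field.
case: w wE => [[x y] z] wE; rewrite /diag3 /= in wE.
have [z0|z0] := eqVneq z 0.
  exists u, x, y; split; last by rewrite uE -[tau]opprK -wE z0; ring.
  by apply/orP; left; apply: contraNneq tau0 => u0; rewrite -uE u0 /diag3 /= !expr0n !mulr0 !addr0.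
have dz : diag3 tau e f (1, x, y) = del * z ^+ 2.
  rewrite /diag3 /=; transitivity (tau + (e * x ^+ 2 + f * y ^+ 2 + - del * z ^+ 2) + del * z ^+ 2).
    by ring.
  by rewrite wE; ring.
have dz0 : del * z ^+ 2 != 0 by rewrite mulf_neq0 ?expf_neq0.
have uE0 : diag3 a b c u != 0 by rewrite uE.
have [m [n [s [T [[m0 n0 s0 mnE] [Tinj TE]]]]]] := diag3_split a0 b0 c0 uE0.
have dE0 : diag3 tau e f (1, x, y) != 0 by rewrite dz.
have [al [be [r [T' [[al0 be0 r0 abE] [T'inj T'E]]]]]] := diag3_split tau0 e0 f0 dE0.
rewrite uE in mnE TE; rewrite dz in abE T'E.
have [|||||||p [q [x' [y' [z' [nz qE]]]]]] :=
  @quaternary_value m n al be (del * z ^+ 2) (s * r / z).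
- exact: m0.
- exact: n0.
- exact: al0.
- exact: be0.
- exact: dz0.
- by rewrite !mulf_neq0 ?invr_eq0 ?mulf_neq0.
- have td0 : tau * (del * z ^+ 2) != 0 by rewrite mulf_neq0.
  apply: (mulfI td0); transitivity ((tau * m * n) * (del * z ^+ 2 * al * be)); first by ring.
  by rewrite mnE abE /del /P; field.
pose R := T' (z', x', y'); pose S := T (R.1.1, p, q).
have RE := T'E (z', x', y'); have SE := TE (R.1.1, p, q); rewrite -/R -/S in RE SE.
exists S, R.1.2, R.2; split.
  apply: contraTT nz; rewrite !negb_or !negbK => /and3P[/eqP/Tinj [R1 -> ->] /eqP R2 /eqP R3].
  have /T'inj [-> -> ->] : T' (z', x', y') = 0; last by rewrite eqxx.
  by rewrite -/R; case: (R) R1 R2 R3 => [[r1 r2] r3] /= -> -> ->.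
rewrite SE -qE /diag3 /=; move: RE; rewrite /diag3 /= => RE.
transitivity (m * p ^+ 2 + n * q ^+ 2 + (tau * R.1.1 ^+ 2 + e * R.1.2 ^+ 2 + f * R.2 ^+ 2)); first by ring.
by rewrite RE; ring.
Qed.

Lemma quinary_qform_isotropic (q : qform K 5) : isotropic q.
Proof.
have [U Uu [d [d0 _ qd]]] := qform_diagonal q.
have [v [x [y [nz vE]]]] := quinary_isotropic (d0 0) (d0 1) (d0 2%:R) (d0 3%:R) (d0 4%:R).
pose w : 'rV[K]_5 := \row_i nth 0 [:: v.1.1; v.1.2; v.2; x; y] i.
exists (w *m U).
  apply: contraTneq nz => /(congr1 (mulmx^~ (invmx U))); rewrite mulmxK // mul0mx => w0.
  have wi (i : 'I_5) := congr1 (fun u : 'rV[K]_5 => u 0 i) w0.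
  move: (wi 0) (wi 1) (wi 2%:R) (wi 3%:R) (wi 4%:R); rewrite !mxE /= => v1 v2 v3 -> ->.
  by rewrite (_ : v = 0) ?eqxx //; case: (v) v1 v2 v3 => [[? ?] ?] /= -> -> ->.
rewrite qd -[RHS]vE !big_ord_recl big_ord0 addr0 /diag3 !addrA.
have o1 : lift ord0 (ord0 : 'I_4) = 1 by apply/val_inj.
have o2 : lift ord0 (lift ord0 (ord0 : 'I_3)) = 2%:R by apply/val_inj.
have o3 : lift ord0 (lift ord0 (lift ord0 (ord0 : 'I_2))) = 3%:R by apply/val_inj.
have o4 : lift ord0 (lift ord0 (lift ord0 (lift ord0 (ord0 : 'I_1)))) = 4%:R by apply/val_inj.
by rewrite o1 o2 o3 o4 !mxE.
Qed.
End Forms.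

(** * Forms over E(X) *)

Unset Implicit Arguments.

Theorem theoremC (E : fieldType) (charE : 2%N \notin [pchar E])
    (wsrE : weakly_square_reflexive E) :
  (forall q : qform {fraction {poly E}} 5, isotropic q)
  /\
  (forall (m : nat) (q : 'I_m -> qform {fraction {poly E}} 3),
     (forall i : 'I_m, trivial_det (q i)) ->
     exists2 c : {fraction {poly E}}, c != 0 & forall i : 'I_m, represents (q i) c).
Proof.
have char2 : (2%:R : E) != 0 by move: charE; rewrite inE.
have char2F : (2%:R : {fraction {poly E}}) != 0.
  have -> : 2%:R = @FracField.tofrac {poly E} 2%:R by rewrite rmorph_nat.
  by rewrite tofrac_eq0 -polyC_natr polyC_eq0.
split=> [q|m q qdet].
  exact (quinary_qform_isotropic char2F (common_value_frac char2 wsrE)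
    (pfister_isotropic_frac char2 wsrE) q).
exact (ternary_common_value char2F (common_value_frac char2 wsrE) qdet).
Qed.
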